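(* Let $l,m$ be positive integers with $m\le l$, and let $u,v$ be nonnegative functions (weights) on $\mathbf{R}^+=(0,+\infty)$ such that $u^{-2}\in B_\delta$ for some $\delta\ge0$ and $v^{-1}\in L_2(0,r)$ for all $r>0$. Then the space of pointwise multipliers $M(W_{2,u}^{(l)}\to W_{2,v}^{(m)})$ consists of exactly those functions $\varphi$ on $\mathbf{R}^+$ which satisfy the following two conditions: $$\|(\varphi x^k)^{(m)}v\|_2<+\infty,\qquad k=0,\dots,l-1,$$ $$\sup_{r>0}\ \|(\varphi x^k)^{(m)}v\|_{L_2(r,+\infty)}\cdot\|x^{l-k-1}u^{-1}\|_{L_2(0,r)}<+\infty,\qquad k=0,\dots,l-1,$$ and, in the case $m=l$, also the additional condition $$\|\varphi\, v\,u^{-1}\|_{L_\infty(\mathbf{R}^+)}<+\infty .$$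
   Context: $\mathbf{R}^+=(0,+\infty)$ and $\|\cdot\|_2=\|\cdot\|_{L_2(\mathbf{R}^+)}$. For $\delta\ge0$, $B_\delta$ denotes the set of positive locally integrable functions $w$ on $\mathbf{R}^+$ for which there is a constant $C_w$ such that $$\int_\Delta w(x)\,dx\le C_w\int_{\frac12\Delta}w(x)\,dx$$ for every (bounded) interval $\Delta\subset\mathbf{R}^+$ of length $|\Delta|\ge\delta$, where $\frac12\Delta$ is the interval with the same center as $\Delta$ and half its length. For a weight $u$ and a positive integer $l$, $W_{2,u}^{(l)}$ is the weighted Sobolev space of functions $f$ on $\mathbf{R}^+$ (having a locally integrable generalized derivative $f^{(l)}$ of order $l$ on $\mathbf{R}^+$) with finite norm $$\|f\|_{W_{2,u}^{(l)}}=\|f\|_{L_2(0,1)}+\|f^{(l)}u\|_2 .$$ The space $W_{2,v}^{(m)}$ is defined in the same way with $v,m$ in place of $u,l$. A function $\varphi$ is a (pointwise) multiplier from ${}^1W$ into ${}^2W$ if $\varphi f\in{}^2W$ for every $f\in{}^1W$; the set of all multipliers is denoted $M({}^1W\to{}^2W)$. Here $\varphi x^k$ denotes the function $x\mapsto\varphi(x)x^k$, derivatives are generalized (weak) derivatives, and the finiteness conditions include the requirement that the derivatives $(\varphi x^k)^{(m)}$ exist as locally integrable functions on $\mathbf{R}^+$. *)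

(* Defs.v *)
(* Functions on R^+ are functions R -> R of which only the
   values on ]0, +oo[ are ever used; "measurable" is Borel measurability, as for
   the library's lebesgue_measure. *)
From HB Require Import structures.
From mathcomp Require Export all_boot all_order all_algebra.
From mathcomp Require Export all_classical all_reals all_analysis measurable_realfun.
Export Order.TTheory GRing.Theory Num.Theory.
Export numFieldNormedType.Exports.

Set Implicit Arguments.
Unset Strict Implicit.
Unset Printing Implicit Defensive.

Local Open Scope classical_set_scope.
Local Open Scope ring_scope.

Definition Rpos (R : realType) : set R := [set` `]0, +oo[].
Arguments Rpos {R}.

Definition weight (R : realType) (w : R -> R) : Prop :=
  measurable_fun Rpos w /\ forall x, Rpos x -> 0 <= w x.

(* Extended-valued, so that the inverse of a weight is +oo where the weight
   vanishes: [(0%:E)^-1 = +oo] for the library's inverse on \bar R. *)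
Definition wpow_inv (R : realType) (w : R -> R) (n : nat) : R -> \bar R :=
  fun x => (((w x) ^+ n)%:E^-1)%E.

(* || f ||_{L_p(D)}, through the extension of f by 0 outside D *)
Definition LnormOn (R : realType) (p : \bar R) (D : set R) (f : R -> \bar R) :
  \bar R := 'N[@lebesgue_measure R]_p [f \_ D]%E.

Definition elocally_integrable (R : realType) (w : R -> \bar R) : Prop :=
  measurable_fun Rpos w /\
  forall K, K `<=` Rpos -> compact K ->
    (\int[@lebesgue_measure R]_(x in K) `|w x| < +oo)%E.

(* Only open intervals ]a, b[ are considered: the end points do not change the
   integrals.  The concentric half of ]a, b[ has half-length (b - a) / 4. *)
Definition B_class (R : realType) (delta : R) : set (R -> \bar R) :=
  [set w | [/\ forall x, Rpos x -> (0 < w x)%E,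
               elocally_integrable w &
               exists C : R, forall a b : R,
                 0 <= a -> a < b -> delta <= b - a ->
                 (\int[@lebesgue_measure R]_(x in `]a, b[) w x <=
                  C%:E * \int[@lebesgue_measure R]_(x in
                    `]((a + b) / 2 - (b - a) / 4)%R,
                      ((a + b) / 2 + (b - a) / 4)%R[) w x)%E]].

Definition test_function (R : realType) (psi : R -> R) : Prop :=
  [/\ forall (n : nat) (x : R), derivable (derive1n n psi) x 1,
      compact (closure [set x | psi x != 0]) &
      closure [set x | psi x != 0] `<=` Rpos].

(* g is the generalized derivative of order n of f on R^+ *)
Definition weak_derivative (R : realType) (n : nat) (f g : R -> R) : Prop :=
  [/\ locally_integrable Rpos f,
      locally_integrable Rpos g &
      forall psi : R -> R, test_function psi ->
        \int[@lebesgue_measure R]_(x in Rpos) (f x * derive1n n psi x) =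
        (-1) ^+ n * \int[@lebesgue_measure R]_(x in Rpos) (g x * psi x)].

Definition sobolev_norm (R : realType) (u f df : R -> R) : \bar R :=
  (LnormOn 2%:E `]0%R, 1%R[ (EFin \o f) +
   LnormOn 2%:E Rpos (EFin \o (df \* u)%R))%E.

(* The choice of df is immaterial: weak derivatives are unique a.e. *)
Definition sobolev (R : realType) (l : nat) (u : R -> R) : set (R -> R) :=
  [set f | exists2 df, weak_derivative l f df & (sobolev_norm u f df < +oo)%E].

Definition multipliers (R : realType) (W1 W2 : set (R -> R)) : set (R -> R) :=
  [set phi | forall f, W1 f -> W2 (phi \* f)].

(* Main.v *)
Require Import Defs.
From mathcomp Require Import ring lra zify ess_sup_inf.

Set Implicit Arguments.
Unset Strict Implicit.
Unset Printing Implicit Defensive.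

Local Open Scope classical_set_scope.
Local Open Scope ring_scope.

(** Let l = n + 1. Since 1/u is square-integrable near the origin, the functions
    of the weighted space of order l are, up to null sets, the sums of a
    polynomial p of degree at most n and of the (n+1)-fold integral from 0 of
    h / u, with h in L_2 (taylor_sobolev, sobolev_taylor). Expanding the kernel
    (x - t)^n / n! in powers of x gives
      f(x) = sum_(k <= n) (p_k + c_k M_(n-k)(x)) x^k,
    where M_i(x) is the integral of t^i h(t) / u(t) over ]0, x] and c_k is a
    nonzero constant. Differentiating f at most n times, one may treat the
    moments M_i as constants, because the kernel vanishes to order n at t = x;
    in the order n + 1 only h / u is added. Leibniz's rule then yields the
    product formula
      (phi f)^(m) = sum_k (p_k + c_k M_(n-k)) (phi x^k)^(m) + [m = l] phi h / u,
    which is weak_derivative_multiplier. Leibniz's rule is available although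
    only weak derivatives are given, because by the du Bois-Reymond lemma
    functions with a weak derivative have representatives that are iterated
    integrals (weak_derivative_chain).

    Sufficiency. The terms with p_k are square-integrable against v by the first
    condition, the last one by the essential bound, and the terms with moments
    by Hardy's inequality, whose criterion is the finiteness of the supremum
    (hardy, moment_part_L2).

    Necessity. The powers x^k with k < l belong to the first space, which gives
    the first condition. If the supremum is infinite for some k, a single
    function f is constructed for which phi f is not in the second space. The
    doubling property makes the monomials of degree at most n uniformly
    independent in L_2(]0, r[, dx / u^2), even when only the part ]s, r[ with
    s <= r / 2 is used (poly_weight_lower). Duality yields functions h on ]s, r[
    for which all the moments of h / u of order at most n vanish except the one
    of order n - k, and whose norm is not larger, up to a constant, than this
    one moment requires (one_moment_density). Such humps are placed on
    successive disjoint intervals, with summable norms and with moments of the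
    same sign (gliding_hump). On the gaps between them the product formula
    reduces to a constant multiple of (phi x^k)^(m), and the constants can be
    chosen so large that the norms tend to infinity (multiplier_moment). Once
    the supremum is known to be finite, the terms with moments are
    square-integrable against v, so that for m = l multiplication by phi v / u
    maps L_2 into itself, which forces it to be essentially bounded
    (multiplier_bounded). *)

(** * Locally absolutely continuous functions *)

Section primitives.
Context {R : realType}.
Local Notation mu := (@lebesgue_measure R).
Implicit Types (f g h F G H : R -> R) (a b c x y z s t : R).

Lemma RposE x : Rpos x = (0 < x) :> Prop.
Proof. by rewrite /Rpos /= in_itv/= andbT. Qed.

Lemma measurable_Rpos : measurable (@Rpos R).
Proof. exact: measurable_itv. Qed.

Lemma open_Rpos : open (@Rpos R).
Proof. exact: interval_open. Qed.

Lemma Rpos_itv x y : 0 < x -> `[x, y] `<=` Rpos.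
Proof.
move=> x0 z /=; rewrite RposE in_itv/= => /andP[+ _]; exact: lt_le_trans.
Qed.

Lemma sub_Rpos_oo x y : 0 <= x -> `]x, y[ `<=` @Rpos R.
Proof.
by move=> x0 t /=; rewrite RposE in_itv/= => /andP[xt _]; exact: le_lt_trans xt.
Qed.

Lemma sub_Rpos_oc x y : 0 <= x -> `]x, y] `<=` @Rpos R.
Proof.
by move=> x0 t /=; rewrite RposE in_itv/= => /andP[xt _]; exact: le_lt_trans xt.
Qed.

Lemma sub_Rpos_o x : 0 <= x -> `]x, +oo[ `<=` @Rpos R.
Proof.
by move=> x0 t /=; rewrite RposE in_itv/= andbT => xt; exact: le_lt_trans xt.
Qed.

Lemma integrable_scale (D : set R) c f : measurable D ->
  mu.-integrable D (EFin \o f) -> mu.-integrable D (EFin \o (fun x => c * f x)).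
Proof. by move=> mD fi; exact: (@integrableZl _ _ _ mu D mD c (EFin \o f)). Qed.

Lemma locint_integrable f x y : locally_integrable Rpos f -> 0 < x ->
  mu.-integrable `[x, y] (EFin \o f).
Proof.
move=> [mf _ fK] x0; apply/integrableP; split.
  apply/measurable_EFinP; apply: measurable_funS mf; first exact: measurable_Rpos.
  exact: Rpos_itv.
by apply: fK; [exact: Rpos_itv|exact: segment_compact].
Qed.

Lemma locint_integrable_oc f x y : locally_integrable Rpos f -> 0 < x ->
  mu.-integrable `]x, y] (EFin \o f).
Proof.
move=> lf x0; apply: (@integrableS _ _ _ mu `[x, y]) => //; last exact: locint_integrable.
exact: subset_itv_oc_cc.
Qed.

Lemma compact_Rpos_itv (K : set R) : K `<=` Rpos -> compact K ->
  exists x y, [/\ 0 < x, x <= y & K `<=` `[x, y]].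
Proof.
move=> KR cK; have [-> | /set0P K0] := eqVneq K set0.
  by exists 1, 1; split => //; exact: sub0set.
have ci : {within K, continuous (@idfun R)}.
  by apply: continuous_subspaceT => x; exact: cvg_id.
have [x /[1!inE] Kx xm] := compact_EVT_min K0 cK ci.
have [y /[1!inE] Ky ym] := compact_EVT_max K0 cK ci.
exists x, y; split; first by rewrite -RposE; exact: KR.
  by apply: xm; rewrite inE.
by move=> z Kz; rewrite /= in_itv/= xm ?ym ?inE.
Qed.

Lemma locintP f : measurable_fun Rpos f ->
  (forall x y, 0 < x -> x <= y -> mu.-integrable `[x, y] (EFin \o f)) ->
  locally_integrable Rpos f.
Proof.
move=> mf fint; split; [exact: mf|exact: open_Rpos|].
move=> K KR cK.
have [x [y [x0 xy Kxy]]] := compact_Rpos_itv KR cK.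
have /integrableP[_ H] := fint _ _ x0 xy.
apply: le_lt_trans H; apply: ge0_subset_integral => //=.
- exact: compact_measurable.
- apply/measurable_EFinP; apply: measurableT_comp => //.
  by apply: measurable_funS mf => //; [exact: measurable_Rpos|exact: Rpos_itv].
Qed.

(** F is locally absolutely continuous on the half-line, with density f. The
    integral form makes the calculus below independent of pointwise
    differentiability. *)
Definition primitive F f := locally_integrable Rpos f /\
  forall x y, 0 < x -> x <= y -> F y - F x = \int[mu]_(t in `]x, y]) f t.

Lemma primitive_continuous F f x y : primitive F f -> 0 < x -> x <= y ->
  {within `[x, y], continuous F}.
Proof.
move=> [lf Ff] x0 xy.
have fi := locint_integrable y lf x0.
have H := parameterized_integral_continuous xy fi.
apply: (@subspace_eq_continuous _ _ _ (fun z => F x + \int[mu]_(t in `[x, z]) f t)).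
  move=> z; rewrite inE/= in_itv/= => /andP[xz zy].
  rewrite -Rintegral_itv_obnd_cbnd; last exact: locint_integrable_oc.
  by rewrite -Ff// addrC subrK.
by move=> z; apply: cvgD; [exact: cvg_cst|exact: H].
Qed.

Lemma primitive_continuous_at F f x : primitive F f -> 0 < x ->
  {for x, continuous F}.
Proof.
move=> Ff x0.
have x2 : 0 < x / 2 by lra.
have x21 : x / 2 < x + 1 by lra.
have /(continuous_within_itvP _ x21)[+ _ _] :=
  primitive_continuous Ff x2 (ltW x21).
by apply; rewrite in_itv/=; apply/andP; split; lra.
Qed.

Lemma primitive_measurable F f : primitive F f -> measurable_fun Rpos F.
Proof.
move=> Ff; apply: open_continuous_measurable_fun; first exact: open_Rpos.
by move=> x /[1!inE]; rewrite RposE; exact: primitive_continuous_at Ff.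
Qed.

Lemma primitive_locint F f : primitive F f -> locally_integrable Rpos F.
Proof.
move=> Ff; apply: locintP => [|x y x0 xy]; first exact: primitive_measurable Ff.
apply: continuous_compact_integrable; first exact: segment_compact.
exact: primitive_continuous Ff x0 xy.
Qed.

Lemma primitive_bounded F f x y : primitive F f -> 0 < x ->
  exists2 M, 0 <= M & forall z, x <= z <= y -> `|F z| <= M.
Proof.
move=> Ff x0; have [xy|yx] := leP x y; last first.
  by exists 0 => // z /andP[xz zy]; lra.
have cF := primitive_continuous Ff x0 xy.
have [c1 _ h1] := EVT_min xy cF.
have [c2 _ h2] := EVT_max xy cF.
exists (`|F c1| + `|F c2|) => [|z xzy]; first by rewrite addr_ge0.
have := h1 z; have := h2 z; rewrite in_itv/= => /(_ xzy) l2 /(_ xzy) l1.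
rewrite ler_norml; apply/andP; split.
  have := ler_norm (- F c1); rewrite normrN; have := normr_ge0 (F c2); lra.
have := ler_norm (F c2); have := normr_ge0 (F c1); lra.
Qed.

Lemma locintM f G g : locally_integrable Rpos f -> primitive G g ->
  locally_integrable Rpos (f \* G).
Proof.
move=> lf Gg; have mf : measurable_fun Rpos f by case: lf.
have mG := primitive_measurable Gg.
apply: locintP; first exact: measurable_funM.
move=> x y x0 xy; have [M M0 GM] := primitive_bounded y Gg x0.
have fi := locint_integrable y lf x0.
have sub := @Rpos_itv x y x0.
apply: (@le_integrable _ _ _ mu `[x, y] (measurable_itv _) _
  (fun t => (M%:E * (f t)%:E)%E)).
- apply/measurable_EFinP; apply: measurable_funS sub _ => //.
    exact: measurable_Rpos.
  exact: measurable_funM.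
- move=> t; rewrite /= in_itv/= => xty.
  rewrite lee_fin !normrM mulrC ler_wpM2r//.
  by rewrite (le_trans (GM _ xty))// ler_norm.
- exact: integrable_scale.
Qed.

Lemma locintZ c f : locally_integrable Rpos f ->
  locally_integrable Rpos (fun x => c * f x).
Proof.
move=> lf; have mf : measurable_fun Rpos f by case: lf.
apply: locintP; first exact: measurable_funM.
by move=> x y x0 _; apply: integrable_scale => //; exact: locint_integrable.
Qed.

Lemma Rintegral_oc_cat f x y z : 0 < x -> x <= y -> y <= z ->
  locally_integrable Rpos f ->
  \int[mu]_(t in `]x, z]) f t =
  \int[mu]_(t in `]x, y]) f t + \int[mu]_(t in `]y, z]) f t.
Proof.
move=> x0 xy yz lf.
rewrite -(@Rintegral_itvB _ f (BRight x) (BRight z) y) ?bnd_simp//; first ring.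
exact: locint_integrable_oc.
Qed.

Lemma primitive_int f c : locally_integrable Rpos f ->
  (forall y, 0 < y -> mu.-integrable `]0, y] (EFin \o f)) ->
  primitive (fun x => c + \int[mu]_(t in `]0, x]) f t) f.
Proof.
move=> lf fi; split => // x y x0 xy.
rewrite -(@Rintegral_itvB _ f (BRight 0) (BRight y) x) ?bnd_simp//; first ring.
  by apply: fi; exact: lt_le_trans xy.
exact: ltW.
Qed.

Lemma primitive_exists f : locally_integrable Rpos f ->
  exists F, primitive F f.
Proof.
move=> lf; exists (fun x => if 1 <= x then \int[mu]_(t in `]1, x]) f t
  else - \int[mu]_(t in `]x, 1]) f t); split => // x y x0 xy.
case: (leP 1 y) => y1; case: (leP 1 x) => x1; try lra.
- rewrite (@Rintegral_oc_cat f 1 x y)//; ring.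
- rewrite (@Rintegral_oc_cat f x 1 y) ?(ltW x1)//; ring.
- rewrite (@Rintegral_oc_cat f x y 1) ?(ltW y1)//; ring.
Qed.

(** Halving repeatedly at the point where the control rho takes its mean value
    divides the quadratic bound on the total by two at each stage. *)
Lemma additive_quadratic_eq0 (e : R -> R -> R) (rho : R -> R) a b : a <= b ->
  {within `[a, b], continuous rho} ->
  {in `[a, b] &, {homo rho : x y / x <= y}} ->
  (forall x y z, a <= x -> x <= y -> y <= z -> z <= b ->
    e x z = e x y + e y z) ->
  (forall x y, a <= x -> x <= y -> y <= b -> `|e x y| <= (rho y - rho x) ^+ 2) ->
  e a b = 0.
Proof.
move=> ab crho hrho eD eB.
have key n : forall x y, a <= x -> x <= y -> y <= b ->
    `|e x y| <= 2^-1 ^+ n * (rho y - rho x) ^+ 2.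
  elim: n => [|n IH] x y ax xy yb; first by rewrite mul1r; exact: eB.
  have rxy : rho x <= rho y.
    by apply: hrho; rewrite ?in_itv//= ?ax ?yb ?(le_trans xy) ?(le_trans ax xy).
  have [||z] := @IVT _ rho x y ((rho x + rho y) / 2) xy.
  - apply: continuous_subspaceW crho => t /=; rewrite !in_itv/= => /andP[xt ty].
    by rewrite (le_trans ax xt) (le_trans ty yb).
  - rewrite minEle maxEle rxy; apply/andP; split; lra.
  rewrite in_itv/= => /andP[xz zy] rz.
  (* the halves satisfy rho z - rho x = rho y - rho z, and 2 (1/2)^2 = 1/2 *)
  rewrite (eD x z y)// (le_trans (ler_normD _ _))//.
  have h1 := IH x z ax xz (le_trans zy yb).
  have h2 := IH z y (le_trans ax xz) zy yb.
  rewrite (le_trans (lerD h1 h2))// rz [2^-1 ^+ n.+1]exprS.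
  by rewrite le_eqVlt; apply/orP; left; apply/eqP; field.
apply/eqP/negPn/negP => e0.
have {}e0 : 0 < `|e a b| by rewrite normr_gt0.
have cv : (fun n => 2^-1 ^+ n * (rho b - rho a) ^+ 2) @ \oo --> 0.
  rewrite -[X in _ --> X](mul0r ((rho b - rho a) ^+ 2)).
  apply: cvgMl; apply: cvg_expr; rewrite gtr0_norm ?invr_gt0// invf_lt1//; lra.
have := cvgr_lt _ cv _ e0 => -[N _ /(_ N (leqnn N))] /=.
by rewrite ltNge key.
Qed.

Lemma locint_norm f : locally_integrable Rpos f ->
  locally_integrable Rpos (fun x => `|f x|).
Proof.
move=> lf; have mf : measurable_fun Rpos f by case: lf.
apply: locintP; first exact: measurableT_comp.
by move=> x y x0 _; apply: integrable_norm; exact: locint_integrable.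
Qed.

Lemma primitive_norm_le F f x y : primitive F f -> 0 < x -> x <= y ->
  `|F y - F x| <= \int[mu]_(t in `]x, y]) `|f t|.
Proof.
move=> [lf Ff] x0 xy; rewrite Ff//; apply: le_normr_Rintegral => //.
exact: locint_integrable_oc.
Qed.

Lemma Rintegral_oc_le f x y s t : locally_integrable Rpos f ->
  (forall z, 0 <= f z) -> 0 < x -> x <= s -> s <= t -> t <= y ->
  \int[mu]_(z in `]s, t]) f z <= \int[mu]_(z in `]x, y]) f z.
Proof.
move=> lf f0 x0 xs st ty; have sy := le_trans st ty.
have s0 := lt_le_trans x0 xs; have t0 := lt_le_trans s0 st.
rewrite (@Rintegral_oc_cat f x s y)// (@Rintegral_oc_cat f s t y)//.
by rewrite addrCA lerDl addr_ge0// Rintegral_ge0.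
Qed.

Lemma primitiveD F f G g : primitive F f -> primitive G g ->
  primitive (F \+ G) (f \+ g).
Proof.
move=> [lf Ff] [lg Gg]; split; first exact: locally_integrableD.
move=> x y x0 xy /=; rewrite RintegralD// -?Ff -?Gg//; first ring.
- exact: locint_integrable_oc.
- exact: locint_integrable_oc.
Qed.

Lemma primitiveZ c F f : primitive F f ->
  primitive (fun x => c * F x) (fun x => c * f x).
Proof.
move=> [lf Ff]; split; first exact: locintZ.
move=> x y x0 xy /=; rewrite RintegralZl// -?Ff//; first ring.
exact: locint_integrable_oc.
Qed.

Lemma locint0 : locally_integrable Rpos (fun=> 0 : R).
Proof.
by apply: locintP => // x y _ _; exact: (@integrable0 _ _ _ mu).
Qed.

Lemma primitive_cst c : primitive (fun=> c) (fun=> 0 : R).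
Proof.
by split; [exact: locint0|move=> x y _ _; rewrite Rintegral_cst// mul0r subrr].
Qed.

Lemma primitive_sum (I : Type) (s : seq I) (P : pred I) (F f : I -> R -> R) :
  (forall i, P i -> primitive (F i) (f i)) ->
  primitive (fun x => \sum_(i <- s | P i) F i x)
            (fun x => \sum_(i <- s | P i) f i x).
Proof.
move=> Ff; elim: s => [|i s IH].
  have sum0 (E : I -> R -> R) : (fun x => \sum_(i <- [::] | P i) E i x) = fun=> 0.
    by apply/funext => x; rewrite big_nil.
  by rewrite !sum0; exact: primitive_cst.
have sumS (E : I -> R -> R) : (fun x => \sum_(j <- i :: s | P j) E j x) =
    if P i then E i \+ (fun x => \sum_(j <- s | P j) E j x)
    else fun x => \sum_(j <- s | P j) E j x.
  by apply/funext => x; rewrite big_cons; case: ifP.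
by rewrite !sumS; case: ifPn => // Pi; exact: (primitiveD (Ff _ Pi) IH).
Qed.

(** Integration by parts without Fubini's theorem: the defect of the product
    rule is additive over intervals and bounded by twice the product of the
    increments of primitives of |f| and |g|, hence quadratically small with
    respect to a primitive of |f| + |g|. *)
Lemma primitiveM F f G g : primitive F f -> primitive G g ->
  primitive (F \* G) (fun x => f x * G x + F x * g x).
Proof.
move=> Ff Gg; have [[lf _] [lg _]] := (Ff, Gg).
have lF := primitive_locint Ff.
have lfG : locally_integrable Rpos (fun x => f x * G x) := locintM lf Gg.
have lFg : locally_integrable Rpos (fun x => F x * g x).
  by under eq_fun do rewrite mulrC; exact: (locintM lg Ff).
have lfg : locally_integrable Rpos (fun x => f x * G x + F x * g x).
  exact: locally_integrableD.
split => // a b a0 ab /=.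
have labs : locally_integrable Rpos (fun x => `|f x| + `|g x|).
  by apply: locally_integrableD; exact: locint_norm.
have [rho Hrho] := primitive_exists labs.
have oc h s t : locally_integrable Rpos h -> 0 < s ->
  mu.-integrable `]s, t] (EFin \o h) by exact: locint_integrable_oc.
pose e x y := F y * G y - F x * G x -
  \int[mu]_(t in `]x, y]) (f t * G t + F t * g t).
suff : e a b = 0 by move=> /eqP; rewrite subr_eq0 => /eqP.
apply: (@additive_quadratic_eq0 e rho) => //.
- exact: primitive_continuous Hrho a0 ab.
- move=> x y; rewrite !in_itv/= => /andP[ax _] _ xy.
  rewrite -subr_ge0 (proj2 Hrho)//; last exact: lt_le_trans ax.
  by apply: Rintegral_ge0 => t _; rewrite addr_ge0.
- move=> x y z ax xy yz _; rewrite /e (@Rintegral_oc_cat _ x y z)//; first ring.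
  exact: lt_le_trans ax.
- move=> x y ax xy yb; have x0 := lt_le_trans a0 ax.
  set A := \int[mu]_(t in `]x, y]) `|f t|.
  set B := \int[mu]_(t in `]x, y]) `|g t|.
  have A0 : 0 <= A by exact: Rintegral_ge0.
  have B0 : 0 <= B by exact: Rintegral_ge0.
  have -> : rho y - rho x = A + B.
    by rewrite (proj2 Hrho)// RintegralD//; apply: oc => //; exact: locint_norm.
  have i1 := oc _ x y lfG x0; have i2 := oc _ x y lFg x0.
  have i3 := oc _ x y lf x0; have i4 := oc _ x y lg x0.
  have -> : e x y = \int[mu]_(t in `]x, y])
      ((G y * f t - f t * G t) + (F x * g t - F t * g t)).
    rewrite RintegralD//; last 2 first.
    - by apply: (@integrableB _ _ _ mu _ _ (EFin \o (fun t => G y * f t))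
        (EFin \o (fun t => f t * G t))) => //; exact: integrable_scale.
    - by apply: (@integrableB _ _ _ mu _ _ (EFin \o (fun t => F x * g t))
        (EFin \o (fun t => F t * g t))) => //; exact: integrable_scale.
    rewrite RintegralB//; last exact: integrable_scale.
    rewrite RintegralB//; last exact: integrable_scale.
    rewrite !RintegralZl// -(proj2 Ff)// -(proj2 Gg)// /e RintegralD//; ring.
  have iR : mu.-integrable `]x, y] (EFin \o (fun t => B * `|f t| + A * `|g t|)).
    apply: (@integrableD _ _ _ mu _ _ (EFin \o (fun t => B * `|f t|))
        (EFin \o (fun t => A * `|g t|))) => //; apply: integrable_scale => //;
      exact: integrable_norm.
  have iL : mu.-integrable `]x, y] (EFin \o (fun t =>
      (G y * f t - f t * G t) + (F x * g t - F t * g t))).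
    apply: (@integrableD _ _ _ mu _ _ (EFin \o (fun t => G y * f t - f t * G t))
        (EFin \o (fun t => F x * g t - F t * g t))) => //.
    - by apply: (@integrableB _ _ _ mu _ _ (EFin \o (fun t => G y * f t))
        (EFin \o (fun t => f t * G t))) => //; exact: integrable_scale.
    - by apply: (@integrableB _ _ _ mu _ _ (EFin \o (fun t => F x * g t))
        (EFin \o (fun t => F t * g t))) => //; exact: integrable_scale.
  apply: le_trans (le_normr_Rintegral _ iL) _ => //.
  apply: (@le_trans _ _ (\int[mu]_(t in `]x, y]) (B * `|f t| + A * `|g t|))).
    apply: le_Rintegral => //; first exact: integrable_norm.
    move=> t /=; rewrite in_itv/= => /andP[xt ty].
    rewrite (le_trans (ler_normD _ _))// lerD//.
    + rewrite [G y * _]mulrC -mulrBr normrM mulrC ler_wpM2r//.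
      rewrite (le_trans (primitive_norm_le Gg _ ty)) ?(lt_trans x0)//.
      by apply: Rintegral_oc_le => //; [exact: locint_norm|exact: ltW].
    + rewrite -mulrBl normrM ler_wpM2r// distrC.
      rewrite (le_trans (primitive_norm_le Ff _ (ltW xt)))//.
      by apply: Rintegral_oc_le => //; [exact: locint_norm|exact: ltW].
  rewrite RintegralD//; last 2 first.
  - by apply: integrable_scale => //; exact: integrable_norm.
  - by apply: integrable_scale => //; exact: integrable_norm.
  rewrite !RintegralZl//; try exact: integrable_norm.
  by rewrite -/A -/B; nra.
Qed.

Lemma primitive_C1 F f : (forall x, 0 < x -> is_derive x 1 F (f x)) ->
  (forall x, 0 < x -> {for x, continuous f}) -> primitive F f.
Proof.
move=> dF cf.
have lf : locally_integrable Rpos f.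
  apply: locintP => [|x y x0 xy].
    apply: open_continuous_measurable_fun; first exact: open_Rpos.
    by move=> x /[1!inE]; rewrite RposE => /cf.
  apply: continuous_compact_integrable; first exact: segment_compact.
  apply: continuous_in_subspaceT => z /[1!inE] /(Rpos_itv x0).
  by rewrite RposE => /cf.
split => // x y x0; rewrite le_eqVlt => /predU1P[->|xy].
  by rewrite subrr set_itv_ge ?bnd_simp ?ltxx// Rintegral_set0.
rewrite Rintegral_itv_obnd_cbnd; last exact: locint_integrable_oc.
rewrite /Rintegral (@continuous_FTC2 _ f F x y)//.
- apply: continuous_in_subspaceT => z /[1!inE] /(Rpos_itv x0).
  by rewrite RposE => /cf.
- have cF z : 0 < z -> {for z, continuous F}.
    move=> z0; apply: differentiable_continuous; apply/derivable1_diffP.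
    by have [] := dF _ z0.
  split.
  + move=> z; rewrite in_itv/= => /andP[xz _].
    by have [] := dF _ (lt_trans x0 xz).
  + by apply: cvg_at_right_filter; exact: cF.
  + by apply: cvg_at_left_filter; apply: cF; exact: lt_trans xy.
- move=> z; rewrite in_itv/= => /andP[xz _].
  by rewrite derive1E; have [_ ->] := dF _ (lt_trans x0 xz).
Qed.

End primitives.

(** * Weak derivatives of iterated primitives *)

Section weak_derivatives.
Context {R : realType}.
Local Notation mu := (@lebesgue_measure R).
Implicit Types (f g h psi : R -> R) (F : nat -> R -> R) (a b c x y : R) (n : nat).

Lemma aeS (P Q : R -> Prop) : (forall x, P x -> Q x) ->
  (\forall x \ae mu, P x) -> \forall x \ae mu, Q x.
Proof.
move=> PQ; apply: filterS => //.
exact: (@ae_filter_ringOfSetsType _ (measurableTypeR R) R mu).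
Qed.

Lemma aeI (P Q : R -> Prop) : (\forall x \ae mu, P x) ->
  (\forall x \ae mu, Q x) -> \forall x \ae mu, P x /\ Q x.
Proof.
move=> aP aQ; apply: filterI => //.
exact: (@ae_filter_ringOfSetsType _ (measurableTypeR R) R mu).
Qed.

Lemma test_function_supp psi : test_function psi -> exists a b,
  [/\ 0 < a, a < b & forall n x, ~~ (a <= x <= b) -> derive1n n psi x = 0].
Proof.
move=> [_ cK KR]; have [a [b [a0 ab Kab]]] := compact_Rpos_itv KR cK.
exists a, (b + 1); split => //; first lra.
have psi0 x : ~~ (a <= x <= b + 1) -> psi x = 0.
  move=> xab; apply/eqP/negPn/negP => psix.
  have /Kab/= : closure [set x | psi x != 0] x by exact: subset_closure.
  rewrite in_itv/= => /andP[ax xb]; move: xab; rewrite ax/=.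
  by rewrite (le_trans xb)// lerDl.
elim => [|n IH] x xab; first exact: psi0.
rewrite derive1nS derive1E -(derive_cst 0 x 1); apply: near_eq_derive.
have : (~` `[a, b + 1]%classic) x by rewrite /= in_itv/=; apply/negP.
have oS : open (~` `[a, b + 1]%classic : set R).
  by apply: closed_openC; exact: interval_closed.
move: oS; rewrite openE => /(_ x) /[apply] xS.
near=> z; apply: IH; apply/negP.
have : (~` `[a, b + 1]%classic) z by near: z; exact: xS.
by rewrite /= in_itv.
Unshelve. all: by end_near. Qed.

Lemma Rintegral_supp f a b : 0 < a ->
  (forall x, ~~ (a <= x <= b) -> f x = 0) ->
  \int[mu]_(x in Rpos) f x = \int[mu]_(x in `]a / 2, b]) f x.
Proof.
move=> a0 f0; rewrite Rintegral_mkcond [RHS]Rintegral_mkcond.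
congr Rintegral; apply/funext => x; rewrite !patchE.
have [xab|xab] := boolP (a <= x <= b); last by rewrite f0//; case: ifP; case: ifP.
rewrite !mem_set//=.
- by rewrite in_itv/=; move: xab => /andP[ax ->]; rewrite andbT; lra.
- by rewrite RposE; move: xab => /andP[ax _]; lra.
Qed.

Lemma derive1n_primitive psi n : (forall k x, derivable (derive1n k psi) x 1) ->
  primitive (derive1n n psi) (derive1n n.+1 psi).
Proof.
move=> dpsi; apply: primitive_C1 => x _.
  by rewrite derive1nS derive1E; apply/derivableP; exact: dpsi.
by apply: differentiable_continuous; apply/derivable1_diffP; exact: dpsi.
Qed.

Lemma test_integrable f psi n : locally_integrable Rpos f -> test_function psi ->
  mu.-integrable Rpos (EFin \o (fun x => f x * derive1n n psi x)).
Proof.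
move=> lf tpsi; have [a [b [a0 ab psi0]]] := test_function_supp tpsi.
have pr : primitive (derive1n n psi) (derive1n n.+1 psi).
  by apply: derive1n_primitive; case: tpsi.
have lfp := locintM lf pr.
have h := locint_integrable_oc b lfp (divr_gt0 a0 (ltr0n _ 2)).
apply/integrable_mkcond; first exact: measurable_Rpos.
have mi : measurable `]a / 2, b] by exact: measurable_itv.
have := proj1 (@integrable_mkcond _ _ _ mu _ _ mi) h.
congr (integrable _ _ _).
apply/funext => x; rewrite !patchE/=.
have [xab|xab] := boolP (a <= x <= b); last first.
  by rewrite psi0// mulr0; case: ifP; case: ifP.
rewrite !mem_set//=.
- by rewrite RposE; move: xab => /andP[ax _]; lra.
- by rewrite in_itv/=; move: xab => /andP[ax ->]; rewrite andbT; lra.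
Qed.

Lemma test_by_parts f g psi n : primitive f g -> test_function psi ->
  \int[mu]_(x in Rpos) (f x * derive1n n.+1 psi x) =
  - \int[mu]_(x in Rpos) (g x * derive1n n psi x).
Proof.
move=> fg tpsi; have [a [b [a0 ab psi0]]] := test_function_supp tpsi.
have pr k : primitive (derive1n k psi) (derive1n k.+1 psi).
  by apply: derive1n_primitive; case: tpsi.
rewrite (@Rintegral_supp _ a (b + 1))//; last first.
  move=> x xab; rewrite psi0 ?mulr0//; apply: contra xab => /andP[-> xb] /=; lra.
rewrite (@Rintegral_supp _ a (b + 1))//; last first.
  move=> x xab; rewrite psi0 ?mulr0//; apply: contra xab => /andP[-> xb] /=; lra.
have a20 : 0 < a / 2 by lra.
have ab2 : a / 2 <= b + 1 by lra.
have /= := proj2 (primitiveM fg (pr n)) (a / 2) (b + 1) a20 ab2.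
rewrite psi0; last by apply/negP => /andP[]; lra.
rewrite psi0; last by apply/negP => /andP[]; lra.
rewrite !mulr0 subrr RintegralD//.
- by move=> /esym /eqP; rewrite addrC addr_eq0 => /eqP.
- by apply: locint_integrable_oc => //; apply: locintM (pr n); case: fg.
- apply: locint_integrable_oc => //.
  exact: (locintM (primitive_locint fg) (pr n.+1)).
Qed.

(** Iterated primitives: the representative F 0 is n times differentiable in
    the absolutely continuous sense, with derivatives F 1, ..., F n. *)
Definition chain n F := locally_integrable Rpos (F n) /\
  forall i, (i < n)%N -> primitive (F i) (F i.+1).

Lemma chain_locint n F i : chain n F -> (i <= n)%N ->
  locally_integrable Rpos (F i).
Proof.
move=> [lF pF]; rewrite leq_eqVlt => /predU1P[->//|/pF].
exact: primitive_locint.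
Qed.

Lemma chain_weak_derivative n F : chain n F -> weak_derivative n (F 0%N) (F n).
Proof.
move=> cF; split; [exact: chain_locint cF _|exact: chain_locint cF _|].
move=> psi tpsi.
suff H i : (i <= n)%N -> \int[mu]_(x in Rpos) (F 0%N x * derive1n n psi x) =
    (-1) ^+ i * \int[mu]_(x in Rpos) (F i x * derive1n (n - i) psi x).
  by rewrite (H n)// subnn.
elim: i => [|i IH] lin; first by rewrite mul1r subn0.
rewrite IH ?(ltnW lin)// -(subnSK lin) (test_by_parts _ (proj2 cF _ lin))//.
by rewrite exprS mulN1r mulrN mulNr.
Qed.

Lemma ae_Rintegral f g : measurable_fun Rpos f -> measurable_fun Rpos g ->
  f = g %[ae mu in Rpos] ->
  \int[mu]_(x in Rpos) f x = \int[mu]_(x in Rpos) g x.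
Proof.
move=> mf mg fg; congr fine; apply: ae_eq_integral => //.
- exact: measurable_Rpos.
- exact/measurable_EFinP.
- exact/measurable_EFinP.
- by apply: aeS fg => x /= fg /fg ->.
Qed.

Lemma weak_derivative_ae n f f' g g' :
  locally_integrable Rpos f' -> locally_integrable Rpos g' ->
  f = f' %[ae mu in Rpos] -> g = g' %[ae mu in Rpos] ->
  weak_derivative n f g -> weak_derivative n f' g'.
Proof.
move=> lf' lg' ff' gg' [lf lg H]; split => // psi tpsi.
have mp k : measurable_fun Rpos (derive1n k psi).
  by apply: primitive_measurable; apply: derive1n_primitive; case: tpsi.
have := H _ tpsi; rewrite (@ae_Rintegral _ (fun x => f' x * derive1n n psi x)).
- rewrite [in RHS](@ae_Rintegral _ (fun x => g' x * psi x))//.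
  + by apply: measurable_funM (mp 0%N); case: lg.
  + by apply: measurable_funM (mp 0%N); case: lg'.
  + by apply: aeS gg' => x /= gg /gg ->.
- by apply: measurable_funM (mp n); case: lf.
- by apply: measurable_funM (mp n); case: lf'.
- by apply: aeS ff' => x /= ff /ff ->.
Qed.

End weak_derivatives.

(** * Smooth bumps *)

Section bumps.
Context {R : realType}.
Local Notation mu := (@lebesgue_measure R).
Implicit Types (f g h psi : R -> R) (p q : {poly R}) (a b c x y z : R) (n : nat).

Lemma exprM_expRN_le n z : 0 <= z -> z ^+ n * expR (- z) <= n`!%:R.
Proof.
move=> z0; rewrite expRN ler_pdivrMr ?expR_gt0//.
case: n => [|n]; first by rewrite expr0 fact0 mul1r (le_trans _ (expR_ge1Dx _))//; lra.
rewrite mulrC -ler_pdivrMr ?ltr0n ?fact_gt0//.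
by rewrite (le_trans _ (expR_ge1Dxn n z0))//; lra.
Qed.

Lemma horner_expRN_bounded p : exists2 M, 0 <= M &
  forall z, 0 <= z -> `|p.[z]| * expR (- z) <= M.
Proof.
exists (\sum_(i < size p) `|p`_i| * i`!%:R).
  by apply: sumr_ge0 => i _; rewrite mulr_ge0.
move=> z z0; rewrite horner_coef.
apply: (@le_trans _ _ (\sum_(i < size p) `|p`_i * z ^+ i| * expR (- z))).
  by rewrite -mulr_suml ler_wpM2r ?expR_ge0// ler_norm_sum.
apply: ler_sum => i _; rewrite normrM -mulrA ler_wpM2l//.
by rewrite ger0_norm ?exprn_ge0//; exact: exprM_expRN_le.
Qed.

(** The functions p(1/y) exp(-1/y), extended by 0 to y <= 0; this family is
    stable under differentiation. *)
Definition flat p y : R := if 0 < y then p.[y^-1] * expR (- y^-1) else 0.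

Lemma is_derive_flat p y :
  is_derive y 1 (flat p) (flat ('X ^+ 2 * (p - p^`())) y).
Proof.
case: (ltgtP 0 y) => [y0|y0|<-].
- have near0 : \forall z \near y, p.[z^-1] * expR (- z^-1) = flat p z.
    near=> z; rewrite /flat ifT//; near: z.
    exact: (open_gt y0).
  have -> : flat ('X ^+ 2 * (p - p^`())) y =
      (p^`().[y^-1] * expR (- y^-1) - p.[y^-1] * expR (- y^-1)) * (- y ^- 2 *: 1).
    rewrite /flat y0 !hornerE /GRing.scale/=; field; lra.
  apply: (near_eq_is_derive near0).
  have h (z : R) : is_derive z 1 (fun z => p.[z] * expR (- z))
      (p^`().[z] * expR (- z) - p.[z] * expR (- z)).
    have h1 : is_derive z 1 (horner p) (p^`().[z]).
      rewrite -[p^`().[z]]/(horner p^`() z) derivE derive1E.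
      by apply/derivableP; exact: derivable_horner.
    have h2 : is_derive z 1 (fun z => expR (- z)) (expR (- z) * (- 1)).
      exact: is_derive1_comp.
    apply: (is_derive_eq (is_deriveM h1 h2)).
    by rewrite /GRing.scale/=; ring.
  apply: (@is_derive1_comp _ (fun z => p.[z] * expR (- z)) (fun z => z^-1)).
  by apply: is_deriveV => //; rewrite gt_eqF.
- have near0 : \forall z \near y, 0 = flat p z.
    near=> z; rewrite /flat ifF//; apply/negbTE; rewrite -leNgt ltW//; near: z.
    exact: (open_lt y0).
  rewrite /flat ltNge (ltW y0)/=.
  by apply: (near_eq_is_derive near0); exact: is_derive_cst.
- have -> : flat ('X ^+ 2 * (p - p^`())) 0 = 0 by rewrite /flat ltxx.
  have [M M0 HM] := horner_expRN_bounded (p * 'X ^+ 2).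
  have bnd (h : R) : `|flat p h| <= M * h ^+ 2.
    rewrite /flat; case: ifPn => [h0|_]; last by rewrite normr0 mulr_ge0 ?sqr_ge0.
    have := HM h^-1; rewrite invr_ge0 ltW// => /(_ isT).
    rewrite hornerM hornerXn !normrM [`|expR _|]ger0_norm ?expR_ge0//.
    rewrite [`|h^-1|]ger0_norm ?invr_ge0 ?(ltW h0)//.
    rewrite -ler_pdivrMr ?exprn_gt0//; apply: le_trans.
    by rewrite le_eqVlt; apply/orP; left; apply/eqP; field; lra.
  suff H : h^-1 *: (flat p (h *: 1 + 0) - flat p 0) @[h --> 0^'] --> 0.
    apply: DeriveDef; first by apply/cvg_ex; exists 0; exact: H.
    by apply: cvg_lim => //; exact: H.
  have f0 : flat p 0 = 0 by rewrite /flat ltxx.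
  apply/cvgrPdist_le => eps eps0; near=> h.
  have h0 : h != 0 by near: h; exact: nbhs_dnbhs_neq.
  rewrite f0 subr0 addr0 sub0r normrN /GRing.scale/= mulr1 normrM normfV.
  rewrite mulrC ler_pdivrMr ?normr_gt0// (le_trans (bnd h))//.
  rewrite -real_normK ?num_real// expr2 mulrA ler_wpM2r//.
  have hM : `|h| <= eps / (M + 1).
    near: h; apply: dnbhs0_le; rewrite divr_gt0//; lra.
  rewrite (@le_trans _ _ ((M + 1) * `|h|))//; first by rewrite ler_wpM2r//; lra.
  by rewrite mulrC -ler_pdivlMr//; lra.
Unshelve. all: by end_near. Qed.

Lemma flatZ c p y : flat (c *: p) y = c * flat p y.
Proof. by rewrite /flat; case: ifP => _; rewrite ?mulr0// hornerZ mulrA. Qed.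

Lemma stable_class_smooth (S : (R -> R) -> Prop) :
  (forall f, S f -> exists2 g, S g & forall x, is_derive x 1 f (g x)) ->
  forall f, S f -> forall n x, derivable (derive1n n f) x 1.
Proof.
move=> Sd f Sf n; suff /Sd[g _ fg] : S (derive1n n f) by move=> x; have [] := fg x.
elim: n => [//|n /Sd[g Sg fg]].
suff -> : derive1n n.+1 f = g by [].
by apply/funext => x; rewrite derive1nS derive1E; have [_] := fg x.
Qed.

Section bump.
Variables (a b N : R).

(** Differentiating a bump leaves this class, given by its closure properties
    rather than by a formula for the iterated derivatives, invariant. *)
Inductive bump_span : (R -> R) -> Prop :=
| BumpMul p q : bump_span (fun x => flat p (N * (x - a)) * flat q (N * (b - x)))
| BumpAdd f g : bump_span f -> bump_span g -> bump_span (f \+ g).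

Lemma bump_span_smooth f : bump_span f -> forall n x, derivable (derive1n n f) x 1.
Proof.
apply: stable_class_smooth => {}f.
elim => [p q|{}f g _ [f' Sf' ff'] _ [g' Sg' gg']].
- pose D (p : {poly R}) := 'X ^+ 2 * (p - p^`()) : {poly R}.
  exists ((fun x => flat (N *: D p) (N * (x - a)) * flat q (N * (b - x))) \+
    (fun x => flat p (N * (x - a)) * flat (- N *: D q) (N * (b - x)))).
    by apply: BumpAdd; exact: BumpMul.
  move=> x.
  have hl : is_derive x 1 (fun z : R => N * (z - a)) N.
    apply: (is_derive_eq (is_deriveZ N (is_deriveB (is_derive_id x 1) (is_derive_cst a x 1)))).
    by rewrite /GRing.scale/=; ring.
  have hr : is_derive x 1 (fun z : R => N * (b - z)) (- N).
    apply: (is_derive_eq (is_deriveZ N (is_deriveB (is_derive_cst b x 1) (is_derive_id x 1)))).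
    by rewrite /GRing.scale/=; ring.
  have dl := @is_derive1_comp _ (flat p) (fun z : R => N * (z - a)) x _ _
    (is_derive_flat p (N * (x - a))) hl.
  have dr := @is_derive1_comp _ (flat q) (fun z : R => N * (b - z)) x _ _
    (is_derive_flat q (N * (b - x))) hr.
  apply: (is_derive_eq (is_deriveM dl dr)).
  by rewrite /GRing.scale/= !flatZ /D; ring.
- by exists (f' \+ g'); [exact: BumpAdd|move=> x; exact: is_deriveD].
Qed.

(** As N grows, these functions tend to the indicator of ]a, b[. *)
Definition bump := fun x => flat 1 (N * (x - a)) * flat 1 (N * (b - x)).

Lemma flat1_ge0 y : 0 <= flat 1 y.
Proof. by rewrite /flat; case: ifP => // _; rewrite hornerC mul1r expR_ge0. Qed.

Lemma flat1_le1 y : flat 1 y <= 1.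
Proof.
rewrite /flat; case: ifPn => // y0; rewrite hornerC mul1r.
by rewrite expR_le1 oppr_le0 invr_ge0 ltW.
Qed.

Lemma bump_ge0 x : 0 <= bump x.
Proof. by rewrite mulr_ge0// flat1_ge0. Qed.

Lemma bump_le1 x : bump x <= 1.
Proof. by rewrite mulr_ile1// ?flat1_ge0 ?flat1_le1. Qed.

Lemma bump_out x : 0 < N -> ~~ (a < x < b) -> bump x = 0.
Proof.
move=> N0; rewrite negb_and -!leNgt => /orP[h|h]; rewrite /bump /flat.
  by rewrite pmulr_rgt0// subr_gt0 ltNge h/= mul0r.
by rewrite !pmulr_rgt0// !subr_gt0 [x < b]ltNge h/= mulr0.
Qed.

End bump.

Lemma test_functionP psi a b : (forall n x, derivable (derive1n n psi) x 1) ->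
  0 < a -> (forall x, ~~ (a <= x <= b) -> psi x = 0) -> test_function psi.
Proof.
move=> dpsi a0 psi0.
have cl : closure [set x | psi x != 0] `<=` `[a, b]%classic.
  apply: (@subset_trans _ (closure `[a, b]%classic)); last first.
    have ci : closed (`[a, b]%classic : set R) by exact: interval_closed.
  by rewrite -(proj1 (closure_id _) ci).
  apply: closure_subset => x /= px; rewrite in_itv/=.
  by apply/negPn/negP => /psi0 px0; rewrite px0 eqxx in px.
split => //; last exact: subset_trans cl (Rpos_itv a0).
apply: (subclosed_compact _ (@segment_compact _ a b)) => //.
exact: closed_closure.
Qed.

Lemma bump_test a b N : 0 < a -> 0 < N -> test_function (bump a b N).
Proof.
move=> a0 N0; apply: (@test_functionP _ a b) => //.
  by apply: bump_span_smooth; exact: BumpMul.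
move=> x xab; apply: bump_out => //; apply: contra xab => /andP[ax xb].
by rewrite !ltW.
Qed.

Lemma cvg_flat1 y : 0 < y -> flat 1 (n.+1%:R * y) @[n --> \oo] --> (1 : R).
Proof.
move=> y0.
have -> : (fun n => flat 1 (n.+1%:R * y)) = (fun n => expR (- (harmonic n * y^-1))).
  apply/funext => n; rewrite /flat pmulr_rgt0 ?ltr0n// y0 hornerC mul1r.
  by rewrite invfM.
rewrite -expR0 -[X in expR X](oppr0) -[X in - X](mul0r y^-1).
apply: continuous_cvg; first exact: continuous_expR.
by apply: cvgN; apply: cvgMl; exact: cvg_harmonic.
Qed.

Lemma cvg_bump a b x : a < x < b -> bump a b n.+1%:R x @[n --> \oo] --> (1 : R).
Proof.
move=> /andP[ax xb]; rewrite -[X in _ --> X](mulr1 1).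
by apply: cvgM; apply: cvg_flat1; rewrite subr_gt0.
Qed.

(** The bumps on ]a, b[ tend boundedly to its indicator, so that orthogonality
    to test functions passes to indicators by dominated convergence. *)
Lemma orthogonal_test_Rintegral0 h a b : locally_integrable Rpos h -> 0 < a ->
  (forall psi, test_function psi -> \int[mu]_(x in Rpos) (h x * psi x) = 0) ->
  \int[mu]_(x in `]a, b[) h x = 0.
Proof.
move=> lh a0 H.
have mab : measurable (`]a, b[%classic : set R) by exact: measurable_itv.
have ih : mu.-integrable `]a, b[ (EFin \o h).
  apply: (@integrableS _ _ _ mu `[a, b]) => //; last exact: locint_integrable.
  exact: subset_itv_oo_cc.
pose hn n x := h x * bump a b n.+1%:R x.
have mbump n : measurable_fun Rpos (bump a b n.+1%:R).
  have [dbump _ _] : test_function (bump a b n.+1%:R) by exact: bump_test.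
  exact: primitive_measurable (derive1n_primitive 0 dbump).
have sub := @sub_Rpos_oo R a b (ltW a0).
have mh : measurable_fun `]a, b[ h by apply/measurable_EFinP; exact: (measurable_int mu ih).
have [] := @dominated_convergence _ _ _ mu _ mab (fun n => EFin \o hn n)
    (EFin \o h) (fun x => `|h x|%:E).
- move=> n; apply/measurable_EFinP; apply: measurable_funM => //.
  by apply: measurable_funS (mbump n) => //; exact: measurable_Rpos.
- exact/measurable_EFinP.
- apply: aeW => x; rewrite /= in_itv/= => xab.
  apply/fine_cvgP; split; first by apply: nearW.
  rewrite -[X in _ --> X]mulr1; apply: cvgMr; exact: cvg_bump.
- exact: integrable_norm.
- apply: aeW => x n xab; rewrite lee_fin normrM ler_piMr//.
  by rewrite ger0_norm ?bump_ge0// bump_le1.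
move=> _ _ cv.
suff E n : (\int[mu]_(x in `]a, b[) (hn n x)%:E)%E = 0%E.
  have cv0 : (fun n => (\int[mu]_(x in `]a, b[) (EFin \o hn n) x)%E) @ \oo --> 0%E.
    by rewrite (_ : (fun n => _) = cst 0%E); [exact: cvg_cst|exact/funext].
  have e0 : (\int[mu]_(x in `]a, b[) (EFin \o h) x)%E = 0%E.
    exact: (cvg_unique _ cv cv0).
  by rewrite /Rintegral [X in fine X]e0.
have ihn : mu.-integrable `]a, b[ (EFin \o hn n).
  apply: (@le_integrable _ _ _ mu _ mab _ (EFin \o h)) => //.
    apply/measurable_EFinP; apply: measurable_funM => //.
    by apply: measurable_funS (mbump n) => //; exact: measurable_Rpos.
  move=> x _; rewrite lee_fin normrM ler_piMr//.
  by rewrite ger0_norm ?bump_ge0// bump_le1.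
rewrite -[LHS]fineK; last exact: integrable_fin_num.
congr EFin.
rewrite -(H _ (bump_test b a0 (ltr0Sn _ n))) Rintegral_mkcond [LHS]Rintegral_mkcond.
congr Rintegral; apply/funext => x; rewrite !patchE.
case: ifPn => [/set_mem xab|xab].
  by rewrite mem_set//; exact: sub.
case: ifPn => // _; rewrite bump_out ?mulr0//.
by apply: contra xab => xab; rewrite mem_set//= in_itv.
Qed.

(** At almost every x, h x is the derivative at x of the integral of h from a
    fixed left end, which vanishes identically. *)
Lemma Rintegral0_ae0 h : locally_integrable Rpos h ->
  (forall a b, 0 < a -> \int[mu]_(x in `]a, b[) h x = 0) ->
  h = (fun=> 0) %[ae mu in Rpos].
Proof.
move=> lh H.
have an0 n : 0 < n.+1%:R^-1 :> R by rewrite invr_gt0.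
pose K n : set R := `]n.+1%:R^-1, n.+1%:R]%classic.
have mK n : measurable (K n) by exact: measurable_itv.
pose hn n := h \_ (K n).
have ihK n : mu.-integrable (K n) (EFin \o h) by exact: locint_integrable_oc.
have ihn n : mu.-integrable setT (EFin \o hn n).
  by have := proj1 (@integrable_mkcond _ _ _ mu _ _ (mK n)) (ihK n); rewrite restrict_EFin.
have lhn n : locally_integrable setT (hn n) by exact: integrable_locally_restrict.
have /ae_foralln := fun n => @FTC1 R (hn n) (BRight n.+1%:R^-1)
  (fun y => @integrableS _ _ _ mu setT _ _ measurableT (measurable_itv _) (@subsetT _ _) (ihn n)) (lhn n).
apply: aeS => x Hx; rewrite RposE => x0.
pose n := Num.bound (x + x^-1).
have xn : x + x^-1 < n%:R by apply: archi_boundP; rewrite addr_ge0// ?invr_ge0 ltW.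
have xi0 : 0 < x^-1 by rewrite invr_gt0.
have nS : n%:R < n.+1%:R :> R by rewrite ltr_nat.
have x1 : n.+1%:R^-1 < x by rewrite invf_plt ?posrE//; lra.
have x2 : x < n.+1%:R by lra.
have [_] := Hx n x1.
rewrite [RHS]patchE mem_set//; last by rewrite /K /= in_itv/= x1 ltW.
move=> <-; rewrite derive1E -(derive_cst 0 x 1); apply: near_eq_derive.
near=> y.
have yn : y < n.+1%:R by near: y; exact: (open_lt x2).
rewrite -Rintegral_itv_bndo_bndc; last first.
  by apply: (@integrableS _ _ _ mu setT).
rewrite -[RHS](H n.+1%:R^-1 y)//; apply: eq_Rintegral => z /[1!inE]/=.
rewrite in_itv/= => /andP[z1 z2]; rewrite /hn patchE mem_set// /K /= in_itv/= z1.
by rewrite ltW// (lt_trans z2).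
Unshelve. all: by end_near. Qed.

Lemma orthogonal_test_ae0 h : locally_integrable Rpos h ->
  (forall psi, test_function psi -> \int[mu]_(x in Rpos) (h x * psi x) = 0) ->
  h = (fun=> 0) %[ae mu in Rpos].
Proof.
move=> lh H; apply: Rintegral0_ae0 => // a b a0.
exact: orthogonal_test_Rintegral0.
Qed.

End bumps.

(** * The du Bois-Reymond lemma *)

Section dubois.
Context {R : realType}.
Local Notation mu := (@lebesgue_measure R).
Implicit Types (f g h psi : R -> R) (F : nat -> R -> R) (p q : {poly R}).
Implicit Types (a b c x y z : R) (n : nat).

Lemma derive1n_sub psi psi0 c : test_function psi -> test_function psi0 ->
  forall n, derive1n n (fun x => psi x - c * psi0 x) =
    (fun x => derive1n n psi x - c * derive1n n psi0 x).
Proof.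
move=> [d1 _ _] [d0 _ _]; elim => [//|n IH].
rewrite derive1nS IH; apply/funext => x; rewrite derive1E.
have h1 := derivableP (d1 n x); have h0 := is_deriveZ c (derivableP (d0 n x)).
by have [_] := is_deriveB h1 h0; rewrite !derive1nS !derive1E.
Qed.

Lemma test_function_sub psi psi0 c : test_function psi -> test_function psi0 ->
  test_function (fun x => psi x - c * psi0 x).
Proof.
move=> t1 t0.
have [a1 [b1 [a10 ab1 psi1]]] := test_function_supp t1.
have [a2 [b2 [a20 ab2 psi2]]] := test_function_supp t0.
apply: (@test_functionP _ _ (Num.min a1 a2) (Num.max b1 b2)).
- move=> n x; rewrite derive1n_sub//.
  have [d1 _ _] := t1; have [d0 _ _] := t0.
  by have [] := is_deriveB (derivableP (d1 n x)) (is_deriveZ c (derivableP (d0 n x))).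
- by rewrite lt_min a10.
- move=> x xab.
  have p1 : psi x = 0.
    apply: (psi1 0%N); apply: contra xab => /andP[h1 h2].
    by rewrite ge_min le_max h1 h2.
  have p2 : psi0 x = 0.
    apply: (psi2 0%N); apply: contra xab => /andP[h1 h2].
    by rewrite ge_min le_max h1 h2 !orbT.
  by rewrite p1 p2 mulr0 subr0.
Qed.

Lemma test_function_continuous psi : test_function psi -> continuous psi.
Proof.
move=> [d _ _] x; apply: differentiable_continuous; apply/derivable1_diffP.
exact: (d 0%N).
Qed.

Lemma test_function_integrable psi : test_function psi ->
  mu.-integrable setT (EFin \o psi).
Proof.
move=> tpsi; have [a [b [a0 ab psi0n]]] := test_function_supp tpsi.
have psi0 x : ~~ (a <= x <= b) -> psi x = 0 := psi0n 0%N x.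
have ii : mu.-integrable `[a, b] (EFin \o psi).
  apply: continuous_compact_integrable; first exact: segment_compact.
  by apply: continuous_subspaceT; exact: test_function_continuous.
have mi : measurable (`[a, b]%classic : set R) by exact: measurable_itv.
have := proj1 (@integrable_mkcond _ _ _ mu _ _ mi) ii.
congr (integrable _ _ _).
apply/funext => x; rewrite patchE; case: ifPn => // xab.
rewrite /= psi0//; apply: contra xab => xab.
by rewrite mem_set//= in_itv.
Qed.

(** The integral of psi from the left vanishes before the support of psi, and
    beyond it because the total mass is zero. *)
Lemma test_function_primitive psi : test_function psi ->
  \int[mu]_(x in Rpos) psi x = 0 ->
  exists2 chi, test_function chi & forall n, derive1n n.+1 chi = derive1n n psi.
Proof.
move=> tpsi int0; have [a [b [a0 ab psi0n]]] := test_function_supp tpsi.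
have psi0 x : ~~ (a <= x <= b) -> psi x = 0 := psi0n 0%N x.
have ipsi := test_function_integrable tpsi.
have cpsi := test_function_continuous tpsi.
pose chi x := \int[mu]_(t in `]-oo, x]) psi t.
have dchi x : derivable chi x 1 /\ derive1 chi x = psi x.
  apply: (@continuous_FTC1 _ _ _ x (x + 1)) ; first by rewrite ltrDl.
  - by apply: (@integrableS _ _ _ mu setT).
  - by rewrite ltNyr.
  - exact: cpsi.
have dchin n : derive1n n.+1 chi = derive1n n psi.
  rewrite derive1Sn; congr derive1n; apply/funext => z.
  by have [_] := dchi z.
exists chi => //; apply: (@test_functionP _ _ a b) => //.
  case=> [|n] x; first by have [] := dchi x.
  by rewrite dchin; have [+ _ _] := tpsi; exact.
move=> x; rewrite negb_and -!ltNge => /orP[xa|bx].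
  rewrite /chi (_ : Rintegral _ _ _ = \int[mu]_(t in `]-oo, x]) 0).
    by rewrite Rintegral_cst// mul0r.
  apply: eq_Rintegral => t /[1!inE]; rewrite /= in_itv/= => tx.
  rewrite psi0//; apply/negP => /andP[at_ _].
  by have := le_lt_trans at_ (le_lt_trans tx xa); rewrite ltxx.
rewrite -[RHS]int0 /chi Rintegral_mkcond [RHS]Rintegral_mkcond.
congr Rintegral; apply/funext => t; rewrite !patchE.
have [/andP[t1 t2]|/psi0 ->] := boolP (a <= t <= b); last first.
  by case: ifP; case: ifP.
rewrite !mem_set//=; last by rewrite in_itv/= (le_trans t2)// ltW.
by rewrite RposE (lt_le_trans a0).
Qed.

Definition poly_chain p : nat -> R -> R := fun i x => (p^`(i)).[x].

Lemma poly_primitive p : primitive (horner p) (horner p^`()).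
Proof.
apply: primitive_C1 => x _.
apply: differentiable_continuous; apply/derivable1_diffP.
exact: derivable_horner.
Qed.

Lemma poly_chainP n p : chain n (poly_chain p).
Proof.
split; first exact: primitive_locint (poly_primitive _).
by move=> i _; rewrite /poly_chain derivnS; exact: poly_primitive.
Qed.

(** Otherwise the constant 1 would be orthogonal to all test functions. *)
Lemma test_function_mass : exists2 psi : R -> R, test_function psi &
  \int[mu]_(x in Rpos) psi x != 0.
Proof.
apply/not_exists2P => H.
have l1 : locally_integrable Rpos (fun=> 1 : R).
  exact: primitive_locint (primitive_cst 1).
have := @orthogonal_test_Rintegral0 R (fun=> 1) 1 2 l1 ltr01.
have -> : (\int[mu]_(x in `]1, 2[) 1 : R) = 1.
  have e : mu `]1, 2[ = 1%:E.
    rewrite lebesgue_measure_itv/= lte_fin ltr1n -EFinB; congr EFin; lra.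
  by rewrite Rintegral_cst// [X in fine X]e mul1r.
move=> K; suff : (1 : R) = 0 by move=> /eqP; rewrite oner_eq0.
apply: K => psi tpsi; have [//|/negP] := H psi; rewrite negbK => /eqP <-.
by apply: eq_Rintegral => x _; rewrite mul1r.
Qed.

(** The du Bois-Reymond lemma: subtracting from a test function the right
    multiple of a fixed one makes it a derivative of a test function, which
    lowers the order by one at the price of a monomial. *)
Lemma weak_derivative0_poly n h : locally_integrable Rpos h ->
  (forall psi, test_function psi ->
    \int[mu]_(x in Rpos) (h x * derive1n n psi x) = 0) ->
  exists2 p : {poly R}, (size p <= n)%N & h = horner p %[ae mu in Rpos].
Proof.
elim: n h => [|n IH] h lh H.
  exists 0; first by rewrite size_poly0.
  apply: aeS (orthogonal_test_ae0 lh H) => x h0 /h0 ->.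
  by rewrite horner0.
have [psi0 t0 m0] := test_function_mass.
set c0 := Rintegral _ _ _ in m0.
pose d := \int[mu]_(x in Rpos) (h x * derive1n n psi0 x) / c0.
have Hd psi : test_function psi ->
    \int[mu]_(x in Rpos) (h x * derive1n n psi x) =
    d * \int[mu]_(x in Rpos) psi x.
  move=> tpsi; set m := \int[mu]_(x in Rpos) psi x.
  have ti f : test_function f -> mu.-integrable Rpos (EFin \o f).
    move=> tf; apply: (@integrableS _ _ _ mu setT) => //.
      exact: measurable_Rpos.
    exact: test_function_integrable.
  have [] := @test_function_primitive (fun x => psi x - m / c0 * psi0 x).
  - exact: test_function_sub.
  - rewrite RintegralB; last 3 first.
    + exact: measurable_Rpos.
    + exact: ti.
    + by apply: integrable_scale; [exact: measurable_Rpos|exact: ti].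
    rewrite RintegralZl; [|exact: measurable_Rpos|exact: ti].
    by rewrite -/m -/c0; field.
  move=> chi tchi dchi; have := H chi tchi; rewrite dchi derive1n_sub//.
  have -> : (fun x => h x * (derive1n n psi x - m / c0 * derive1n n psi0 x)) =
    (fun x => h x * derive1n n psi x - (m / c0) * (h x * derive1n n psi0 x)).
    by apply/funext => x; ring.
  have i1 := test_integrable n lh tpsi; have i0 := test_integrable n lh t0.
  rewrite RintegralB; last 3 first.
  + exact: measurable_Rpos.
  + exact: i1.
  + by apply: integrable_scale => //; exact: measurable_Rpos.
  rewrite RintegralZl//; last exact: measurable_Rpos.
  by rewrite /d => /eqP; rewrite subr_eq0 => /eqP ->; field.
(* the monomial whose n-th derivative accounts for the multiple d of the mass *)
pose q : {poly R} := ((-1) ^+ n * d / n`!%:R) *: 'X^n.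
have qn : q^`(n) = ((-1) ^+ n * d)%:P.
  rewrite /q derivnZ derivnXn subnn expr0 ffactnn -mul_polyC -polyCMn -polyCM.
  have nf0 : n`!%:R != 0 :> R by rewrite pnatr_eq0 -lt0n fact_gt0.
  by congr polyC; rewrite -mulr_natr mul1r divfK.
have [_ _ wq] := chain_weak_derivative (poly_chainP n q).
have lq : locally_integrable Rpos (horner q) := primitive_locint (poly_primitive q).
have [] := IH (h \- horner q); first exact: locally_integrableB.
  move=> psi tpsi.
  have -> : (fun x => (h \- horner q) x * derive1n n psi x) =
      (fun x => h x * derive1n n psi x - q.[x] * derive1n n psi x).
    by apply/funext => x /=; ring.
  rewrite RintegralB; last 3 first.
  + exact: measurable_Rpos.
  + exact: test_integrable.
  + exact: test_integrable.
  rewrite Hd// [X in _ - X](wq _ tpsi) /poly_chain qn.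
  have -> : (fun x => ((-1) ^+ n * d)%:P.[x] * psi x) =
    (fun x => ((-1) ^+ n * d) * psi x) by apply/funext => x; rewrite hornerC.
  rewrite RintegralZl; [|exact: measurable_Rpos|]; last first.
    apply: (@integrableS _ _ _ mu setT) => //; first exact: measurable_Rpos.
    exact: test_function_integrable.
  by rewrite !mulrA -expr2 sqrr_sign mul1r subrr.
move=> p sp hp; exists (p + q).
  rewrite (leq_trans (size_polyD _ _))// geq_max (leqW sp)/=.
  by rewrite (leq_trans (size_scale_leq _ _))// size_polyXn.
by apply: aeS hp => x hp /hp /= hpx; rewrite hornerD -hpx subrK.
Qed.

Lemma weak_derivative_unique n f g g' :
  weak_derivative n f g -> weak_derivative n f g' -> g = g' %[ae mu in Rpos].
Proof.
move=> [lf lg H] [_ lg' H'].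
have lgg : locally_integrable Rpos (g \- g') by exact: locally_integrableB.
suff : g \- g' = (fun=> 0) %[ae mu in Rpos].
  by apply: aeS => x /= gg /gg /eqP; rewrite subr_eq0 => /eqP.
apply: orthogonal_test_ae0 => // psi tpsi.
have -> : (fun x => (g \- g') x * psi x) = (fun x => g x * psi x - g' x * psi x).
  by apply/funext => x /=; ring.
rewrite RintegralB; last 3 first.
+ exact: measurable_Rpos.
+ exact: (test_integrable 0%N).
+ exact: (test_integrable 0%N).
have s0 : (-1) ^+ n != 0 :> R by rewrite signr_eq0.
apply: (mulfI s0).
by rewrite mulr0 mulrBr -H// -H'// subrr.
Qed.

Lemma weak_derivative_same n f f' g :
  weak_derivative n f g -> weak_derivative n f' g ->
  exists2 p : {poly R}, (size p <= n)%N & f = (fun x => f' x + p.[x]) %[ae mu in Rpos].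
Proof.
move=> [lf lg H] [lf' _ H'].
have [] := @weak_derivative0_poly n (f \- f').
- exact: locally_integrableB.
- move=> psi tpsi.
  have -> : (fun x => (f \- f') x * derive1n n psi x) =
      (fun x => f x * derive1n n psi x - f' x * derive1n n psi x).
    by apply/funext => x /=; ring.
  rewrite RintegralB; last 3 first.
  + exact: measurable_Rpos.
  + exact: test_integrable.
  + exact: test_integrable.
  by rewrite H// H'// subrr.
move=> p sp fp; exists p => //.
by apply: aeS fp => x fp /fp /= <-; rewrite addrC subrK.
Qed.

Lemma chainD n F G : chain n F -> chain n G -> chain n (fun i => F i \+ G i).
Proof.
move=> [lF pF] [lG pG]; split; first exact: locally_integrableD.
by move=> i lin; apply: primitiveD; [exact: pF|exact: pG].
Qed.

Lemma chain_exists n g : locally_integrable Rpos g -> exists2 F,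
  chain n F & F n = g.
Proof.
elim: n g => [|n IH] g lg; first by exists (fun=> g).
have [G Gg] := primitive_exists lg.
have [F [lF pF] Fn] := IH G (primitive_locint Gg).
exists (fun i => if (i <= n)%N then F i else g); last by rewrite ltnn.
split; first by rewrite ltnn.
move=> i; rewrite ltnS => lin; rewrite lin.
by move: lin; rewrite leq_eqVlt => /predU1P[->|lin]; rewrite ?ltnn ?Fn// lin; exact: pF.
Qed.

(** An iterated primitive of g has the same weak derivative as f, so the two
    differ by a polynomial of degree less than n, itself an iterated primitive
    of 0. Hence f has a representative to which the classical calculus
    applies. *)
Lemma weak_derivative_chain n f g : weak_derivative n f g -> exists F,
  [/\ chain n F, F n = g & f = F 0%N %[ae mu in Rpos]].
Proof.
move=> wf; have [_ lg _] := wf.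
have [F cF Fn] := chain_exists n lg.
have := chain_weak_derivative cF; rewrite Fn => wF.
have [p sp fp] := weak_derivative_same wf wF.
exists (fun i => F i \+ poly_chain p i); split.
- exact: chainD (poly_chainP n p).
- apply/funext => x /=; rewrite Fn /poly_chain.
  by rewrite (_ : p^`(n) = 0) ?horner0 ?addr0//; apply: derivn_poly0.
- by apply: aeS fp => x fp /fp ->.
Qed.

End dubois.

(** * Leibniz rule, Taylor representation and product formula *)

Section leibniz.
Context {R : realType}.
Local Notation mu := (@lebesgue_measure R).
Implicit Types (f g h : R -> R) (F G Phi : nat -> R -> R) (p q : {poly R}).
Implicit Types (a b c x y z : R) (n m i j k : nat).

Lemma leibniz_sum k (a b : nat -> R) :
  \sum_(i < k.+1) 'C(k, i)%:R * (a i.+1 * b (k - i)%N + a i * b (k - i).+1) =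
  \sum_(i < k.+2) 'C(k.+1, i)%:R * (a i * b (k.+1 - i)%N).
Proof.
have -> : \sum_(i < k.+2) 'C(k.+1, i)%:R * (a i * b (k.+1 - i)%N) =
    a 0%N * b k.+1 + \sum_(i < k.+1)
      ('C(k, i.+1)%:R * (a i.+1 * b (k - i)%N) + 'C(k, i)%:R * (a i.+1 * b (k - i)%N)).
  rewrite big_ord_recl; congr (_ + _); first by rewrite /= bin0 mul1r subn0.
  by apply: eq_bigr => i _; rewrite lift0 binS natrD mulrDl subSS.
rewrite [X in _ = _ + X]big_split/= [X in _ = _ + (X + _)]big_ord_recr/=.
rewrite bin_small// mul0r addr0 addrA.
have -> : a 0%N * b k.+1 + \sum_(i < k) 'C(k, i.+1)%:R * (a i.+1 * b (k - i)%N) =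
    \sum_(i < k.+1) 'C(k, i)%:R * (a i * b (k - i).+1).
  rewrite [RHS]big_ord_recl; congr (_ + _); first by rewrite /= bin0 mul1r subn0.
  by apply: eq_bigr => i _; rewrite lift0 subnSK.
by rewrite -big_split/=; apply: eq_bigr => i _; ring.
Qed.

Definition leibniz Phi F k x : R :=
  \sum_(i < k.+1) 'C(k, i)%:R * (Phi i x * F (k - i)%N x).

(** One order at a time, from the product rule for primitives and Pascal's
    rule; positivity of n makes the top density locally integrable as part of
    a primitive. *)
Lemma chain_leibniz n Phi F : (0 < n)%N -> chain n Phi -> chain n F ->
  chain n (leibniz Phi F).
Proof.
move=> n0 [lP pP] [lF pF].
have pr k : (k < n)%N -> primitive (leibniz Phi F k) (leibniz Phi F k.+1).
  move=> kn; rewrite /leibniz.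
  have -> : (fun x => \sum_(i < k.+2) 'C(k.+1, i)%:R * (Phi i x * F (k.+1 - i)%N x)) =
    (fun x => \sum_(i < k.+1) 'C(k, i)%:R *
      (Phi i.+1 x * F (k - i)%N x + Phi i x * F (k - i).+1 x)).
    by apply/funext => x; rewrite -(leibniz_sum k (Phi^~ x) (F^~ x)).
  apply: primitive_sum => i _; apply: primitiveZ; apply: primitiveM.
    by apply: pP; rewrite (leq_trans (ltn_ord i)).
  by apply: pF; rewrite (leq_ltn_trans (leq_subr _ _)).
split => //; case: n n0 pr {lP pP lF pF} => // n _ pr.
by case: (pr n (ltnSn n)).
Qed.

Lemma chain_le n m F : (m <= n)%N -> chain n F -> chain m F.
Proof.
move=> mn cF; split; first exact: chain_locint cF mn.
by move=> i im; apply: (proj2 cF); exact: leq_trans mn.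
Qed.

Lemma derivn_XsubC_exp n j c : (j <= n)%N ->
  (('X - c%:P) ^+ n)^`(j) = ('X - c%:P) ^+ (n - j) *+ n ^_ j :> {poly R}.
Proof.
elim: j => [|j IH] jn; first by rewrite subn0 ffactn0 mulr1n.
rewrite derivnS IH ?(ltnW jn)// derivMn deriv_exp derivXsubC mul1r.
by rewrite -mulrnA ffactnSr mulnC subnS.
Qed.

(** Coefficients of the expansion of the kernel (x - t)^n / n! in powers of x. *)
Definition kernel_coef n k : R := (-1) ^+ (n - k) * 'C(n, k)%:R / n`!%:R.

(** The left-hand side is the j-th derivative of (x - t)^n / n! in x, taken at
    t = x. *)
Lemma kernel_diagonal n j x : (j <= n)%N ->
  \sum_(k < n.+1) kernel_coef n k * (('X^k)^`(j)).[x] * x ^+ (n - k) =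
  (j == n)%:R.
Proof.
move=> jn; have nf0 : n`!%:R != 0 :> R by rewrite pnatr_eq0 -lt0n fact_gt0.
apply: (mulfI nf0); rewrite mulr_sumr.
have := congr1 (horner^~ x) (derivn_XsubC_exp x jn).
rewrite [X in (X ^+ n)^`(j)]addrC exprDn linear_sum/= horner_sum.
have -> : (('X - x%:P) ^+ (n - j) *+ n ^_ j).[x] = n`!%:R * (j == n)%:R :> R.
  rewrite hornerMn horner_exp hornerXsubC subrr expr0n subn_eq0.
  have [nj|] := leqP n j.
    have -> : j = n by apply/eqP; rewrite eqn_leq jn nj.
    by rewrite eqxx ffactnn mulr1.
  by move=> jn'; rewrite ltn_eqF// mulr0 mul0rn.
move=> <-; apply: eq_bigr => k _.
rewrite derivnMn hornerMn -polyCN -polyC_exp mul_polyC derivnZ hornerZ.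
rewrite -[RHS]mulr_natr [(- x) ^+ _]exprNn /kernel_coef.
by field.
Qed.

(** Expanding the kernel (x - t)^n / n! under the integral sign turns the
    (n+1)-fold integral of g from 0 into a combination of monomials in x whose
    coefficients are these moments. *)
Definition moment i g x : R := \int[mu]_(t in `]0, x]) (t ^+ i * g t).

Definition origin_integrable g := locally_integrable Rpos g /\
  forall y, 0 < y -> mu.-integrable `]0, y] (EFin \o g).

Lemma origin_integrable_expM i g : origin_integrable g -> origin_integrable (fun t => t ^+ i * g t).
Proof.
move=> [lg ig].
have mX : measurable_fun setT (fun t : R => t ^+ i) by exact: exprn_measurable.
split=> [|y y0].
  have -> : (fun t => t ^+ i * g t) = g \* horner 'X^i.
    by apply/funext => t /=; rewrite hornerXn mulrC.
  by apply: locintM => //; exact: poly_primitive.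
have mg : measurable_fun `]0, y] g.
  by apply/measurable_EFinP; exact: (measurable_int mu (ig y y0)).
apply: (@le_integrable _ _ _ mu `]0, y] (measurable_itv _) _
  (EFin \o (fun t => y ^+ i * g t))).
- apply/measurable_EFinP; exact: measurable_funM.
- move=> t; rewrite /= in_itv/= => /andP[t0 ty].
  rewrite lee_fin !normrM ler_wpM2r// !normrX lerXn2r ?nnegrE//.
  by rewrite !gtr0_norm.
- by apply: integrable_scale => //; exact: ig.
Qed.

Lemma moment_primitive i g : origin_integrable g ->
  primitive (moment i g) (fun t => t ^+ i * g t).
Proof.
move=> /(origin_integrable_expM i)[lg ig].
have := primitive_int 0 lg ig; congr primitive.
by apply/funext => x; rewrite add0r.
Qed.

(** The coefficient of x^k in p plus the (n+1)-fold integral of g; it varies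
    with x through the moment. *)
Definition taylor_coef n p g k x : R :=
  p`_k + kernel_coef n k * moment (n - k) g x.

(** The derivatives of p plus the (n+1)-fold integral of g: by kernel_diagonal,
    the variable coefficients are differentiated as if they were constant,
    until g itself appears in the order n + 1. *)
Definition taylor_chain n p g j x : R :=
  \sum_(k < n.+1) (('X^k)^`(j)).[x] * taylor_coef n p g k x +
  (j == n.+1)%:R * g x.

Lemma taylor_chainP n p g : origin_integrable g -> chain n.+1 (taylor_chain n p g).
Proof.
move=> ig.
have pr j : (j < n.+1)%N ->
    primitive (taylor_chain n p g j) (taylor_chain n p g j.+1).
  move=> jn.
  have -> : taylor_chain n p g j =
      (fun x => \sum_(k < n.+1) (('X^k)^`(j)).[x] * taylor_coef n p g k x).
    by apply/funext => x; rewrite /taylor_chain (ltn_eqF jn) mul0r addr0.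
  have -> : taylor_chain n p g j.+1 = (fun x => \sum_(k < n.+1)
     ((('X^k)^`(j.+1)).[x] * taylor_coef n p g k x +
      (('X^k)^`(j)).[x] * (0 + kernel_coef n k * (x ^+ (n - k) * g x)))).
    apply/funext => x; rewrite big_split/=; congr (_ + _).
    rewrite eqSS -(@kernel_diagonal n j x)// mulr_suml; apply: eq_bigr => k _.
    by ring.
  apply: primitive_sum => k _; apply: primitiveM.
    by rewrite derivnS; exact: poly_primitive.
  apply: primitiveD; first exact: primitive_cst.
  by apply: primitiveZ; exact: moment_primitive.
split => //; by case: (pr n (ltnSn n)).
Qed.

Lemma taylor_chain0 n p g x :
  taylor_chain n p g 0 x = \sum_(k < n.+1) x ^+ k * taylor_coef n p g k x.
Proof.
by rewrite /taylor_chain mul0r addr0; apply: eq_bigr => k _; rewrite hornerXn.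
Qed.

Lemma taylor_chain_top n p g : taylor_chain n p g n.+1 = g.
Proof.
apply/funext => x; rewrite /taylor_chain eqxx mul1r big1 ?add0r// => k _.
by rewrite derivn_poly0 ?horner0 ?mul0r// size_polyXn.
Qed.

(** Integrability of g up to the origin allows all the integrals to start at 0,
    leaving only the polynomial undetermined. *)
Lemma taylor_repr n f g : origin_integrable g -> weak_derivative n.+1 f g ->
  exists p, f = taylor_chain n p g 0 %[ae mu in Rpos].
Proof.
move=> ig wf; have := chain_weak_derivative (taylor_chainP n 0 ig).
rewrite taylor_chain_top => /(weak_derivative_same wf)[p sp fp]; exists p.
apply: aeS fp => x fp /fp ->.
rewrite !taylor_chain0 (horner_coef_wide _ sp) -big_split/=.
by apply: eq_bigr => k _; rewrite /taylor_coef coef0; ring.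
Qed.

Lemma locint_ae f f' : measurable_fun Rpos f' -> f = f' %[ae mu in Rpos] ->
  locally_integrable Rpos f -> locally_integrable Rpos f'.
Proof.
move=> mf' ff' lf; have mf : measurable_fun Rpos f by case: lf.
have ms h x y : measurable_fun Rpos h -> 0 < x ->
    measurable_fun `[x, y] (EFin \o (fun t => `|h t|)).
  move=> mh x0; apply/measurable_EFinP; apply: measurableT_comp => //.
  by apply: measurable_funS mh; [exact: measurable_Rpos|exact: Rpos_itv].
apply: locintP => // x y x0 xy.
have /integrableP[_ fi] := locint_integrable y lf x0.
apply/integrableP; split.
  apply/measurable_EFinP; apply: measurable_funS mf'.
    exact: measurable_Rpos.
  exact: Rpos_itv.
rewrite (le_lt_trans _ fi)// le_eqVlt; apply/orP; left; apply/eqP.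
apply: ae_eq_integral => //; [exact: ms mf' x0|exact: ms mf x0|].
by apply: aeS ff' => t ff' /(Rpos_itv x0) /ff' /= ->.
Qed.

(** The product formula behind the theorem: since the Taylor coefficients are
    differentiated as if they were constant, the derivative of order m of phi f
    only involves those of the products phi x^k, with the Taylor coefficients
    of f, and the top derivative g of f when m = n + 1. *)
Lemma weak_derivative_multiplier n m p g phi (G : nat -> R -> R) :
  (0 < m)%N -> (m <= n.+1)%N -> origin_integrable g ->
  (forall k, (k < n.+1)%N -> weak_derivative m (fun x => phi x * x ^+ k) (G k)) ->
  weak_derivative m (fun x => phi x * taylor_chain n p g 0 x)
    (fun x => \sum_(k < n.+1) taylor_coef n p g k x * G k x +
       (m == n.+1)%:R * (phi x * g x)).
Proof.
move=> m0 mn ig wG.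
have wphi : weak_derivative m phi (G 0%N).
  by have := wG 0%N (ltn0Sn n); congr weak_derivative; apply/funext => x; rewrite mulr1.
have lphi : locally_integrable Rpos phi by case: wphi.
(* the calculus is done on Phi 0, which agrees with phi almost everywhere *)
have [Phi [cPhi _ phiE]] := weak_derivative_chain wphi.
have cF := chain_le mn (taylor_chainP n p ig).
have cD := chain_leibniz m0 cPhi cF.
have wD := chain_weak_derivative cD.
have GE k : (k < n.+1)%N ->
    G k = leibniz Phi (poly_chain 'X^k) m %[ae mu in Rpos].
  move=> kn; have ck := chain_leibniz m0 cPhi (poly_chainP m 'X^k).
  apply: weak_derivative_unique (wG _ kn) _.
  apply: weak_derivative_ae (chain_weak_derivative ck); last 2 first.
  - apply: aeS phiE => x px x0.
    by rewrite /leibniz big_ord1 bin0 mul1r -px// /poly_chain hornerXn.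
  - exact: aeW.
  - by case: (wG k kn).
  - exact: (proj1 ck).
have aeG : \forall x \ae mu, forall k, (k < n.+1)%N -> Rpos x ->
    G k x = leibniz Phi (poly_chain 'X^k) m x.
  apply/ae_foralln => k; have [kn|kn] := ltnP k n.+1.
    by apply: aeS (GE k kn) => x h _; exact: h.
  by apply: aeW => x kn'; move: kn; rewrite leqNgt => /negP.
(* Both sides are the same combination of the derivatives of the x^k, except
   that g enters when m = n + 1, through the term with phi undifferentiated. *)
have DE : leibniz Phi (taylor_chain n p g) m = (fun x =>
    \sum_(k < n.+1) taylor_coef n p g k x * G k x +
    (m == n.+1)%:R * (phi x * g x)) %[ae mu in Rpos].
  apply: aeS (aeI aeG phiE) => x [Gx phix] x0; rewrite phix//.
  under [in RHS]eq_bigr => k _ do rewrite Gx ?ltn_ord//.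
  rewrite /leibniz /taylor_chain /poly_chain.
  transitivity (\sum_(i < m.+1) (\sum_(k < n.+1) taylor_coef n p g k x *
      ('C(m, i)%:R * (Phi i x * ('X^k)^`(m - i).[x])) +
      'C(m, i)%:R * (Phi i x * ((m - i == n.+1)%N%:R * g x)))).
    apply: eq_bigr => i _; rewrite !mulrDr; congr (_ + _).
    by rewrite !mulr_sumr; apply: eq_bigr => k _; ring.
  rewrite big_split/=; congr (_ + _).
    by rewrite exchange_big/=; apply: eq_bigr => k _; rewrite mulr_sumr.
  rewrite big_ord_recl big1 ?addr0 => [|i _].
    by rewrite /= bin0 subn0; ring.
  rewrite lift0 (_ : (m - i.+1 == n.+1)%N = false) ?mul0r ?mulr0//.
  by apply/negbTE; rewrite neq_ltn ltnS; apply/orP; left; lia.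
have ltay : primitive (taylor_chain n p g 0) (taylor_chain n p g 1).
  exact: (proj2 (taylor_chainP n p ig) 0%N (ltn0Sn n)).
apply: weak_derivative_ae wD; last 2 first.
- apply: aeS phiE => x px x0.
  by rewrite /leibniz big_ord1 bin0 mul1r -px.
- exact: DE.
- exact: locintM ltay.
- apply: locint_ae DE _; last by case: cD.
  have mG (k : 'I_n.+1) : measurable_fun Rpos (G k).
    by case: (wG k (ltn_ord k)) => _ [].
  have mg : measurable_fun Rpos g by case: ig => -[].
  have mphi : measurable_fun Rpos phi by case: lphi.
  apply: measurable_funD.
    apply: measurable_sum => k; apply: measurable_funM => //.
    apply: measurable_funD => //; apply: measurable_funM => //.
    exact: primitive_measurable (moment_primitive _ ig).
  by apply: measurable_funM => //; exact: measurable_funM.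
Qed.

(** Being the increment of an integrable density, F stays bounded near 0. *)
Lemma primitive_origin_integrable (F f : R -> R) : primitive F f -> origin_integrable f ->
  (exists M : R, forall x, 0 < x <= 1 -> `|F x| <= M) /\ origin_integrable F.
Proof.
move=> Ff [lf fi]; have lF := primitive_locint Ff.
have bnd y : 0 < y -> exists M : R, forall x, 0 < x <= y -> `|F x| <= M.
  move=> y0; exists (`|F y| + \int[mu]_(t in `]0, y]) `|f t|) => x /andP[x0 xy].
  have := primitive_norm_le Ff x0 xy.
  have : \int[mu]_(t in `]x, y]) `|f t| <= \int[mu]_(t in `]0, y]) `|f t|.
    rewrite -(@Rintegral_itvB _ (fun t => `|f t|) (BRight 0) (BRight y) x);
      rewrite ?bnd_simp ?(ltW x0)//; last by apply: integrable_norm; exact: fi.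
    by rewrite gerBl; exact: Rintegral_ge0.
  move=> h1 h2; have h3 := le_trans h2 h1.
  rewrite -[F x](subrK (F y)) addrC (le_trans (ler_normD _ _))// lerD2l.
  by rewrite distrC.
split; first exact: bnd.
split => // y y0; have [M HM] := bnd y y0.
have mF := primitive_measurable Ff.
apply: measurable_bounded_integrable => //.
- suff : (mu (`]0%R, y]%classic) < +oo)%E by [].
  by rewrite lebesgue_measure_itv/=; case: ifP => _; rewrite ?ltry// -EFinB ltry.
- apply: measurable_funS mF; first exact: measurable_Rpos.
  by move=> t /=; rewrite RposE in_itv/= => /andP[].
- exists M; split; first exact: num_real.
  move=> N MN t; rewrite /= in_itv/= => ty.
  by rewrite (le_trans (HM t ty))// ltW.
Qed.

End leibniz.

(** * Square integrals and Hardy's inequality *)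

Section square_integrals.
Context {R : realType}.
Local Notation mu := (@lebesgue_measure R).
Implicit Types (f g h : R -> R) (D : set R).
Implicit Types (a b c x y z : R) (n m i j k : nat).

Definition sqint D f : \bar R := (\int[mu]_(x in D) (f x ^+ 2)%:E)%E.

Lemma sqint_ge0 D f : (0 <= sqint D f)%E.
Proof. by apply: integral_ge0 => x _; rewrite lee_fin sqr_ge0. Qed.

Lemma measurable_sqr D f : measurable_fun D f ->
  measurable_fun D (fun x => (f x ^+ 2)%:E).
Proof. by move=> mf; apply/measurable_EFinP; exact: measurable_funX. Qed.

Lemma sqint_subset D E f : measurable D -> measurable E -> measurable_fun E f ->
  D `<=` E -> (sqint D f <= sqint E f)%E.
Proof.
move=> mD mE mf DE; apply: ge0_subset_integral => //.
- exact: measurable_sqr.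
- by move=> x _; rewrite lee_fin sqr_ge0.
Qed.

Lemma sqint_le D f g : measurable D -> measurable_fun D f -> measurable_fun D g ->
  (forall x, D x -> `|f x| <= `|g x|) -> (sqint D f <= sqint D g)%E.
Proof.
move=> mD mf mg fg; apply: ge0_le_integral => //.
- by move=> x _; rewrite lee_fin sqr_ge0.
- exact: measurable_sqr.
- exact: measurable_sqr.
- move=> x Dx; rewrite lee_fin -[f x ^+ 2]real_normK ?num_real//.
  by rewrite -[g x ^+ 2]real_normK ?num_real// lerXn2r ?nnegrE// fg.
Qed.

Lemma sqint_ae D f g : measurable D -> measurable_fun D f -> measurable_fun D g ->
  f = g %[ae mu in D] -> sqint D f = sqint D g.
Proof.
move=> mD mf mg fg; apply: ae_eq_integral => //; [exact: measurable_sqr..|].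
by apply: aeS fg => x fg /fg ->.
Qed.

Lemma sqintZ D c f : measurable D -> measurable_fun D f ->
  sqint D (fun x => c * f x) = ((c ^+ 2)%:E * sqint D f)%E.
Proof.
move=> mD mf; rewrite /sqint -ge0_integralZl_EFin ?sqr_ge0//.
- by apply: eq_integral => x _; rewrite exprMn.
- by move=> x _; rewrite lee_fin sqr_ge0.
- exact: measurable_sqr.
Qed.

Lemma sqintD_lty D f g : measurable D -> measurable_fun D f ->
  measurable_fun D g -> (sqint D f < +oo)%E -> (sqint D g < +oo)%E ->
  (sqint D (fun x => (f x + g x)%R) < +oo)%E.
Proof.
move=> mD mf mg foo goo.
have mf2 := measurable_sqr mf; have mg2 := measurable_sqr mg.
apply: (@le_lt_trans _ _ (\int[mu]_(x in D) (2%:E * ((f x ^+ 2)%:E + (g x ^+ 2)%:E)))%E).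
  apply: ge0_le_integral => //.
  - by move=> x _; rewrite lee_fin sqr_ge0.
  - by apply: measurable_sqr; exact: measurable_funD.
  - by apply: measurable_funeM; exact: emeasurable_funD.
  - by move=> x _; rewrite lee_fin; have := sqr_ge0 (f x - g x); lra.
rewrite ge0_integralZl_EFin//; last 2 first.
- by move=> x _; rewrite -EFinD lee_fin addr_ge0// sqr_ge0.
- exact: emeasurable_funD.
rewrite ge0_integralD//; [|by move=> x _; rewrite lee_fin sqr_ge0..].
by rewrite lte_mul_pinfty// lte_add_pinfty.
Qed.

Lemma sqint_sum_lty D (s : seq nat) (f : nat -> R -> R) : measurable D ->
  (forall i, i \in s -> measurable_fun D (f i)) ->
  (forall i, i \in s -> (sqint D (f i) < +oo)%E) ->
  (sqint D (fun x => \sum_(i <- s) f i x)%R < +oo)%E.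
Proof.
move=> mD; elim: s => [|i s IH] mf foo.
  rewrite /sqint (_ : integral _ _ _ = 0)%E//.
  by apply: integral0_eq => x _; rewrite big_nil expr0n.
rewrite (_ : (fun x => _) = (fun x => f i x + \sum_(j <- s) f j x)); last first.
  by apply/funext => x; rewrite big_cons.
have ms j : j \in s -> j \in i :: s by rewrite inE orbC => ->.
apply: sqintD_lty => //.
- by apply: mf; rewrite mem_head.
- rewrite (_ : (fun x => _) = (fun x => \sum_(j < size s) f (nth 0%N s j) x)).
    by apply: measurable_sum => j; apply: mf; apply: ms; exact: mem_nth.
  by apply/funext => x; rewrite (big_nth 0%N) big_mkord.
- by apply: foo; rewrite mem_head.
- by apply: IH => j js; [apply: mf|apply: foo]; exact: ms.
Qed.

Lemma LnormOn2E D f :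
  LnormOn 2%:E D (EFin \o f) = (sqint D f `^ 2^-1)%E.
Proof.
rewrite /LnormOn unlock/=; congr (_ `^ _)%E.
rewrite /sqint [RHS]integral_mkcond; apply: eq_integral => x _.
rewrite !patchE; case: ifP => _; last by rewrite abse0 poweR0r.
have -> : (`|(EFin \o f) x| = `|f x|%:E)%E by [].
by rewrite poweR_EFin powR_mulrn// real_normK ?num_real.
Qed.

Lemma LnormOn2_ltyP D f :
  (LnormOn 2%:E D (EFin \o f) < +oo)%E = (sqint D f < +oo)%E.
Proof.
rewrite LnormOn2E; apply/idP/idP; last exact: poweR_lty.
by apply: lty_poweRy; rewrite invr_eq0.
Qed.

Lemma cauchy_schwarz D f g a b : measurable D -> measurable_fun D f ->
  measurable_fun D g -> (sqint D f <= a%:E)%E -> (sqint D g <= b%:E)%E ->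
  (\int[mu]_(x in D) `|f x * g x|%:E <= (Num.sqrt a * Num.sqrt b)%:E)%E.
Proof.
move=> mD mf mg fa gb.
have mf' : measurable_fun setT (f \_ D) by apply/(measurable_restrictT _ mD).
have mg' : measurable_fun setT (g \_ D) by apply/(measurable_restrictT _ mD).
have half : (2^-1 + 2^-1 = 1 :> R)%R by lra.
have := @hoelder _ _ _ mu _ _ 2 2 mf' mg' (ltr0n _ 2) (ltr0n _ 2) half.
rewrite Lnorm1.
have -> : (\int[mu]_x `|(EFin \o (f \_ D \* g \_ D)%R) x| =
    \int[mu]_(x in D) `|f x * g x|%:E)%E.
  rewrite [RHS]integral_mkcond; apply: eq_integral => x _.
  by rewrite /= !patchE; case: ifP => _ //=; rewrite mulr0 normr0.
move=> /le_trans; apply.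
have sq h c : (sqint D h <= c%:E)%E ->
    ('N[mu]_2%:E [EFin \o h \_ D] <= (Num.sqrt c)%:E)%E.
  move=> hc; rewrite -restrict_EFin -/(LnormOn _ _ _) LnormOn2E.
  have c0 : 0 <= c by rewrite -lee_fin (le_trans _ hc)// sqint_ge0.
  rewrite -powR12_sqrt// -poweR_EFin.
  by apply: gt0_ler_poweR; rewrite ?invr_ge0// ?in_itv/= ?sqint_ge0 ?lee_fin ?c0 leey.
rewrite EFinM lee_pmul ?Lnorm_ge0//; exact: sq.
Qed.

(** Monotone convergence, to reduce estimates on the half-line to bounded
    intervals. *)
Lemma integral_Rpos_lim (f : R -> \bar R) (M : \bar R) : measurable_fun Rpos f ->
  (forall x, Rpos x -> (0 <= f x)%E) ->
  (forall n, (\int[mu]_(x in `]0%R, n%:R]) f x <= M)%E) ->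
  (\int[mu]_(x in Rpos) f x <= M)%E.
Proof.
move=> mf f0 fM.
have sub n : `]0, n%:R] `<=` @Rpos R.
  by move=> x /=; rewrite RposE in_itv/= => /andP[].
have -> : @Rpos R = \bigcup_n `]0, n%:R]%classic.
  apply/seteqP; split => x; last by move=> [n _]; exact: sub.
  rewrite RposE => x0; exists (Num.bound x) => //=.
  by rewrite in_itv/= x0 ltW// archi_boundP// ltW.
have nd : {homo (fun n => `]0, n%:R]%classic : set R) : n m / (n <= m)%N >-> (n <= m)%O}.
  move=> n k nk; apply/subsetPset => x /=; rewrite !in_itv/= => /andP[-> xn].
  by rewrite (le_trans xn)// ler_nat.
have := @ge0_nondecreasing_set_cvg_integral _ (measurableTypeR R) R
  (fun n => `]0, n%:R]%classic) f mu nd (fun n => measurable_itv _).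
have mfn n : measurable_fun (`]0, n%:R]%classic : set R) f.
  by apply: measurable_funS mf; [exact: measurable_Rpos|exact: sub].
have f0n n x : (`]0, n%:R]%classic : set R) x -> (0 <= f x)%E by move=> /sub; exact: f0.
move=> /(_ mfn f0n); apply: cvge_le.
by apply: nearW => n; exact: fM.
Qed.

Lemma sqint_split f x y : 0 <= x -> x <= y -> measurable_fun Rpos f ->
  sqint `]0, y] f = (sqint `]0%R, x] f + sqint `]x, y] f)%E.
Proof.
move=> x0 xy mf; rewrite /sqint.
have -> : `]0, y]%classic = `]0, x] `|` `]x, y] :> set R.
  by rewrite -itv_bndbnd_setU// ?bnd_simp.
rewrite ge0_integral_setU//.
- apply: measurable_sqr; apply: measurable_funS mf; first exact: measurable_Rpos.
  move=> t [] /=; rewrite RposE in_itv/= => /andP[] //.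
  by move=> xt _; exact: le_lt_trans xt.
- by move=> t _; rewrite lee_fin sqr_ge0.
- apply/eqP; rewrite -subset0 => t [] /=; rewrite !in_itv/= => /andP[_ tx] /andP[xt _].
  by have := lt_le_trans xt tx; rewrite ltxx.
Qed.

(** Hardy's inequality, in qualitative form, for the weights w and rho: the
    half-line is cut at the points where the primitive H of |h rho| crosses the
    levels c 2^k, so that H^2 on one piece is comparable with the square of its
    increment over the previous piece, to which Cauchy-Schwarz applies. *)
Lemma hardy (w rho h H : R -> R) (B : R) :
  measurable_fun Rpos w -> measurable_fun Rpos rho -> measurable_fun Rpos h ->
  primitive H (fun t => `|h t * rho t|) -> (forall x, 0 < x -> 0 <= H x) ->
  (sqint Rpos w < +oo)%E -> (sqint Rpos h < +oo)%E ->
  (forall r : R, 0 < r -> (sqint `]0%R, r] rho < +oo)%E) ->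
  (forall r : R, 0 < r -> (sqint `]r, +oo[ w * sqint `]0%R, r] rho <= B%:E)%E) ->
  (sqint Rpos (fun x => (w x * H x)%R) < +oo)%E.
Proof.
move=> mw mrho mh Hp H0 woo hoo rhooo hB.
have mH := primitive_measurable Hp.
have mRx f x y : 0 <= x -> measurable_fun Rpos f -> measurable_fun `]x, y] f.
  move=> x0; apply: measurable_funS; first exact: measurable_Rpos.
  exact: sub_Rpos_oc.
have mRo f x : 0 <= x -> measurable_fun Rpos f -> measurable_fun `]x, +oo[ f.
  move=> x0; apply: measurable_funS; first exact: measurable_Rpos.
  exact: sub_Rpos_o.
have mwH : measurable_fun Rpos (fun x => w x * H x) by exact: measurable_funM.
have Hmono x y : 0 < x -> x <= y -> H x <= H y.
  by move=> x0 xy; rewrite -subr_ge0 (proj2 Hp)//; exact: Rintegral_ge0.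
have bnd x y M : 0 <= x -> (forall t, x < t -> t <= y -> H t <= M) ->
    (sqint `]x, y] (fun t => (w t * H t)%R) <= (M ^+ 2)%:E * sqint `]x, +oo[ w)%E.
  move=> x0 HM; apply: (@le_trans _ _ ((M ^+ 2)%:E * sqint `]x, y] w)%E).
    rewrite -sqintZ//; last exact: mRx.
    apply: sqint_le => //; [exact: mRx|by apply: measurable_funM => //; exact: mRx|].
    move=> t /=; rewrite in_itv/= => /andP[xt ty]; rewrite mulrC !normrM ler_wpM2r//.
    have t0 := le_lt_trans x0 xt.
    by rewrite ger0_norm ?H0// (le_trans (HM t xt ty))// ler_norm.
  rewrite lee_wpmul2l ?lee_fin ?sqr_ge0//; apply: sqint_subset => //; first exact: mRo.
  by move=> t /=; rewrite !in_itv/= => /andP[-> _].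
have W0 : (sqint `]0%R, +oo[ w < +oo)%E by [].
have Wlty x : 0 <= x -> (sqint `]x, +oo[ w < +oo)%E.
  move=> x0; apply: le_lt_trans woo; apply: sqint_subset => //.
  - exact: measurable_Rpos.
  - exact: sub_Rpos_o.
(* a bounded H only needs w to be square-integrable *)
have [[M HM]|unb] := pselect (exists M, forall x, 0 < x -> H x <= M).
  apply: (@le_lt_trans _ _ ((M ^+ 2)%:E * sqint `]0%R, +oo[ w)%E).
    apply: integral_Rpos_lim.
    - exact: measurable_sqr.
    - by move=> x _; rewrite lee_fin sqr_ge0.
    - by move=> n; apply: bnd => // t t0 _; exact: HM.
  by rewrite lte_mul_pinfty ?lee_fin ?sqr_ge0.
(* starting the levels above H 1 places all the crossing points beyond 1 *)
pose c := H 1 + 1.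
have c0 : 0 < c by rewrite /c; have := H0 1 ltr01; lra.
have lev k : exists x, 1 <= x /\ H x = c * 2 ^+ k.
  have [y y0 Hy] : exists2 y, 0 < y & c * 2 ^+ k < H y.
    apply/not_exists2P => nex; apply: unb; exists (c * 2 ^+ k) => x x0.
    by have [//|/negP] := nex x; rewrite -leNgt.
  have ck : c <= c * 2 ^+ k by rewrite ler_peMr ?(ltW c0)// exprn_ege1// ler1n.
  have y1 : 1 <= y.
    rewrite leNgt; apply/negP => y1; have := Hmono _ _ y0 (ltW y1).
    by rewrite /c in ck Hy *; lra.
  have [||x] := @IVT _ H 1 y (c * 2 ^+ k) y1.
  - exact: primitive_continuous Hp ltr01 y1.
  - rewrite ge_min le_max; apply/andP; split; apply/orP; [left|right].
      by rewrite (le_trans _ ck)// /c lerDl.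
    exact: ltW.
  by rewrite in_itv/= => /andP[x1 _] Hx; exists x.
have {lev}[X HX] := choice lev.
have X1 k : 1 <= X k by have [] := HX k.
have HXk k : H (X k) = c * 2 ^+ k by have [] := HX k.
have X0 k : 0 < X k by exact: lt_le_trans (X1 k).
have XS k : X k <= X k.+1.
  rewrite leNgt; apply/negP => XX; have := Hmono _ _ (X0 _) (ltW XX).
  rewrite !HXk exprS leNgt => /negP; apply.
  by rewrite ltr_pM2l// ltr_pMl ?exprn_gt0// ltr1n.
set W := fine (sqint `]0%R, +oo[ w).
have WE : sqint `]0%R, +oo[ w = W%:E by rewrite /W fineK// ge0_fin_numE// sqint_ge0.
have Hle k t : 0 < t -> t <= X k -> H t <= c * 2 ^+ k.
  by move=> t0 tX; rewrite -HXk; exact: Hmono.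
(* on ]X (k+1), X (k+2)] the function H is at most four times its increment
   over ]X k, X (k+1)]; hence the constant 16 *)
have step k : (sqint `]X k.+1, X k.+2] (fun t => (w t * H t)%R) <=
    (16 * B)%:E * sqint `]X k, X k.+1] h)%E.
  apply: (le_trans (bnd _ _ (c * 2 ^+ k.+2) _ _)).
  - exact: ltW.
  - move=> t Xt tX; apply: Hle => //; exact: lt_trans Xt.
  have qoo : (sqint `]X k, X k.+1] h < +oo)%E.
    apply: le_lt_trans hoo; apply: sqint_subset => //; first exact: measurable_Rpos.
    by apply: sub_Rpos_oc; exact: ltW.
  have Soo := rhooo _ (X0 k.+1).
  have := Wlty _ (ltW (X0 k.+1)).
  have := hB _ (X0 k.+1).
  have := @cauchy_schwarz `]X k, X k.+1] h rho (fine (sqint `]X k, X k.+1] h))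
     (fine (sqint `]0, X k.+1] rho)) ltac:(by []) (mRx _ _ _ (ltW (X0 k)) mh)
     (mRx _ _ _ (ltW (X0 k)) mrho).
  rewrite !fineK ?ge0_fin_numE ?sqint_ge0//.
  have h1 : (sqint `]X k, X k.+1] rho <= sqint `]0%R, X k.+1] rho)%E.
    apply: sqint_subset => //; first exact: mRx.
    move=> t /=; rewrite !in_itv/= => /andP[Xt ->]; rewrite andbT.
    exact: lt_trans Xt.
  move=> /(_ (lexx _) h1).
  have -> : (\int[mu]_(x in `]X k, X k.+1]) `|h x * rho x|%:E)%E = (c * 2 ^+ k)%:E.
    have -> : c * 2 ^+ k = H (X k.+1) - H (X k) by rewrite !HXk exprS; ring.
    rewrite (proj2 Hp)// fineK//; apply: integrable_fin_num => //.
    by apply: locint_integrable_oc => //; case: Hp.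
  have := sqint_ge0 `]X k, X k.+1] h; have := sqint_ge0 `]0%R, X k.+1] rho.
  move: qoo Soo.
  case: (sqint `]X k, X k.+1] h) => // q; case: (sqint `]0%R, X k.+1] rho) => // S.
  move=> _ _ S0 q0; rewrite lee_fin/= => qS; rewrite !lee_fin in S0 q0.
  have := sqint_ge0 `]X k.+1, +oo[ w.
  case: (sqint `]X k.+1, +oo[ w) => // w0 w00; rewrite lee_fin in w00.
  rewrite -!EFinM !lee_fin => wSB _.
  have lev2 : (c * 2 ^+ k) ^+ 2 <= q * S.
    rewrite -(sqr_sqrtr q0) -(sqr_sqrtr S0) -exprMn.
    by rewrite lerXn2r ?nnegrE// ?mulr_ge0 ?sqrtr_ge0 ?exprn_ge0 ?(ltW c0).
  have -> : (c * 2 ^+ k.+2) ^+ 2 = 16 * (c * 2 ^+ k) ^+ 2 by rewrite !exprS; ring.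
  rewrite (@le_trans _ _ (16 * (q * S) * w0))//.
    by rewrite ler_wpM2r// ler_wpM2l.
  rewrite (_ : _ * w0 = 16 * (w0 * S) * q); last by ring.
  by rewrite ler_wpM2r// ler_wpM2l.
have B0 : 0 <= B.
  rewrite -lee_fin; apply: le_trans (hB 1 ltr01).
  by rewrite mule_ge0 ?sqint_ge0.
have main k : (sqint `]0%R, X k.+1] (fun t => (w t * H t)%R) <=
    ((c * 2) ^+ 2)%:E * W%:E + (16 * B)%:E * sqint `]0%R, X k] h)%E.
  elim: k => [|k IH].
    apply: (@le_trans _ _ (((c * 2) ^+ 2)%:E * W%:E)%E).
      rewrite -WE; apply: bnd => // t t0 tX.
      by have := Hle 1%N t t0 tX; rewrite expr1.
    by rewrite leeDl// mule_ge0 ?sqint_ge0// lee_fin mulr_ge0.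
  rewrite (@sqint_split _ (X k.+1) (X k.+2)) ?(ltW (X0 _))//.
  rewrite (@sqint_split h (X k) (X k.+1)) ?(ltW (X0 _))//.
  rewrite ge0_muleDr ?sqint_ge0// [leRHS]addeA.
  by apply: leeD; [exact: IH|exact: step].
apply: (@le_lt_trans _ _ (((c * 2) ^+ 2)%:E * W%:E + (16 * B)%:E * sqint Rpos h)%E).
  apply: integral_Rpos_lim; first exact: measurable_sqr.
    by move=> x _; rewrite lee_fin sqr_ge0.
  move=> n.
  have [k nX] : exists k, n%:R <= X k.+1.
    pose N : R := n.+1%:R.
    have N0 : 0 < N by rewrite ltr0n.
    have HN0 : 0 <= H N / c by rewrite divr_ge0 ?H0// ltW.
    exists (Num.bound (H N / c)); rewrite leNgt; apply/negP => Xn.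
    have := archi_boundP HN0; set k := Num.bound _ in Xn *.
    rewrite ltr_pdivrMr// ltNge => /negP; apply.
    have XN : X k.+1 <= N by rewrite (le_trans (ltW Xn))// ler_nat.
    rewrite (le_trans _ (Hmono _ _ (X0 _) XN))// HXk mulrC ler_wpM2l ?(ltW c0)//.
    by rewrite -natrX ler_nat (leq_trans (ltnW (ltn_expl k (ltnSn 1))))// leq_exp2l.
  apply: (@le_trans _ _ (sqint `]0%R, X k.+1] (fun t => (w t * H t)%R))).
    apply: sqint_subset => //; first exact: mRx.
    by move=> t /=; rewrite !in_itv/= => /andP[-> tn]; rewrite (le_trans tn).
  apply: le_trans (main k) _; rewrite leeD2l// lee_wpmul2l ?lee_fin ?mulr_ge0//.
  apply: sqint_subset => //; first exact: measurable_Rpos.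
  exact: sub_Rpos_oc.
rewrite lte_add_pinfty// ?ltry// lte_mul_pinfty// lee_fin mulr_ge0//.
Qed.

End square_integrals.

(** * Polynomials against doubling weights *)

Section doubling.
Context {R : realType}.
Local Notation mu := (@lebesgue_measure R).
Implicit Types (a b c r s x y z : R) (n m i j k l : nat) (p q : {poly R}).

(** The left end is moved to 0 with the right end fixed. An interval whose left
    end is below b / 4 contains the middle half of ]0, 4b/3[; any other one
    contains the middle half of its extension to the left by a third of its
    length, and at most n such extensions are needed. *)
Lemma doubling_reach (nu : R -> R -> R) C delta : 1 <= C ->
  (forall a b, 0 <= nu a b) ->
  (forall a b a' b', 0 <= a' -> a' <= a -> b <= b' -> nu a b <= nu a' b') ->
  (forall a b, 0 <= a -> a < b -> delta <= b - a ->
    nu a b <= C * nu ((a + b) / 2 - (b - a) / 4) ((a + b) / 2 + (b - a) / 4)) ->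
  forall n a b, 0 <= a -> a < b -> delta <= b - a -> b <= (4 / 3) ^+ n * (b - a) ->
  nu 0 b <= C ^+ n.+1 * nu a b.
Proof.
move=> C1 nu0 nuS nuD; elim => [|n IH] a b a0 ab dab.
  rewrite mul1r expr1 => bba; have -> : a = 0 by lra.
  by rewrite ler_peMl.
have [a3 _|a3] := ltP a ((b - a) / 3).
  have b0 : 0 < b by lra.
  have h1 : nu 0 b <= nu 0 (4 * b / 3) by apply: nuS; lra.
  have h2 := nuD 0 (4 * b / 3) (lexx _) ltac:(lra) ltac:(lra).
  have h3 : nu ((0 + 4 * b / 3) / 2 - (4 * b / 3 - 0) / 4)
      ((0 + 4 * b / 3) / 2 + (4 * b / 3 - 0) / 4) <= nu a b by apply: nuS; lra.
  rewrite (le_trans h1)// (le_trans h2)// (@le_trans _ _ (C * nu a b))//.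
    by rewrite ler_wpM2l//; lra.
  rewrite ler_wpM2r// exprS ler_peMr ?exprn_ege1//; lra.
move=> bn; set a' := a - (b - a) / 3.
have a'0 : 0 <= a' by rewrite /a'; lra.
have h1 : nu a' b <= C * nu a b.
  have := nuD a' b a'0; rewrite /a' => /(_ ltac:(lra) ltac:(lra)) h.
  rewrite (le_trans h)// ler_wpM2l//; first lra.
  by apply: nuS => //; lra.
have a'b : a' < b by rewrite /a'; lra.
have dab' : delta <= b - a' by rewrite /a'; lra.
have bn' : b <= (4 / 3) ^+ n * (b - a').
  rewrite (le_trans bn)// exprSr -mulrA le_eqVlt; apply/orP; left; apply/eqP.
  by congr (_ * _); rewrite /a'; field.
rewrite (le_trans (IH a' b a'0 a'b dab' bn'))// [C ^+ n.+2]exprSr -mulrA.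
by rewrite ler_wpM2l// exprn_ge0//; lra.
Qed.

(** Newton interpolation without formulas: values at separated nodes control
    the coefficients, one linear factor at a time. *)
Lemma poly_coef_bound (sigma : R) n : 0 < sigma -> exists2 K : R, 0 < K &
  forall (x : nat -> R) (B : R) p, (size p <= n)%N -> 0 <= B ->
  (forall i, (i < n)%N -> 0 <= x i <= 1) ->
  (forall i j, (i < j)%N -> (j < n)%N -> sigma <= `|x j - x i|) ->
  (forall i, (i < n)%N -> `|p.[x i]| <= B) ->
  forall j, `|p`_j| <= K * B.
Proof.
move=> sigma0; elim: n => [|n [K K0 IH]].
  exists 1 => // x B p; rewrite leqn0 size_poly_eq0 => /eqP -> B0 _ _ _ j.
  by rewrite coef0 normr0 mul1r.
exists (4 * K / sigma + 1) => [|x B p sp B0 x01 xs pB j].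
  by rewrite addr_gt0// divr_gt0// mulr_gt0.
set c := p.[x 0%N].
have /factor_theorem[q qE] : root (p - c%:P) (x 0%N).
  by rewrite /root !hornerE subrr.
have sq : (size q <= n)%N.
  have [->|q0] := eqVneq q 0; first by rewrite size_poly0.
  have : (size (p - c%:P)%R <= n.+1)%N.
    rewrite (leq_trans (size_polyD _ _))// geq_max sp size_polyN.
    by rewrite (leq_trans (size_polyC_leq1 _)).
  by rewrite qE size_mul ?polyXsubC_eq0// size_XsubC addn2.
have qB i : (i < n)%N -> `|q.[x i.+1]| <= 2 * B / sigma.
  move=> lin; rewrite ler_pdivlMr//.
  have := congr1 (horner^~ (x i.+1)) qE; rewrite !hornerE => E.
  apply: (@le_trans _ _ (`|q.[x i.+1]| * `|x i.+1 - x 0%N|)).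
    by rewrite ler_wpM2l// xs.
  rewrite -normrM -E (le_trans (ler_normB _ _))//.
  have := pB i.+1 lin; have := pB 0%N (ltn0Sn n); rewrite -/c; lra.
have B2 : 0 <= 2 * B / sigma by rewrite divr_ge0 ?mulr_ge0// ltW.
have qK := IH (x \o succn) _ q sq B2 (fun i h => x01 i.+1 h)
  (fun i k h1 h2 => xs i.+1 k.+1 h1 h2) qB.
have pE : p`_j = (c%:P)`_j + ((if j is j'.+1 then q`_j' else 0) - q`_j * x 0%N).
  rewrite -[p in LHS](subrK c%:P) qE mulrBr coefD coefB coefMX coefMC addrC.
  by case: j.
have cB : `|(c%:P)`_j| <= B.
  rewrite coefC; case: ifP => _; last by rewrite normr0.
  exact: pB.
have h1 : `|if j is j'.+1 then q`_j' else 0| <= K * (2 * B / sigma).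
  case: j {pE cB} => [|j']; last exact: qK.
  by rewrite normr0 mulr_ge0// ltW.
have h2 : `|q`_j * x 0%N| <= K * (2 * B / sigma).
  rewrite normrM; have /andP[x0 x1] := x01 0%N (ltn0Sn n).
  by rewrite (le_trans _ (qK j))// ler_piMr// ger0_norm.
rewrite pE (le_trans (ler_normD _ _))// mulrDl mul1r [leRHS]addrC lerD//.
rewrite (le_trans (ler_normB _ _))//.
apply: (le_trans (lerD h1 h2)); rewrite le_eqVlt; apply/orP; left; apply/eqP.
by field; lra.
Qed.

(** The intervals [node l i, node l i + width l], i < l, lie in [1/2, 1] at
    distance at least width l from each other. *)
Definition node l i : R := 1 / 2 + (i.*2)%:R / (4 * l)%:R.
Definition width l : R := 1 / (4 * l)%:R.

Lemma node_itv l i : (0 < l)%N -> (i < l)%N ->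
  1 / 2 <= node l i /\ node l i + width l <= 1.
Proof.
move=> l0 il; have l4 : 0 < (4 * l)%:R :> R by rewrite ltr0n; lia.
split; first by rewrite /node lerDl divr_ge0.
rewrite /node /width -addrA -mulrDl -natr1 -[X in _ <= X](subrK (1 / 2)) addrC lerD2r.
rewrite ler_pdivrMr// [leRHS](_ : _ = (2 * l)%:R); first by rewrite natr1 ler_nat; lia.
by rewrite !natrM; field.
Qed.

(** Otherwise p would be small at one point of each of the l separated
    intervals, and interpolation would make all its coefficients small. *)
Lemma poly_large_on_node l : (0 < l)%N -> exists2 K : R, 0 < K &
  forall p, (size p <= l)%N -> forall j, exists2 i, (i < l)%N &
  forall x, node l i <= x <= node l i + width l -> `|p`_j| <= K * `|p.[x]|.
Proof.
move=> l0; have l4 : 0 < (4 * l)%:R :> R by rewrite ltr0n; lia.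
have w0 : 0 < width l by rewrite /width divr_gt0.
have [K K0 HK] := poly_coef_bound l w0.
exists (K + 1) => [|p sp j]; first by rewrite addr_gt0.
apply/not_exists2P => nex.
have bad i : exists x, (i < l)%N -> node l i <= x <= node l i + width l /\
    (K + 1) * `|p.[x]| < `|p`_j|.
  have [il|il] := boolP (i < l)%N; last by exists 0.
  have [//|/existsNP[x /not_implyP[xi /negP]]] := nex i.
  by rewrite -ltNge => px; exists x.
have [x Hx] := choice bad.
have K1 : 0 < K + 1 by rewrite addr_gt0.
have := HK x (`|p`_j| / (K + 1)) p sp _ _ _ _ j.
have B0 : 0 <= `|p`_j| / (K + 1) by rewrite divr_ge0// ltW.
move=> /(_ B0); apply: contraPP => _ Hj.
have pj : 0 < `|p`_j|.
  by have [_] := Hx 0%N l0; apply: le_lt_trans; rewrite mulr_ge0// ltW.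
have : `|p`_j| <= K * (`|p`_j| / (K + 1)).
  apply: Hj.
  - move=> i il; have [/andP[h1 h2] _] := Hx i il; have [h3 h4] := node_itv l0 il.
    apply/andP; split; lra.
  - move=> i k ik kl; have [/andP[h1 h2] _] := Hx i (ltn_trans ik kl).
    have [/andP[h3 h4] _] := Hx k kl.
    rewrite (le_trans _ (ler_norm _))//.
    suff : node l i + width l + width l <= node l k by lra.
    rewrite /node /width -!addrA lerD2l -!mulrDl ler_pM2r ?invr_gt0//.
    by rewrite -[1 + 1]/(2%:R) -natrD ler_nat; lia.
  - move=> i il; have [_ h] := Hx i il.
    by rewrite ler_pdivlMr// mulrC ltW.
rewrite mulrA ler_pdivlMr// mulrC ler_pM2r//; lra.
Qed.

Section weight.
Variables (U : R -> R) (delta C : R).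
Hypothesis mU : measurable_fun Rpos U.
Hypothesis U_lty : forall r, 0 < r -> (sqint `]0%R, r[ U < +oo)%E.
Hypothesis U_gt0 : forall r, 0 < r -> (0 < sqint `]0%R, r[ U)%E.
Hypothesis U_doubling : forall a b, 0 <= a -> a < b -> delta <= b - a ->
  (sqint `]a, b[ U <= C%:E * sqint `]((a + b) / 2 - (b - a) / 4)%R,
                                     ((a + b) / 2 + (b - a) / 4)%R[ U)%E.

Let mUi a b : 0 <= a -> measurable_fun `]a, b[ U.
Proof. by move=> a0; apply: measurable_funS mU; [exact: measurable_Rpos|exact: sub_Rpos_oo]. Qed.

Let Ufin a b : 0 <= a -> sqint `]a, b[ U \is a fin_num.
Proof.
move=> a0; rewrite ge0_fin_numE ?sqint_ge0//.
have [ab|ba] := ltP a b; last first.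
  by rewrite set_itv_ge ?bnd_simp -?leNgt// /sqint integral_set0.
apply: le_lt_trans (U_lty (le_lt_trans a0 ab)); apply: sqint_subset => //.
  exact: mUi.
by move=> t /=; rewrite !in_itv/= => /andP[at_ ->]; rewrite (le_lt_trans a0).
Qed.

Let nu a b := fine (sqint `]a, b[ U).

Let nuS a b a' b' : 0 <= a' -> a' <= a -> b <= b' -> nu a b <= nu a' b'.
Proof.
move=> a'0 aa bb; apply: fine_le; first by apply: Ufin; exact: le_trans aa.
  exact: Ufin.
apply: sqint_subset => //; first exact: mUi.
move=> t /=; rewrite !in_itv/= => /andP[h1 h2].
by rewrite (le_lt_trans aa)//= (lt_le_trans h2).
Qed.

(** The scaled i-th node interval has length r / (4 l) >= delta and right end
    b >= r / 2: doubling_reach bounds the mass of ]0, b[ by that of the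
    interval, and three extensions by the factor 4/3 carry ]0, b[ past r,
    because (4/3)^3 >= 2. *)
Lemma doubling_portion l : (0 < l)%N -> exists2 N, 0 < N & forall i r,
  (i < l)%N -> 0 < r -> (4 * l)%:R * delta <= r ->
  fine (sqint `]0, r[ U) <=
  N * fine (sqint `]r * node l i, r * (node l i + width l)[ U).
Proof.
move=> l0; have l4 : 0 < (4 * l)%:R :> R by rewrite ltr0n; lia.
pose D := Num.max 1 C.
have D1 : 1 <= D by rewrite le_max lexx.
have D0 : 0 < D by apply: lt_le_trans D1.
have nu0 a b : 0 <= nu a b by rewrite fine_ge0// sqint_ge0.
have nuD a b : 0 <= a -> a < b -> delta <= b - a ->
    nu a b <= D * nu ((a + b) / 2 - (b - a) / 4) ((a + b) / 2 + (b - a) / 4).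
  move=> a0 ab dab; have m0 : 0 <= (a + b) / 2 - (b - a) / 4 by lra.
  apply: (@le_trans _ _ (C * nu ((a + b) / 2 - (b - a) / 4) ((a + b) / 2 + (b - a) / 4))).
    by rewrite -lee_fin EFinM !fineK ?Ufin//; exact: U_doubling.
  by rewrite ler_wpM2r// le_max lexx orbT.
have reach := doubling_reach D1 nu0 nuS nuD.
have [n hn] : exists n, (4 * l)%:R <= (4 / 3 : R) ^+ n.
  (* by Bernoulli's inequality *)
  exists (12 * l)%N; suff h k : 1 + k%:R / 3 <= (4 / 3 : R) ^+ k.
    by apply: le_trans (h _); rewrite !natrM; lra.
  elim: k => [|k IHk]; first by rewrite mul0r addr0 expr0.
  rewrite exprS; apply: (@le_trans _ _ (4 / 3 * (1 + k%:R / 3))).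
    by rewrite -natr1; have : 0 <= k%:R :> R by []; lra.
  rewrite ler_wpM2l//; lra.
exists (D ^+ 3 * D ^+ n.+1); first by rewrite mulr_gt0// exprn_gt0.
move=> i r il r0 lr; have [n1 n2] := node_itv l0 il.
set a := r * node l i; set b := r * (node l i + width l).
have w0 : 0 < width l by rewrite /width divr_gt0.
have a0 : 0 <= a by rewrite mulr_ge0//; lra.
have ba : b - a = r / (4 * l)%:R by rewrite /a /b /width; ring.
have ab : a < b by rewrite -subr_gt0 ba divr_gt0.
have br : b <= r by rewrite /b ler_piMr// ltW.
have dab : delta <= b - a by rewrite ba ler_pdivlMr// mulrC.
have r2b : r <= 2 * b.
  have : r * (1 / 2) <= a by rewrite /a ler_wpM2l// ltW.
  lra.
have h1 : nu 0 b <= D ^+ n.+1 * nu a b.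
  apply: reach => //; rewrite ba mulrA ler_pdivlMr// mulrC.
  by rewrite (le_trans (ler_wpM2l _ br))// ?(ltW l4)// ler_wpM2r// ltW.
have grow y : 0 < y -> delta <= y -> nu 0 (4 / 3 * y) <= D * nu 0 y.
  move=> y0 dy; have y1 : 0 < 4 / 3 * y by lra.
  have y2 : delta <= 4 / 3 * y - 0 by lra.
  have := nuD 0 (4 / 3 * y) (lexx _) y1 y2.
  move=> /le_trans; apply; rewrite ler_wpM2l ?(ltW D0)//; apply: nuS; lra.
have b0 : 0 < b by lra.
have db : delta <= b by lra.
have g1 := grow b b0 db.
have b1 : 0 < 4 / 3 * b by lra.
have db1 : delta <= 4 / 3 * b by lra.
have g2 := grow (4 / 3 * b) b1 db1.
have b2 : 0 < 4 / 3 * (4 / 3 * b) by lra.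
have db2 : delta <= 4 / 3 * (4 / 3 * b) by lra.
have g3 := grow (4 / 3 * (4 / 3 * b)) b2 db2.
rewrite -/(nu _ _) -/(nu _ _).
apply: (@le_trans _ _ (nu 0 (4 / 3 * (4 / 3 * (4 / 3 * b))))).
  by apply: nuS; lra.
have D00 := ltW D0.
have G2 := ler_wpM2l D00 g2.
have G1 := ler_wpM2l D00 (ler_wpM2l D00 g1).
have G0 := ler_wpM2l D00 (ler_wpM2l D00 (ler_wpM2l D00 h1)).
rewrite (le_trans g3)// (le_trans G2)// (le_trans G1)// (le_trans G0)//.
by rewrite !exprS expr0 mulr1 !mulrA.
Qed.

Lemma horner_bounded p r : exists2 M, 0 <= M &
  forall x, 0 <= x <= r -> `|p.[x]| <= M.
Proof.
exists (\sum_(k < size p) `|p`_k| * `|r| ^+ k).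
  by apply: sumr_ge0 => k _; rewrite mulr_ge0// exprn_ge0.
move=> x /andP[x0 xr]; rewrite horner_coef (le_trans (ler_norm_sum _ _ _))//.
apply: ler_sum => k _; rewrite normrM normrX ler_wpM2l// lerXn2r ?nnegrE//.
by rewrite !ger0_norm// (le_trans x0).
Qed.

Let mhU p s r : 0 <= s -> measurable_fun `]s, r[ (fun x => p.[x] * U x).
Proof.
move=> s0; apply: measurable_funM; last exact: mUi.
apply: measurable_funS (primitive_measurable (poly_primitive p)).
  exact: measurable_Rpos.
exact: sub_Rpos_oo.
Qed.

Lemma horner_sqint_lty p s r : 0 <= s ->
  (sqint `]s, r[ (fun x => (p.[x] * U x)%R) < +oo)%E.
Proof.
move=> s0; have [M M0 HM] := horner_bounded p r.
apply: (@le_lt_trans _ _ ((M ^+ 2)%:E * sqint `]s, r[ U)%E).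
  rewrite -sqintZ//; last exact: mUi.
  apply: sqint_le => //; [exact: mhU|by apply: measurable_funM => //; exact: mUi|].
  move=> x; rewrite /= in_itv/= => /andP[sx xr]; rewrite !normrM ler_wpM2r//.
  by rewrite (le_trans (HM x _)) ?ler_norm// !ltW// (le_lt_trans s0).
by rewrite lte_mul_pinfty ?lee_fin ?sqr_ge0// -ge0_fin_numE ?sqint_ge0 ?Ufin.
Qed.

(** After rescaling to r = 1, p is comparable from below with each of its
    coefficients on one of finitely many intervals inside ]r/2, r[, each of
    which carries a fixed portion of the mass of ]0, r[. *)
Lemma poly_weight_lower n : exists2 kappa, 0 < kappa & forall p r s j,
  (size p <= n.+1)%N -> (j < n.+1)%N -> 0 < r -> (4 * n.+1)%:R * delta <= r ->
  0 <= s -> s <= r / 2 ->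
  kappa * (p`_j * r ^+ j) ^+ 2 * fine (sqint `]0, r[ U) <=
  fine (sqint `]s, r[ (fun x => p.[x] * U x)).
Proof.
have [K K0 HK] := poly_large_on_node (ltn0Sn n).
have [N N0 HN] := doubling_portion (ltn0Sn n).
exists (K ^- 2 / N); first by rewrite divr_gt0// invr_gt0 exprn_gt0.
move=> p r s j sp jn r0 dr s0 sr.
pose q : {poly R} := \poly_(k < n.+1) (p`_k * r ^+ k).
have qE y : q.[y] = p.[r * y].
  rewrite horner_poly (horner_coef_wide _ sp); apply: eq_bigr => k _.
  by rewrite exprMn mulrA.
have qj : q`_j = p`_j * r ^+ j by rewrite coef_poly jn.
have [i il Hi] := HK q (size_poly _ _) j.
have [n1 n2] := node_itv (ltn0Sn n) il.
set a := r * node n.+1 i; set b := r * (node n.+1 i + width n.+1).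
have ar : r / 2 <= a by rewrite /a ler_wpM2l// ?(ltW r0)//; lra.
have a0 : 0 <= a by lra.
have br : b <= r by rewrite /b ler_piMr// ltW.
have h1 : (((q`_j / K) ^+ 2)%:E * sqint `]a, b[ U <=
    sqint `]s, r[ (fun x => (p.[x] * U x)%R))%E.
  rewrite -sqintZ//; last exact: mUi.
  apply: (@le_trans _ _ (sqint `]a, b[ (fun x => (p.[x] * U x)%R))).
    apply: sqint_le => //; [by apply: measurable_funM => //; exact: mUi|exact: mhU|].
    move=> x; rewrite /= in_itv/= => /andP[ax xb]; rewrite !normrM ler_wpM2r//.
    rewrite normfV (gtr0_norm K0) ler_pdivrMr// mulrC.
    rewrite -[x](mulfVK (lt0r_neq0 r0)) [x / r * r]mulrC -qE.
    apply: Hi; rewrite ler_pdivlMr// ler_pdivrMr// [_ * r]mulrC [_ * r]mulrC.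
    by rewrite !ltW.
  apply: sqint_subset => //; first exact: mhU.
  move=> x /=; rewrite !in_itv/= => /andP[ax xb].
  by rewrite (le_lt_trans _ ax) ?(lt_le_trans xb)//; lra.
have h2 := HN i r il r0 dr; rewrite -/a -/b in h2.
rewrite -lee_fin [X in (_ <= X)%E]fineK; last first.
  by rewrite ge0_fin_numE ?sqint_ge0//; exact: horner_sqint_lty.
apply: le_trans h1; rewrite -[sqint `]a, b[ U]fineK ?Ufin// -EFinM lee_fin.
rewrite -qj; set A := fine _ in h2 *; set B := fine _ in h2 *.
apply: (@le_trans _ _ (K ^- 2 / N * q`_j ^+ 2 * (N * B))).
  by rewrite ler_wpM2l// mulr_ge0 ?sqr_ge0// divr_ge0 ?(ltW N0)// invr_ge0 sqr_ge0.
rewrite le_eqVlt; apply/orP; left; apply/eqP.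
by field; rewrite !gt_eqF.
Qed.

(** For U = 1/u and the function h = p U, this is the integral of the density
    h / u on ]s, r[; on products of monomials it is their Gram matrix. *)
Definition wint s r p : R := \int[mu]_(x in `]s, r[) (p.[x] * U x ^+ 2).

Let wint_integrable s r p : 0 <= s ->
  mu.-integrable `]s, r[ (EFin \o (fun x => p.[x] * U x ^+ 2)).
Proof.
move=> s0; apply/integrableP; split.
  apply/measurable_EFinP; apply: (eq_measurable_fun (fun x => (p.[x] * U x) * U x)).
    by move=> x _; rewrite expr2 mulrA.
  by apply: measurable_funM; [exact: mhU|exact: mUi].
have h1 := horner_sqint_lty p r s0.
have h2 : (sqint `]s, r[ U < +oo)%E by rewrite -ge0_fin_numE ?sqint_ge0// Ufin.
have h3 := @cauchy_schwarz R `]s, r[ (fun x => p.[x] * U x) U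
  (fine (sqint `]s, r[ (fun x => p.[x] * U x))) (fine (sqint `]s, r[ U))
  (measurable_itv _) (@mhU p s r s0) (@mUi s r s0).
apply: (@le_lt_trans _ _ (\int[mu]_(x in `]s, r[) `|p.[x] * U x * U x|%:E)%E).
  rewrite le_eqVlt; apply/orP; left; apply/eqP; apply: eq_integral => x _.
  by rewrite /= expr2 mulrA.
apply: le_lt_trans (h3 _ _) _; rewrite ?fineK ?ge0_fin_numE ?sqint_ge0//.
exact: ltry.
Qed.

Lemma wintD s r p q : 0 <= s -> wint s r (p + q) = wint s r p + wint s r q.
Proof.
move=> s0; rewrite /wint -RintegralD//; [|exact: wint_integrable..].
by apply: eq_Rintegral => x _; rewrite hornerD mulrDl.
Qed.

Lemma wintZ s r c p : 0 <= s -> wint s r (c *: p) = c * wint s r p.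
Proof.
move=> s0; have ip := wint_integrable r p s0.
rewrite /wint -(@RintegralZl _ _ _ mu `]s, r[ _ c (measurable_itv _) ip).
by apply: eq_Rintegral => x _; rewrite hornerZ -mulrA.
Qed.

Lemma wint_sum s r n (c : 'I_n -> R) (p : 'I_n -> {poly R}) : 0 <= s ->
  wint s r (\sum_(k < n) c k *: p k) = \sum_(k < n) c k * wint s r (p k).
Proof.
move=> s0; rewrite (big_morph (wint s r) (id1 := 0) (op1 := +%R)).
- by apply: eq_bigr => k _; rewrite wintZ.
- by move=> p1 p2; rewrite wintD.
- by rewrite -[0 in LHS](scale0r 0) wintZ// mul0r.
Qed.

Lemma wint_sqr s r p : 0 <= s ->
  wint s r (p * p) = fine (sqint `]s, r[ (fun x => p.[x] * U x)).
Proof.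
move=> s0; congr fine; apply: eq_integral => x _.
by rewrite hornerM exprMn expr2.
Qed.

(** Inverting the Gram matrix of the monomials produces a density whose only
    nonzero moment is the j-th one. Its squared norm is its own j-th
    coefficient, so the lower bound for polynomials makes it as small, up to a
    constant, as the j-th moment alone would allow. *)
Lemma one_moment_density n : exists2 kappa, 0 < kappa & forall r s j,
  (j < n.+1)%N -> 0 < r -> (4 * n.+1)%:R * delta <= r -> 0 <= s -> s <= r / 2 ->
  exists p, (forall k, (k < n.+1)%N -> wint s r (p * 'X^k) = (k == j)%:R) /\
    (sqint `]s, r[ (fun x => (p.[x] * U x)%R) *
     sqint `]0%R, r[ (fun x => (x ^+ j * U x)%R) <= kappa%:E)%E.
Proof.
have [kappa kappa0 low] := poly_weight_lower n.
exists kappa^-1 => [|r s j jn r0 dr s0 sr]; first by rewrite invr_gt0.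
pose G : 'M[R]_n.+1 := \matrix_(a, b) wint s r ('X^a * 'X^b).
pose P (v : 'rV[R]_n.+1) : {poly R} := \sum_(k < n.+1) v 0 k *: 'X^k.
have Pcoef v (k : 'I_n.+1) : (P v)`_k = v 0 k.
  rewrite /P coef_sum (bigD1 k)//= coefZ coefXn eqxx mulr1 big1 ?addr0// => i ik.
  rewrite coefZ coefXn; have -> : (k == i :> nat) = false by apply/negbTE; rewrite eq_sym; exact: ik.
  by rewrite mulr0.
have Psize v : (size (P v) <= n.+1)%N.
  apply: (leq_trans (size_sum _ _ _)); apply/bigmax_leqP => k _.
  by rewrite (leq_trans (size_scale_leq _ _))// size_polyXn.
have PG v (b : 'I_n.+1) : wint s r (P v * 'X^b) = (v *m G) 0 b.
  rewrite /P mulr_suml mxE.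
  under eq_bigr do rewrite -scalerAl.
  by rewrite wint_sum//; apply: eq_bigr => k _; rewrite mxE.
have PP (v : 'rV[R]_n.+1) : wint s r (P v * P v) = \sum_b v 0 b * (v *m G) 0 b.
  rewrite {2}/P mulr_sumr; under eq_bigr do rewrite -scalerAr.
  by rewrite wint_sum//; apply: eq_bigr => k _; rewrite PG.
have nu_gt0 : 0 < fine (sqint `]0, r[ U).
  by rewrite fine_gt0// U_gt0// U_lty.
have plow (v : 'rV[R]_n.+1) (b : 'I_n.+1) : kappa * (v 0 b * r ^+ b) ^+ 2 * fine (sqint `]0, r[ U) <=
    \sum_b v 0 b * (v *m G) 0 b.
  by rewrite -PP wint_sqr// -Pcoef; apply: low.
(* the lower bound makes the Gram form positive definite *)
have Gunit : G \in unitmx.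
  rewrite unitmxE unitfE; apply/det0P => -[v v0 vG]; move/negP: v0; apply.
  apply/eqP/rowP => b; rewrite mxE; apply/eqP.
  have := plow v b; rewrite vG big1 => [h|k _]; last by rewrite mxE mulr0.
  have : (v 0 b * r ^+ b) ^+ 2 <= 0.
    by rewrite -(pmulr_rle0 _ kappa0) -(pmulr_lle0 _ nu_gt0).
  move=> h0; have : (v 0 b * r ^+ b) ^+ 2 == 0 by rewrite eq_le h0 sqr_ge0.
  by rewrite sqrf_eq0 mulf_eq0 [_ ^+ b == 0]gt_eqF ?exprn_gt0// orbF.
pose j' := Ordinal jn.
pose v : 'rV[R]_n.+1 := delta_mx 0 j' *m invmx G.
have vG : v *m G = delta_mx 0 j' by rewrite /v mulmxKV.
have mom (k : 'I_n.+1) : wint s r (P v * 'X^k) = (k == j')%:R.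
  by rewrite PG vG mxE eqxx.
exists (P v); split => [k kn|]; first exact: (mom (Ordinal kn)).
have vj : \sum_b v 0 b * (v *m G) 0 b = v 0 j'.
  rewrite vG (bigD1 j')//= [delta_mx _ _ _ _]mxE !eqxx mulr1 big1 ?addr0// => b bj.
  by rewrite [delta_mx _ _ _ _]mxE (negbTE bj) andbF mulr0.
have := plow v j'; rewrite vj => vlow.
have vge0 : 0 <= v 0 j' by rewrite -vj -PP wint_sqr// fine_ge0// sqint_ge0.
have -> : sqint `]s, r[ (fun x => ((P v).[x] * U x)%R) = (v 0 j')%:E.
  rewrite -vj -PP wint_sqr// fineK// ge0_fin_numE ?sqint_ge0//.
  exact: horner_sqint_lty.
(* the one-moment problem costs at least 1 / S r; S r is at most r^2j times
   the mass, which is what the lower bound compares with the norm of P v *)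
have Sle : (sqint `]0%R, r[ (fun x => (x ^+ j * U x)%R) <=
    ((r ^+ j) ^+ 2)%:E * sqint `]0%R, r[ U)%E.
  rewrite -sqintZ//; last exact: mUi.
  apply: sqint_le => //; last 1 first.
  - move=> x; rewrite /= in_itv/= => /andP[x0 xr]; rewrite !normrM ler_wpM2r//.
    by rewrite !normrX lerXn2r ?nnegrE// !gtr0_norm// ltW.
  - apply: measurable_funM; last exact: mUi.
    by apply: measurable_funTS; exact: exprn_measurable.
  - by apply: measurable_funM => //; exact: mUi.
apply: le_trans (lee_wpmul2l _ Sle) _; first by rewrite lee_fin.
rewrite -[sqint `]0%R, r[ U]fineK ?Ufin// -!EFinM lee_fin.
set S := fine _ in vlow nu_gt0 *.
have [->|vn0] := eqVneq (v 0 j') 0; first by rewrite mul0r invr_ge0 ltW.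
have vgt0 : 0 < v 0 j' by rewrite lt_neqAle eq_sym vn0.
rewrite -[leRHS]mulr1 ler_pdivlMl// -(ler_pM2r vgt0) mul1r.
apply: le_trans vlow; rewrite le_eqVlt; apply/orP; left; apply/eqP.
by rewrite /j'/=; ring.
Qed.

End weight.
End doubling.

(** * Gliding humps *)

Section hump.
Context {R : realType}.
Local Notation mu := (@lebesgue_measure R).
Implicit Types (a b c r s x y z : R) (n m i j k l : nat) (p q : {poly R}).
Implicit Types (f g h w U : R -> R).

Lemma sqint_patch (D E : set R) f : sqint D (f \_ E) = sqint (D `&` E) f.
Proof.
rewrite /sqint integral_mkcondr; apply: eq_integral => x _.
by rewrite !patchE; case: ifP => // _; rewrite expr0n.
Qed.

Lemma origin_integrable_mul h U : measurable_fun Rpos h -> measurable_fun Rpos U ->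
  (sqint Rpos h < +oo)%E -> (forall r, 0 < r -> (sqint `]0%R, r[ U < +oo)%E) ->
  origin_integrable (fun x => h x * U x).
Proof.
move=> mh mU hoo Uoo.
have ioc y : 0 < y -> mu.-integrable `]0, y] (EFin \o (fun x => h x * U x)).
  move=> y0; have sub := @sub_Rpos_oc R 0 y (lexx _).
  have mi : measurable (`]0, y]%classic : set R) by exact: measurable_itv.
  have mhy : measurable_fun `]0, y] h.
    by apply: measurable_funS mh; [exact: measurable_Rpos|].
  have mUy : measurable_fun `]0, y] U.
    by apply: measurable_funS mU; [exact: measurable_Rpos|].
  have h1 : (sqint `]0%R, y] h < +oo)%E.
    by apply: le_lt_trans hoo; apply: sqint_subset => //; exact: measurable_Rpos.
  have h2 : (sqint `]0%R, y] U < +oo)%E.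
    have y1 : 0 < y + 1 by rewrite addr_gt0.
    apply: le_lt_trans (Uoo _ y1); apply: sqint_subset => //.
      apply: measurable_funS mU; first exact: measurable_Rpos.
      by move=> t /=; rewrite RposE in_itv/= => /andP[].
    move=> t /=; rewrite !in_itv/= => /andP[-> ty] /=.
    by rewrite (le_lt_trans ty)// ltrDl.
  apply/integrableP; split; first by apply/measurable_EFinP; exact: measurable_funM.
  have := @cauchy_schwarz R _ h U (fine (sqint `]0, y] h)) (fine (sqint `]0, y] U))
    mi mhy mUy.
  rewrite !fineK ?ge0_fin_numE ?sqint_ge0// => /(_ (lexx _) (lexx _)).
  by move=> /le_lt_trans; apply; exact: ltry.
split => //; apply: locintP; first exact: measurable_funM.
move=> x y x0 xy; have y0 := lt_le_trans x0 xy.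
apply: (@integrableS _ _ _ mu `]0, y]) => //; last exact: ioc.
by move=> t /=; rewrite !in_itv/= => /andP[xt ->]; rewrite (lt_le_trans x0).
Qed.

Section weight.
Variables (U w : R -> R) (delta C : R) (n j : nat).
Hypothesis mU : measurable_fun Rpos U.
Hypothesis U_lty : forall r, 0 < r -> (sqint `]0%R, r[ U < +oo)%E.
Hypothesis U_gt0 : forall r, 0 < r -> (0 < sqint `]0%R, r[ U)%E.
Hypothesis U_doubling : forall a b, 0 <= a -> a < b -> delta <= b - a ->
  (sqint `]a, b[ U <= C%:E * sqint `]((a + b) / 2 - (b - a) / 4)%R,
                                     ((a + b) / 2 + (b - a) / 4)%R[ U)%E.
Hypothesis mw : measurable_fun Rpos w.
Hypothesis w_lty : (sqint Rpos w < +oo)%E.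
Hypothesis jn : (j < n.+1)%N.

Let S r := sqint `]0%R, r[ (fun x => (x ^+ j * U x)%R).

Let SE r : S r = sqint `]0%R, r[ (fun x => (('X^j : {poly R}).[x] * U x)%R).
Proof. by apply: eq_integral => x _; rewrite hornerXn. Qed.

Let S_lty r : (S r < +oo)%E.
Proof. by rewrite SE; apply: horner_sqint_lty => //; exact: U_lty. Qed.

Let mSf : measurable_fun Rpos (fun x => x ^+ j * U x).
Proof.
apply: measurable_funM => //; apply: measurable_funTS; exact: exprn_measurable.
Qed.

Let S_mono r r' : r <= r' -> (S r <= S r')%E.
Proof.
move=> rr; apply: sqint_subset => //.
  by apply: measurable_funS mSf; [exact: measurable_Rpos|exact: sub_Rpos_oo].
by move=> t /=; rewrite !in_itv/= => /andP[-> tr]; rewrite (lt_le_trans tr).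
Qed.

Hypothesis unbounded : forall B : R, exists2 r, 0 < r &
  (B%:E < sqint `]r, +oo[ w * S r)%E.

(** The product in the unboundedness hypothesis is bounded for r in bounded sets,
    so it provides an r beyond 2 s and beyond the scale of the doubling
    property. Multiplying the one-moment density by M = 2^-N sqrt (S r) makes
    its norm of order 2^-N, hence summable over N, while the norm of M w to the
    right of r, already on a bounded interval, is still large. *)
Lemma hump_exists (kappa : R) (N : nat) s : 0 <= s ->
  (forall r s, 0 < r -> (4 * n.+1)%:R * delta <= r -> 0 <= s -> s <= r / 2 ->
   exists p, (forall k, (k < n.+1)%N -> wint U s r (p * 'X^k) = (k == j)%:R) /\
    (sqint `]s, r[ (fun x => (p.[x] * U x)%R) * S r <= kappa%:E)%E) ->
  exists t : R * R * {poly R} * R,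
    let: (r, s', p, M) := t in
    [/\ s + 1 <= r, r <= s', 0 <= M,
       forall k, (k < n.+1)%N -> wint U s r (p * 'X^k) = (k == j)%:R * M &
       (sqint `]s, r[ (fun x => (p.[x] * U x)%R) <= (kappa * 4 ^- N)%:E)%E /\
       (N%:R%:E <= (M ^+ 2)%:E * sqint `]r, s'] w)%E].
Proof.
move=> s0 dens.
(* r > r1 ensures s <= r / 2, s + 1 <= r and the scale condition *)
pose r1 := 2 * s + 1 + `|(4 * n.+1)%:R * delta|.
pose A0 := fine (sqint Rpos w * S r1).
pose B : R := Num.max A0 (N%:R * 4 ^+ N).
have [r r0 rB] := unbounded B.
have mwo x : 0 <= x -> measurable_fun `]x, +oo[ w.
  move=> x0; apply: measurable_funS mw; first exact: measurable_Rpos.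
  exact: sub_Rpos_o.
have wo x : 0 <= x -> (sqint `]x, +oo[ w <= sqint Rpos w)%E.
  by move=> x0; apply: sqint_subset => //; [exact: measurable_Rpos|exact: sub_Rpos_o].
have fw : sqint Rpos w \is a fin_num by rewrite ge0_fin_numE// sqint_ge0.
have fS x : S x \is a fin_num by rewrite ge0_fin_numE ?S_lty ?sqint_ge0.
have rr1 : r1 < r.
  rewrite ltNge; apply/negP => rr1; move: rB; rewrite ltNge => /negP; apply.
  apply: (@le_trans _ _ A0%:E); last by rewrite lee_fin le_max lexx.
  rewrite fineK ?fin_numM//; apply: lee_pmul; rewrite ?sqint_ge0//.
  - by apply: wo; exact: ltW.
  - exact: S_mono.
have nd0 := normr_ge0 ((4 * n.+1)%:R * delta).
have nd1 := ler_norm ((4 * n.+1)%:R * delta).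
have [p [pk pS]] : exists p,
    (forall k, (k < n.+1)%N -> wint U s r (p * 'X^k) = (k == j)%:R) /\
    (sqint `]s, r[ (fun x => (p.[x] * U x)%R) * S r <= kappa%:E)%E.
  by apply: dens => //; rewrite /r1 in rr1; lra.
have S0 : 0 <= fine (S r) by rewrite fine_ge0// sqint_ge0.
set Sr := fine (S r) in S0.
have SrE : S r = Sr%:E by rewrite /Sr fineK.
have BN : N%:R * 4 ^+ N <= B by rewrite le_max lexx orbT.
have Sgt0 : 0 < Sr.
  rewrite lt_neqAle S0 andbT; apply/eqP => Sr0; move: rB.
  rewrite SrE -Sr0 mule0 lte_fin ltNge => /negP; apply.
  by rewrite (le_trans _ BN)// mulr_ge0.
(* by monotone convergence a bounded part of the tail of w is enough *)
have [s' rs' hs'] : exists2 s', r <= s' &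
    ((N%:R * 4 ^+ N)%:E <= sqint `]r, s'] w * Sr%:E)%E.
  apply/not_exists2P => nex; move: rB; rewrite ltNge => /negP; apply.
  rewrite SrE -lee_pdivlMr//.
  have -> : sqint `]r, +oo[ w = sqint Rpos (w \_ `]r, +oo[).
    by rewrite sqint_patch; congr sqint; rewrite setIidr//; apply: sub_Rpos_o; exact: ltW.
  have mwp : measurable_fun Rpos (w \_ `]r, +oo[).
    have mi : measurable (`]r, +oo[%classic : set R) by exact: measurable_itv.
    apply: measurable_funTS; apply/(measurable_restrictT _ mi).
    by apply: mwo; exact: ltW.
  apply: integral_Rpos_lim; first exact: measurable_sqr.
    by move=> x _; rewrite lee_fin sqr_ge0.
  move=> m; rewrite -/(sqint _ _) sqint_patch -EFinM.
  have [mr|rm] := leP m%:R r.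
    have -> : `]0, m%:R] `&` `]r, +oo[ = set0 :> set R.
      rewrite -subset0 => t [] /=; rewrite !in_itv/= andbT => /andP[_ tm] rt.
      by have := lt_le_trans rt (le_trans tm mr); rewrite ltxx.
    rewrite /sqint integral_set0 lee_fin divr_ge0 ?(ltW Sgt0)//.
    by rewrite (le_trans _ BN)// mulr_ge0.
  have [/negP|/negP] := nex m%:R; first by rewrite ltW.
  rewrite -ltNge => /ltW h; rewrite EFinM lee_pdivlMr//.
  apply: le_trans (le_trans _ h) _; last by rewrite lee_fin.
  apply: lee_wpmul2r; first by rewrite lee_fin.
  apply: sqint_subset.
  - by apply: measurableI; exact: measurable_itv.
  - exact: measurable_itv.
  - apply: measurable_funS mw; first exact: measurable_Rpos.
    by apply: sub_Rpos_oc; exact: ltW.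
  - by move=> t [] /=; rewrite !in_itv/= andbT => /andP[_ ->] ->.
pose M := 2 ^- N * Num.sqrt Sr.
have M2 : M ^+ 2 = 4 ^- N * Sr.
  rewrite /M exprMn sqr_sqrtr// -exprVn -exprM mulnC exprM -exprVn; congr (_ ^+ _ * _).
  by field.
have M0 : 0 <= M by rewrite mulr_ge0 ?sqrtr_ge0// invr_ge0 exprn_ge0.
exists (r, s', M *: p, M); split => //.
- by rewrite /r1 in rr1; lra.
- move=> k kn; rewrite -scalerAl wintZ//; first by rewrite pk// mulrC.
- split.
    have -> : sqint `]s, r[ (fun x => ((M *: p).[x] * U x)%R) =
      ((M ^+ 2)%:E * sqint `]s, r[ (fun x => (p.[x] * U x)%R))%E.
      rewrite -sqintZ//.
        by apply: eq_integral => x _; rewrite hornerZ mulrA.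
      apply: measurable_funS (measurable_funM (primitive_measurable (poly_primitive p)) mU).
        exact: measurable_Rpos.
      exact: sub_Rpos_oo.
    rewrite M2 EFinM -muleA [(Sr%:E * _)%E]muleC -SrE mulrC EFinM.
    by apply: lee_wpmul2l => //; rewrite lee_fin invr_ge0 exprn_ge0.
  have i4 : 0 <= 4 ^- N :> R by rewrite invr_ge0 exprn_ge0.
  have := @lee_wpmul2l _ (4 ^- N)%:E _ _ _ hs'.
  rewrite lee_fin => /(_ i4); rewrite -EFinM mulrCA mulVf ?mulr1 ?expf_neq0//.
  by move=> /le_trans; apply; rewrite M2 EFinM -muleA [(Sr%:E * _)%E]muleC.
Qed.

(** Gluing the humps on disjoint successive intervals: between the N-th hump
    and the next one all moments of y U vanish except the j-th one, where the
    nonnegative contributions of the humps add up. *)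
Lemma gliding_hump : exists2 y : R -> R,
  measurable_fun Rpos y /\ (sqint Rpos y < +oo)%E &
  forall N : nat, exists r s' T, [/\ 0 < r, r <= s',
    (forall x, r < x <= s' -> y x = 0 /\ forall k, (k < n.+1)%N ->
      moment k (fun t => y t * U t) x = (k == j)%:R * T) &
    (N%:R%:E <= (T ^+ 2)%:E * sqint `]r, s'] w)%E].
Proof.
have [kappa kappa0 dens0] := one_moment_density mU U_lty U_gt0 U_doubling n.
have dens r s : 0 < r -> (4 * n.+1)%:R * delta <= r -> 0 <= s -> s <= r / 2 ->
   exists p, (forall k, (k < n.+1)%N -> wint U s r (p * 'X^k) = (k == j)%:R) /\
    (sqint `]s, r[ (fun x => (p.[x] * U x)%R) * S r <= kappa%:E)%E.
  by move=> *; exact: dens0.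
pose spec (Ns : nat * R) (t : R * R * {poly R} * R) := 0 <= Ns.2 ->
    let: (r, s', p, M) := t in
    [/\ Ns.2 + 1 <= r, r <= s', 0 <= M,
       forall k, (k < n.+1)%N -> wint U Ns.2 r (p * 'X^k) = (k == j)%:R * M &
       (sqint `]Ns.2, r[ (fun x => (p.[x] * U x)%R) <= (kappa * 4 ^- Ns.1)%:E)%E /\
       (Ns.1%:R%:E <= (M ^+ 2)%:E * sqint `]r, s'] w)%E].
have ex_spec Ns : exists t, spec Ns t.
  have [s0|s0] := leP 0 Ns.2; last by exists (0, 0, 0, 0) => h; lra.
  have [t ht] := hump_exists Ns.1 s0 dens.
  by exists t => _.
have [F HF] := choice ex_spec.
(* the N-th hump lives on ]st N, rr N[ and is followed by the gap
   ]rr N, st (N+1)], on which y vanishes *)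
pose st := fix st N := if N is N'.+1 then (F (N', st N')).1.1.2 else 0 : R.
pose rr N := (F (N, st N)).1.1.1.
pose pp N := (F (N, st N)).1.2.
pose MM N := (F (N, st N)).2.
have HS N : 0 <= st N -> [/\ st N + 1 <= rr N, rr N <= st N.+1, 0 <= MM N,
       forall k, (k < n.+1)%N -> wint U (st N) (rr N) (pp N * 'X^k) = (k == j)%:R * MM N &
       (sqint `]st N, rr N[ (fun x => ((pp N).[x] * U x)%R) <= (kappa * 4 ^- N)%:E)%E /\
       (N%:R%:E <= (MM N ^+ 2)%:E * sqint `]rr N, st N.+1] w)%E].
  move=> s0; have := HF (N, st N) s0; rewrite /rr /pp /MM /=.
  by case: (F (N, st N)) => [[[]]].
have st0 N : 0 <= st N.
  by elim: N => [//|N IH]; have [h1 h2 _ _ _] := HS N IH; lra.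
have {}HS N := HS N (st0 N).
have sr N : st N + 1 <= rr N by have [] := HS N.
have rs N : rr N <= st N.+1 by have [] := HS N.
have M0 N : 0 <= MM N by have [] := HS N.
have sS N : st N <= st N.+1 by have := sr N; have := rs N; lra.
have smono N N' : (N <= N')%N -> st N <= st N'.
  by move=> NN; exact: (homo_leq (fun x => lexx x) (fun y x z => @le_trans _ _ y x z)).
have sN N : N%:R <= st N.
  by elim: N => [//|N IH]; rewrite -natr1; have := sr N; have := rs N; lra.
have loc x : exists N, 0 < x -> st N < x <= st N.+1.
  have [x0|x0] := ltP 0 x; last by exists 0%N; rewrite ltNge x0.
  pose P N := x <= st N.
  have exP : exists N, P N.
    exists (Num.bound x); rewrite /P (le_trans _ (sN _))// ltW// archi_boundP//.
    exact: ltW.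
  case: (ex_minnP exP) => -[|N] PN Nmin; first by move: PN; rewrite /P /=; lra.
  exists N => _; rewrite [x <= _]PN andbT ltNge; apply/negP => PN'.
  by have := Nmin N PN'; rewrite ltnn.
have [idx Hidx] := choice loc.
pose piece N x : R := if x < rr N then (pp N).[x] * U x else 0.
pose y x := piece (idx x) x.
have yE N x : st N < x -> x <= st N.+1 -> y x = piece N x.
  move=> Nx xN; have x0 : 0 < x by rewrite (le_lt_trans (st0 N)).
  rewrite /y; congr piece; have /andP[h1 h2] := Hidx x x0.
  apply/eqP; rewrite eqn_leq; apply/andP; split; rewrite leqNgt; apply/negP => NN.
    by have := lt_le_trans h1 (le_trans xN (smono _ _ NN)); rewrite ltxx.
  by have := lt_le_trans Nx (le_trans h2 (smono _ _ NN)); rewrite ltxx.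
have mpU p : measurable_fun Rpos (fun x => p.[x] * U x).
  exact: measurable_funM (primitive_measurable (poly_primitive p)) mU.
have mir N : measurable (`]st N, rr N[%classic : set R) by exact: measurable_itv.
pose hump N := (fun x => (pp N).[x] * U x) \_ `]st N, rr N[%classic.
have pieceE N x : st N < x -> piece N x = hump N x.
  move=> Nx; rewrite /hump patchE /piece; case: ifPn => xr.
    by rewrite mem_set//= in_itv/= Nx xr.
  by case: ifPn => // /set_mem/=; rewrite in_itv/= (negbTE xr) andbF.
have mhump N : measurable_fun setT (hump N).
  apply/(measurable_restrictT _ (mir N)).
  by apply: measurable_funS (mpU _); [exact: measurable_Rpos|exact: sub_Rpos_oo].
have RposU : @Rpos R = \bigcup_N `]st N, st N.+1]%classic.
  apply/seteqP; split => x.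
    by rewrite RposE => x0; exists (idx x) => //=; rewrite in_itv/=; exact: Hidx.
  by move=> [N _] /=; rewrite RposE in_itv/= => /andP[+ _]; exact: le_lt_trans.
have my : measurable_fun Rpos y.
  rewrite RposU; apply/measurable_fun_bigcup; first by move=> N; exact: measurable_itv.
  move=> N; apply: (eq_measurable_fun (hump N)); last exact: measurable_funTS.
  by move=> x /[1!inE]/=; rewrite in_itv/= => /andP[h1 h2]; rewrite (yE N)// pieceE.
have mys a b : 0 <= a -> measurable_fun `]a, b] y.
  move=> a0; apply: measurable_funS my; first exact: measurable_Rpos.
  exact: sub_Rpos_oc.
have ysq N : (sqint `]0%R, st N] y <= (2 * kappa * (1 - 2^-1 ^+ N))%:E)%E.
  elim: N => [|N IH].
    rewrite set_itv_ge ?bnd_simp ?ltxx// /sqint integral_set0 lee_fin.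
    by rewrite subrr mulr0.
  rewrite (@sqint_split _ _ (st N))//.
  have hN : (sqint `]st N, st N.+1] y <= (kappa * 4 ^- N)%:E)%E.
    have -> : sqint `]st N, st N.+1] y = sqint `]st N, st N.+1] (hump N).
      apply: eq_integral => x /[1!inE]/=; rewrite in_itv/= => /andP[h1 h2].
      by rewrite (yE N)// pieceE.
    have [_ _ _ _ [h _]] := HS N.
    rewrite sqint_patch (_ : _ `&` _ = `]st N, rr N[%classic)//.
    apply/setIidPr => x /=; rewrite !in_itv/= => /andP[-> xr]/=.
    exact: le_trans (ltW xr) (rs N).
  apply: le_trans (leeD IH hN) _; rewrite -EFinD lee_fin.
  have i2 : 0 <= 2^-1 ^+ N :> R by rewrite exprn_ge0.
  have i4 : 4 ^- N <= 2^-1 ^+ N :> R.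
    rewrite -exprVn (_ : 4^-1 = 2^-1 * 2^-1 :> R); last by field.
    by rewrite exprMn ler_piMr// exprn_ile1//; lra.
  have := ler_wpM2l (ltW kappa0) i4; rewrite [2^-1 ^+ N.+1]exprS.
  set e := 2^-1 ^+ N in i2 i4 *; set d := 4 ^- N; lra.
have yoo : (sqint Rpos y < +oo)%E.
  apply: (@le_lt_trans _ _ (2 * kappa)%:E); last exact: ltry.
  apply: integral_Rpos_lim; first exact: measurable_sqr.
    by move=> x _; rewrite lee_fin sqr_ge0.
  move=> N; apply: (@le_trans _ _ (sqint `]0%R, st N] y)).
    apply: sqint_subset => //; first exact: mys.
    by move=> t /=; rewrite !in_itv/= => /andP[-> tN]; rewrite (le_trans tN).
  apply: (le_trans (ysq N)); rewrite lee_fin; apply: ler_piMr.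
    by rewrite mulr_ge0// ltW.
  by rewrite lerBlDr lerDl exprn_ge0.
exists y => //.
have ig := origin_integrable_mul my mU yoo U_lty.
pose T N := \sum_(i < N) MM i.
have incr N k x : (k < n.+1)%N -> rr N <= x -> x <= st N.+1 ->
    moment k (fun t => y t * U t) x =
    moment k (fun t => y t * U t) (st N) + (k == j)%:R * MM N.
  move=> kn rx xs; have [_ _ _ /(_ k kn) <- _] := HS N.
  have sx : st N <= x by have := sr N; lra.
  have [lg igk] := origin_integrable_expM k ig.
  have [x0|x0] := leP x 0; first by have := st0 N; have := sr N; lra.
  have := @Rintegral_itvB _ _ (BRight 0) (BRight x) (st N) (igk x x0).
  rewrite !bnd_simp => /(_ (st0 N) sx) E.
  rewrite /moment -[LHS](subrK (\int[mu]_(t in `]0, st N]) (t ^+ k * (y t * U t)))) E.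
  rewrite addrC; congr (_ + _).
  rewrite /wint Rintegral_mkcond [RHS]Rintegral_mkcond.
  congr Rintegral; apply/funext => t; rewrite !patchE.
  case: ifPn => [/set_mem/=|tn].
    rewrite in_itv/= => /andP[t1 t2]; rewrite (yE N)// ?(le_trans t2)// /piece.
    case: ifPn => tr; last first.
      by rewrite mul0r mulr0; case: ifPn => // /set_mem/=; rewrite in_itv/= (negbTE tr) andbF.
    by rewrite mem_set/= ?in_itv/= ?t1// hornerM hornerXn; ring.
  case: ifPn => // /set_mem/=; rewrite in_itv/= => /andP[t1 t2].
  by move: tn; rewrite mem_set//= in_itv/= t1 (le_trans (ltW t2)).
have momE N k : (k < n.+1)%N ->
    moment k (fun t => y t * U t) (st N) = (k == j)%:R * T N.
  move=> kn; elim: N => [|N IH].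
    rewrite /T big_ord0 mulr0 /moment.
    by rewrite set_itv_ge ?bnd_simp ?ltxx// Rintegral_set0.
  by rewrite (incr N k)// IH /T big_ord_recr/= mulrDr.
move=> N; exists (rr N), (st N.+1), (T N.+1); split => //.
- by have := sr N; have := st0 N; lra.
- move=> x /andP[rx xs]; split.
    have sx : st N < x by have := sr N; lra.
    by rewrite (yE N)// /piece ltNge (ltW rx).
  by move=> k kn; rewrite (incr N k) ?(ltW rx)// momE// /T big_ord_recr/= mulrDr.
- have [_ _ _ _ [_ h]] := HS N; apply: le_trans h _.
  rewrite lee_wpmul2r ?sqint_ge0// lee_fin lerXn2r ?nnegrE//.
    by apply: sumr_ge0.
  by rewrite /T big_ord_recr/= lerDr sumr_ge0.
Qed.

End weight.
End hump.

(** * Multipliers of square-integrable functions *)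

Section essential_bound.
Context {R : realType}.
Local Notation mu := (@lebesgue_measure R).
Implicit Types (f g h : R -> R).

Lemma nonnegligible_bounded_part (E : set R) : measurable E -> E `<=` Rpos ->
  ~ mu.-negligible E -> exists F : set R,
  [/\ measurable F, F `<=` E, (0 < mu F)%E & (mu F < +oo)%E].
Proof.
move=> mE ER nE.
have mEk k : measurable (E `&` `]0, k%:R]) by apply: measurableI.
have [H|] := pselect (forall k : nat, mu (E `&` `]0, k%:R]) = 0%E).
  exfalso; apply: nE.
  have -> : E = \bigcup_k (E `&` `]0, k%:R]).
    rewrite -setI_bigcupr; apply/esym/setIidPl => x /ER; rewrite RposE => x0.
    by exists (Num.bound x) => //=; rewrite in_itv/= x0 ltW// archi_boundP// ltW.
  apply: negligible_bigcup => k.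
  by apply/negligibleP; [exact: mEk|exact: H].
move=> /existsNP[k nk]; exists (E `&` `]0, k%:R]); split => //.
- by rewrite lt_neqAle measure_ge0 andbT eq_sym; apply/eqP.
- apply: (@le_lt_trans _ _ (mu (`]0, k%:R]%classic : set R))).
    by apply: le_measure; rewrite ?inE//; exact: mEk.
  by rewrite lebesgue_measure_itv/=; case: ifP => _; rewrite ?ltry// -EFinB ltry.
Qed.

(** Otherwise a square-integrable function whose square gives mass at least
    2^-(n+1) to a part of the set where |h| > 2^n, for every n, is sent out of
    L_2. *)
Lemma L2_multiplier_bounded h : measurable_fun Rpos h ->
  (forall y, measurable_fun Rpos y -> (sqint Rpos y < +oo)%E ->
    (sqint Rpos (fun x => (h x * y x)%R) < +oo)%E) ->
  exists M : R, \forall x \ae mu, Rpos x -> `|h x| <= M.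
Proof.
move=> mh hL2; apply: contrapT => nM.
pose E n : set R := Rpos `&` [set x | 2 ^+ n < `|h x|].
have mE n : measurable (E n).
  rewrite (_ : E n = Rpos `&` (fun x => `|h x|) @^-1` `]2 ^+ n, +oo[%classic).
    have mah : measurable_fun Rpos (fun x => `|h x|) by exact: measurableT_comp.
    by apply: mah => //; exact: measurable_Rpos.
  by apply/seteqP; split => x [x0 /=]; rewrite in_itv/= ?andbT.
have nE n : ~ mu.-negligible (E n).
  move=> En; apply: nM; exists (2 ^+ n).
  apply: negligibleS En => x /= /not_implyP[x0 /negP]; rewrite -ltNge => hx.
  by split.
have [F HF] := choice (fun n => nonnegligible_bounded_part (mE n) (@subIsetl _ _ _) (@nE n)).
have mF n : measurable (F n) by have [] := HF n.
have FE n : F n `<=` E n by have [] := HF n.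
pose m n := fine (mu (F n)).
have muE n : mu (F n) = (m n)%:E.
  by have [_ _ _ h1] := HF n; rewrite /m fineK// ge0_fin_numE.
have m0 n : 0 < m n by have [_ _ h1 _] := HF n; rewrite -lte_fin -muE.
(* c n times the indicator of F n has integral 2^-(n+1) *)
pose c n := 1 / (2 ^ n.+1)%:R / m n.
have c0 n : 0 <= c n by rewrite !divr_ge0// ltW.
pose fn n x : \bar R := ((c n)%:E * (\1_(F n) x)%:E)%E.
have fn0 n x : (0 <= fn n x)%E by rewrite mule_ge0// lee_fin.
have mfn n : measurable_fun Rpos (fn n).
  apply: measurable_funeM; apply/measurable_EFinP.
  by apply: measurable_funTS; exact: measurable_indic.
pose z x : \bar R := (\sum_(0 <= n <oo) fn n x)%E.
have z0 x : (0 <= z x)%E by apply: nneseries_ge0 => n _ _.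
have mz : measurable_fun Rpos z by apply: ge0_emeasurable_sum.
have zoo : (\int[mu]_(x in Rpos) z x <= 1%:E)%E.
  rewrite integral_nneseries//; last exact: measurable_Rpos.
  have := @epsilon_trick0 R 1 xpredT ler01; apply: le_trans.
  apply: lee_nneseries => [n _ _|n _]; first exact: integral_ge0.
  have mi : measurable_fun Rpos (fun x => (\1_(F n) x)%:E : \bar R).
    by apply/measurable_EFinP; apply: measurable_funTS; exact: measurable_indic.
  have i0 x : Rpos x -> (0 <= (\1_(F n) x)%:E :> \bar R)%E by rewrite lee_fin.
  rewrite (@ge0_integralZl_EFin _ _ _ mu Rpos measurable_Rpos _ i0 mi)//.
  rewrite (@integral_indic _ _ _ mu _ measurable_Rpos _ (mF n)).
  rewrite (_ : _ `&` _ = F n); last by apply/setIidPl => x /FE[].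
  by rewrite [X in (_ * X)%E]muE -EFinM lee_fin /c divfK// gt_eqF.
have iz : mu.-integrable Rpos z.
  apply/integrableP; split => //.
  under eq_integral do rewrite gee0_abs//.
  by apply: le_lt_trans zoo _; rewrite ltry.
have zfin := @integrable_ae _ _ _ mu Rpos measurable_Rpos _ iz.
pose y x := Num.sqrt (fine (z x)).
have fz0 x : 0 <= fine (z x) by rewrite fine_ge0.
have my : measurable_fun Rpos y.
  apply: measurableT_comp; first exact: (continuous_measurable_fun (@sqrt_continuous R)).
  by apply: (measurable_comp measurableT) => //; exact: fine_measurable.
have y2 x : y x ^+ 2 = fine (z x) by rewrite sqr_sqrtr.
have yoo : (sqint Rpos y < +oo)%E.
  apply: (@le_lt_trans _ _ (\int[mu]_(x in Rpos) z x)%E); last first.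
    by apply: le_lt_trans zoo _; rewrite ltry.
  apply: ge0_le_integral => //.
  - exact: measurable_Rpos.
  - by move=> x _; rewrite lee_fin sqr_ge0.
  - exact: measurable_sqr.
  - move=> x _; rewrite y2; have [zf|] := boolP (z x \is a fin_num).
      by rewrite fineK.
    by rewrite ge0_fin_numE// -leNgt leye_eq => /eqP ->; exact: leey.
have := hL2 y my yoo; set I := sqint _ _ => Ioo.
have big n : ((2 ^+ n / 2)%:E <= I)%E.
  apply: (@le_trans _ _ (\int[mu]_(x in F n) ((2 ^+ n) ^+ 2 * c n)%:E)%E).
    rewrite (@integral_cst _ _ _ mu _ (mF n)).
    apply: (@le_trans _ _ ((2 ^+ n ^+ 2 * c n)%:E * (m n)%:E)%E); last by rewrite -muE.
    rewrite -EFinM lee_fin /c.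
    rewrite le_eqVlt; apply/orP; left; apply/eqP.
    have e0 : 2 ^+ n != 0 :> R by rewrite expf_neq0.
    have n0 : m n != 0 by rewrite gt_eqF.
    by rewrite natrX [2 ^+ n.+1]exprS; field; rewrite e0 n0.
  have mhy : measurable_fun Rpos (fun x => h x * y x) by exact: measurable_funM.
  have FR : F n `<=` Rpos by move=> x /FE[].
  have mhF : measurable_fun (F n) (fun x => ((h x * y x) ^+ 2)%:E).
    apply: measurable_sqr; apply: measurable_funS mhy => //; exact: measurable_Rpos.
  apply: (@le_trans _ _ (sqint (F n) (fun x => h x * y x))); last first.
    by apply: sqint_subset => //; exact: measurable_Rpos.
  apply: ae_ge0_le_integral => //.
  - exact: mF.
  - by move=> x _; rewrite lee_fin mulr_ge0 ?sqr_ge0.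
  - by move=> x _; rewrite lee_fin sqr_ge0.
  apply: aeS zfin => x zf Fx; rewrite lee_fin exprMn y2.
  have [x0 hx] := FE n x Fx; rewrite /= in hx.
  rewrite ler_pM ?sqr_ge0//.
    rewrite -[leRHS]real_normK ?num_real// lerXn2r ?nnegrE ?exprn_ge0//.
    exact: ltW.
  rewrite -lee_fin fineK ?zf//.
  apply: (@le_trans _ _ (\sum_(0 <= i < n.+1) fn i x)%E); last exact: nneseries_lim_ge.
  rewrite big_nat_recr//= [fn n x](_ : _ = (c n)%:E).
    by rewrite leeDr// sume_ge0.
  by rewrite /fn indicE mem_set// mule1.
have I0 : I \is a fin_num by rewrite ge0_fin_numE// sqint_ge0.
have [k hk] : exists k : nat, fine I * 2 < k%:R.
  by exists (Num.bound (fine I * 2)); apply: archi_boundP; rewrite mulr_ge0// fine_ge0// sqint_ge0.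
have := big k; rewrite -(fineK I0) lee_fin ler_pdivrMr// leNgt => /negP; apply.
by rewrite (lt_le_trans hk)// -natrX ler_nat ltnW// ltn_expl.
Qed.

End essential_bound.

(** * Weights and their inverses *)

Section weights.
Context {R : realType}.
Local Notation mu := (@lebesgue_measure R).
Implicit Types (f g h w u : R -> R) (D : set R) (x y r : R) (n m i j k : nat).

Lemma measurable_inve : measurable_fun setT (fun x : R => (x%:E^-1)%E).
Proof.
have -> : [set: R] = [set 0] `|` ~` [set 0] by rewrite setUv.
have m0 : measurable ([set 0] : set R) by exact: measurable_set1.
apply/measurable_funU; [exact: m0|exact: measurableC|split].
  exact: measurable_fun_set1.
apply: (eq_measurable_fun (fun x => (x^-1)%:E)).
  by move=> x /[1!inE] /eqP x0; rewrite inver (negbTE x0).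
apply/measurable_EFinP; apply: open_continuous_measurable_fun.
  by rewrite openC; exact: closed_eq.
by move=> x /[1!inE] /eqP x0; exact: inv_continuous.
Qed.

Lemma measurable_inv : measurable_fun setT (fun x : R => x^-1).
Proof.
under eq_fun do rewrite -fine_invr.
apply: (measurable_comp measurableT) => //; last exact: measurable_inve.
Qed.

Lemma wpow_inv1E w x : w x != 0 -> wpow_inv w 1 x = ((w x)^-1)%:E.
Proof. by move=> w0; rewrite /wpow_inv expr1 inver (negbTE w0). Qed.

Lemma wpow_inv2E w x : (wpow_inv w 2 x = `|wpow_inv w 1 x| `^ 2)%E.
Proof.
rewrite /wpow_inv expr1 !inver sqrf_eq0; case: ifPn => // w0.
  by rewrite gee0_abs ?leey// poweRyr ?pnatr_eq0.
rewrite /= -[RHS]/((`|(w x)^-1| `^ 2)%:E) powR_mulrn//.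
by rewrite real_normK ?num_real// exprVn.
Qed.

(** The facts about a weight w that the argument uses, freed from the
    infinite values of 1/w. *)
Definition regular_weight w := [/\ measurable_fun Rpos w,
  (\forall x \ae mu, Rpos x -> w x != 0),
  measurable_fun Rpos (fun x => (w x)^-1) &
  forall r, 0 < r -> (sqint `]0%R, r[ (fun x => (w x)^-1%R) < +oo)%E].

Lemma measurable_wpow_inv1 w : measurable_fun Rpos w ->
  measurable_fun Rpos (wpow_inv w 1).
Proof.
move=> mw; have -> : wpow_inv w 1 = (fun x : R => (x%:E^-1)%E) \o w.
  by apply/funext => x; rewrite /wpow_inv expr1.
by apply: measurableT_comp => //; exact: measurable_inve.
Qed.

Lemma measurable_wpow_inv2 w : measurable_fun Rpos w ->
  measurable_fun Rpos (wpow_inv w 2).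
Proof.
move=> mw; rewrite (_ : wpow_inv w 2 = (fun x : \bar R => (x `^ 2)%E) \o (abse \o wpow_inv w 1)).
  apply: measurableT_comp; first exact: measurable_poweR.
  by apply: measurableT_comp => //; exact: measurable_wpow_inv1.
by apply/funext => x; rewrite wpow_inv2E.
Qed.

Lemma measurable_invw w : measurable_fun Rpos w ->
  measurable_fun Rpos (fun x => (w x)^-1).
Proof. by move=> mw; apply: measurableT_comp => //; exact: measurable_inv. Qed.

Lemma sqint_wpow w D : measurable_fun Rpos w ->
  (\forall x \ae mu, Rpos x -> w x != 0) -> measurable D -> D `<=` Rpos ->
  (\int[mu]_(x in D) wpow_inv w 2 x)%E = sqint D (fun x => (w x)^-1).
Proof.
move=> mw w0 mD DR; apply: ae_eq_integral => //.
- by apply: measurable_funS (measurable_wpow_inv2 mw) => //; exact: measurable_Rpos.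
- apply: measurable_sqr; apply: measurable_funS (measurable_invw mw) => //.
  exact: measurable_Rpos.
- apply: aeS w0 => x wx Dx; have {}wx := wx (DR _ Dx).
  rewrite wpow_inv2E wpow_inv1E//= -[LHS]/((`|(w x)^-1| `^ 2)%:E) powR_mulrn//.
  by rewrite real_normK ?num_real.
Qed.

(** The power of 1/w takes the value +oo where w vanishes, so its integrability
    forces w to be nonzero almost everywhere. *)
Lemma regular_weightP w : measurable_fun Rpos w ->
  (forall r, 0 < r -> (\int[mu]_(x in `]0%R, r[) wpow_inv w 2 x < +oo)%E) ->
  regular_weight w.
Proof.
move=> mw woo.
have mw2 := measurable_wpow_inv2 mw.
have mwr r : measurable_fun `]0, r[ (wpow_inv w 2).
  by apply: measurable_funS mw2; [exact: measurable_Rpos|exact: sub_Rpos_oo].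
have w2ge0 x : (0 <= wpow_inv w 2 x)%E.
  by rewrite wpow_inv2E poweR_ge0.
have aew : \forall x \ae mu, Rpos x -> w x != 0.
  have : \forall x \ae mu, forall k : nat, `]0, k.+1%:R[%classic x -> w x != 0.
    apply/ae_foralln => k.
    have ik : mu.-integrable `]0, k.+1%:R[ (wpow_inv w 2).
      apply/integrableP; split; first exact: mwr.
      under eq_integral do rewrite gee0_abs//.
      by apply: woo; rewrite ltr0n.
    have mi : measurable (`]0, k.+1%:R[%classic : set R) by exact: measurable_itv.
    apply: aeS (@integrable_ae _ _ _ mu _ mi _ ik) => x H /H.
    by rewrite /wpow_inv inver sqrf_eq0; case: ifPn.
  apply: aeS => x H; rewrite RposE => x0; apply: (H (Num.bound x)).
  rewrite /= in_itv/= x0 (@lt_le_trans _ _ (Num.bound x)%:R)//.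
    by rewrite archi_boundP// ltW.
  by rewrite ler_nat.
split => //; first exact: measurable_invw.
move=> r r0; rewrite -sqint_wpow//; [exact: woo|exact: sub_Rpos_oo].
Qed.

Lemma LnormOn2_sqrE D (F : R -> \bar R) :
  (LnormOn 2%:E D F `^ 2)%E = (\int[mu]_(x in D) `|F x| `^ 2)%E.
Proof.
rewrite /LnormOn powR_Lnorm ?pnatr_eq0// [RHS]integral_mkcond.
apply: eq_integral => x _; rewrite !patchE; case: ifP => // _.
by rewrite abse0 poweR0r.
Qed.

Lemma LnormOn2_wpow w D f : regular_weight w -> measurable D -> D `<=` Rpos ->
  measurable_fun D f ->
  LnormOn 2%:E D (fun x => (f x)%:E * wpow_inv w 1 x)%E =
  (sqint D (fun x => f x * (w x)^-1)%R `^ 2^-1)%E.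
Proof.
move=> [mw w0 mwi woo] mD DR mf.
rewrite /LnormOn unlock/=; congr (_ `^ _)%E.
rewrite /sqint [RHS]integral_mkcond.
have mfw : measurable_fun D (fun x => f x * (w x)^-1).
  by apply: measurable_funM => //; apply: measurable_funS mwi => //; exact: measurable_Rpos.
have me : measurable_fun D (fun x => (f x)%:E * wpow_inv w 1 x)%E.
  apply: emeasurable_funM; first exact/measurable_EFinP.
  by apply: measurable_funS (measurable_wpow_inv1 mw) => //; exact: measurable_Rpos.
have mp : measurable_fun setT (fun x : \bar R => (x `^ 2)%E) by exact: measurable_poweR.
have mr := proj1 (measurable_restrictT _ mD) me.
apply: ae_eq_integral => //.
- apply: (measurableT_comp mp); exact: measurableT_comp.
- by apply/(measurable_restrictT _ mD); exact: measurable_sqr.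
- apply: aeS w0 => x w0 _; rewrite !patchE; case: ifPn => [/set_mem Dx|_].
    rewrite wpow_inv1E ?w0//; last exact: DR.
    rewrite -EFinM /= -[LHS]/((`|f x / w x| `^ 2)%:E) powR_mulrn//.
    by rewrite real_normK ?num_real.
  by rewrite abse0 poweR0r.
Qed.

End weights.

(** * Weighted Sobolev spaces and their multipliers *)

Section spaces.
Context {R : realType}.
Local Notation mu := (@lebesgue_measure R).
Implicit Types (f g h w u : R -> R) (D : set R) (x y r : R) (n m i j k : nat).
Implicit Types (p : {poly R}) (F : nat -> R -> R).

Lemma chain_bounded n F : (0 < n)%N -> chain n F -> origin_integrable (F n) ->
  exists M : R, forall x, 0 < x <= 1 -> `|F 0%N x| <= M.
Proof.
move=> n0 [lF pF] iF.
have H i : (i < n)%N -> origin_integrable (F (n - i)%N).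
  elim: i => [|i IH] lin; first by rewrite subn0.
  have pri : primitive (F (n - i.+1)%N) (F (n - i)%N).
    by rewrite -(subnSK (ltnW lin)); apply: pF; lia.
  by have [] := primitive_origin_integrable pri (IH (ltnW lin)).
have i1 : origin_integrable (F 1%N).
  have n1 : (n.-1 < n)%N by lia.
  by have := H n.-1 n1; rewrite (_ : n - n.-1 = 1)%N//; lia.
by have [] := primitive_origin_integrable (pF 0%N n0) i1.
Qed.

Lemma origin_integrable_ae f f' : measurable_fun Rpos f' -> f = f' %[ae mu in Rpos] ->
  origin_integrable f -> origin_integrable f'.
Proof.
move=> mf' ff' [lf fi]; split; first exact: locint_ae ff' lf.
have mf : measurable_fun Rpos f by case: lf.
move=> y y0; have /integrableP[_ foo] := fi y y0.
have sub := @sub_Rpos_oc R 0 y (lexx _).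
have ms g : measurable_fun Rpos g -> measurable_fun (`]0, y]%classic : set R) g.
  by move=> mg; apply: measurable_funS mg; [exact: measurable_Rpos|].
have mi : measurable (`]0, y]%classic : set R) by exact: measurable_itv.
apply/integrableP; split; first by apply/measurable_EFinP; exact: ms.
apply: le_lt_trans foo; rewrite le_eqVlt; apply/orP; left; apply/eqP.
apply: ae_eq_integral => //.
- by apply/measurable_EFinP; apply: measurableT_comp => //; exact: ms.
- by apply/measurable_EFinP; apply: measurableT_comp => //; exact: ms.
- by apply: aeS ff' => x ffx /sub /ffx /= ->.
Qed.

Lemma origin_integrable_weight w g : regular_weight w -> measurable_fun Rpos g ->
  (sqint Rpos (fun x => (g x * w x)%R) < +oo)%E -> origin_integrable g.
Proof.
move=> [mw w0 mwi woo] mg goo.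
have mgw : measurable_fun Rpos (fun x => g x * w x) by exact: measurable_funM.
apply: origin_integrable_ae (origin_integrable_mul mgw mwi goo woo) => //.
by apply: aeS w0 => x wx x0; rewrite mulfK// wx.
Qed.

(** The L_2(0, 1) part of the norm is automatically finite, since the derivative
    is integrable up to the origin. *)
Lemma sobolevP m w f : (0 < m)%N -> regular_weight w ->
  sobolev m w f <-> exists2 df, weak_derivative m f df &
    (sqint Rpos (fun x => (df x * w x)%R) < +oo)%E.
Proof.
move=> m0 rw; split => -[df wf].
  rewrite /sobolev_norm => h; exists df => //.
  rewrite -LnormOn2_ltyP; apply: le_lt_trans h.
  by rewrite leeDr// Lnorm_ge0.
move=> dfoo; exists df => //; rewrite /sobolev_norm.
rewrite lte_add_pinfty ?LnormOn2_ltyP//.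
have [lf ldf _] := wf.
have idf : origin_integrable df by apply: origin_integrable_weight rw _ dfoo; case: ldf.
have [F [cF Fm fF]] := weak_derivative_chain wf.
have [|M HM] := chain_bounded m0 cF; first by rewrite Fm.
have mi : measurable (`]0, 1[%classic : set R) by exact: measurable_itv.
have sub := @sub_Rpos_oo R 0 1 (lexx _).
have ms g : measurable_fun Rpos g -> measurable_fun (`]0, 1[%classic : set R) g.
  by move=> mg; apply: measurable_funS mg; [exact: measurable_Rpos|].
have mf : measurable_fun Rpos f by case: lf.
have mF : measurable_fun Rpos (F 0%N).
  by case: (chain_locint cF (leq0n m)).
rewrite (@sqint_ae _ _ f (F 0%N))//; [|exact: ms|exact: ms|]; last first.
  by apply: aeS fF => x fx /sub /fx.
apply: (@le_lt_trans _ _ (\int[mu]_(x in `]0%R, 1%R[) (M ^+ 2)%:E)%E).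
  apply: ge0_le_integral => //.
  - by move=> x _; rewrite lee_fin sqr_ge0.
  - by apply: measurable_sqr; exact: ms.
  - move=> x; rewrite /= in_itv/= => /andP[x0 x1]; rewrite lee_fin.
    have h : `|F 0%N x| <= M by apply: HM; rewrite x0 ltW.
    rewrite -[F 0%N x ^+ 2]real_normK ?num_real// lerXn2r ?nnegrE//.
    exact: le_trans h.
rewrite (@integral_cst _ _ _ mu _ mi).
suff : (mu (`]0%R, 1%R[%classic) < +oo)%E.
  by move=> h; rewrite lte_mul_pinfty// lee_fin sqr_ge0.
by rewrite lebesgue_measure_itv/=; case: ifP => _; rewrite ?ltry// -EFinB ltry.
Qed.

Lemma sqint_weightK w h : regular_weight w -> measurable_fun Rpos h ->
  (sqint Rpos (fun x => (h x * (w x)^-1 * w x)%R) <= sqint Rpos h)%E.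
Proof.
move=> [mw w0 mwi _] mh; apply: sqint_le => //; first exact: measurable_Rpos.
  by do 2 apply: measurable_funM => //.
move=> x _; have [->|wx] := eqVneq (w x) 0; first by rewrite mulr0 normr0.
by rewrite divfK.
Qed.

Lemma origin_integrable_div u h : regular_weight u -> measurable_fun Rpos h ->
  (sqint Rpos h < +oo)%E -> origin_integrable (fun x => h x * (u x)^-1).
Proof. by move=> [mu_ _ mui uoo] mh hoo; exact: origin_integrable_mul. Qed.

(** The weighted space consists of the (n+1)-fold integrals of the functions
    h / u with h square-integrable, up to polynomials of degree at most n. *)
Lemma taylor_sobolev n u p h : regular_weight u -> measurable_fun Rpos h ->
  (sqint Rpos h < +oo)%E ->
  sobolev n.+1 u (taylor_chain n p (fun x => h x * (u x)^-1) 0).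
Proof.
move=> ru mh hoo; apply/sobolevP => //.
have ih := origin_integrable_div ru mh hoo.
exists (fun x => h x * (u x)^-1).
  by have := chain_weak_derivative (taylor_chainP n p ih); rewrite taylor_chain_top.
exact: le_lt_trans (sqint_weightK ru mh) hoo.
Qed.

Lemma sobolev_taylor n u f : regular_weight u -> sobolev n.+1 u f ->
  exists p h, [/\ measurable_fun Rpos h, (sqint Rpos h < +oo)%E &
    f = taylor_chain n p (fun x => h x * (u x)^-1) 0 %[ae mu in Rpos]].
Proof.
move=> ru /(sobolevP _ (ltn0Sn n) ru)[df wf dfoo].
have [lf ldf _] := wf; have mdf : measurable_fun Rpos df by case: ldf.
have [mu_ u0 mui uoo] := ru.
have mh : measurable_fun Rpos (fun x => df x * u x) by exact: measurable_funM.
have ih := origin_integrable_div ru mh dfoo.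
have dfE : df = (fun x => df x * u x * (u x)^-1) %[ae mu in Rpos].
  by apply: aeS u0 => x ux x0; rewrite mulfK// ux.
have wf' : weak_derivative n.+1 f (fun x => df x * u x * (u x)^-1).
  apply: weak_derivative_ae wf => //; first by case: ih.
  exact: aeW.
have [p fp] := taylor_repr ih wf'.
by exists p, (fun x => df x * u x); split.
Qed.

Section multiplier.
Variables (n m : nat) (u v phi : R -> R) (G : nat -> R -> R).
Hypotheses (m_gt0 : (0 < m)%N) (le_mn : (m <= n.+1)%N).
Hypotheses (ru : regular_weight u) (rv : regular_weight v).
Hypothesis wG : forall k, (k < n.+1)%N ->
  weak_derivative m (fun x => phi x * x ^+ k) (G k).
Hypothesis Goo : forall k, (k < n.+1)%N ->
  (sqint Rpos (fun x => (G k x * v x)%R) < +oo)%E.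

Let mv : measurable_fun Rpos v. Proof. by case: rv. Qed.
Let mui : measurable_fun Rpos (fun x => (u x)^-1). Proof. by case: ru. Qed.
Let mG k : (k < n.+1)%N -> measurable_fun Rpos (G k).
Proof. by move=> /wG[_ []]. Qed.
Let mphi : measurable_fun Rpos phi.
Proof.
have [[+ _ _] _ _] := wG (ltn0Sn n); congr measurable_fun.
by apply/funext => x; rewrite mulr1.
Qed.

Definition multiplier_derivative p h x : R :=
  \sum_(k < n.+1) taylor_coef n p (fun x => h x * (u x)^-1) k x * G k x +
  (m == n.+1)%:R * (phi x * (h x * (u x)^-1)).

Lemma multiplier_derivativeP p h : measurable_fun Rpos h ->
  (sqint Rpos h < +oo)%E ->
  weak_derivative m
    (fun x => phi x * taylor_chain n p (fun x => h x * (u x)^-1) 0 x)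
    (multiplier_derivative p h).
Proof.
move=> mh hoo; apply: weak_derivative_multiplier => //.
exact: origin_integrable_div.
Qed.

Definition moment_condition k := exists B : R, forall r, 0 < r ->
  (sqint `]r, +oo[ (fun x => (G k x * v x)%R) *
   sqint `]0%R, r[ (fun x => (x ^+ (n - k) * (u x)^-1)%R) <= B%:E)%E.

(** A moment of h / u is dominated by the integral of |h rho| from 0, where
    rho = x^(n-k) / u, and the moment condition is what Hardy's inequality
    requires of the weights (phi x^k)^(m) v and rho. *)
Lemma moment_part_L2 p h : (forall k, (k < n.+1)%N -> moment_condition k) ->
  measurable_fun Rpos h -> (sqint Rpos h < +oo)%E ->
  (sqint Rpos (fun x => ((\sum_(k < n.+1)
     taylor_coef n p (fun x => h x * (u x)^-1) k x * G k x) * v x)%R) < +oo)%E.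
Proof.
move=> cond mh hoo.
have ih := origin_integrable_div ru mh hoo.
have mX k : measurable_fun Rpos (fun x : R => x ^+ k).
  by apply: measurable_funTS; exact: exprn_measurable.
have mmom k : measurable_fun Rpos (moment k (fun x => h x * (u x)^-1)).
  exact: primitive_measurable (moment_primitive k ih).
pose t k x : R := taylor_coef n p (fun x => h x * (u x)^-1) k x * (G k x * v x).
have -> : (fun x => ((\sum_(k < n.+1)
     taylor_coef n p (fun x => h x * (u x)^-1) k x * G k x) * v x)%R) =
   (fun x => \sum_(k <- iota 0 n.+1) t k x).
  apply/funext => x; rewrite mulr_suml -[iota 0 n.+1]/(index_iota 0 n.+1) big_mkord.
  by apply: eq_bigr => k _; rewrite /t mulrA.
have mGv k : (k < n.+1)%N -> measurable_fun Rpos (fun x => G k x * v x).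
  by move=> kn; apply: measurable_funM => //; exact: mG.
apply: sqint_sum_lty; first exact: measurable_Rpos.
  move=> k; rewrite mem_iota add0n /= => kn; apply: measurable_funM; last exact: mGv.
  by apply: measurable_funD => //; exact: measurable_funM.
move=> k; rewrite mem_iota add0n /= => kn.
rewrite (_ : t k = (fun x => p`_k * (G k x * v x) +
    kernel_coef n k * ((G k x * v x) * moment (n - k) (fun x => h x * (u x)^-1) x))); last first.
  by apply/funext => x; rewrite /t /taylor_coef; ring.
have mGvm : measurable_fun Rpos (fun x => (G k x * v x) *
    moment (n - k) (fun x => h x * (u x)^-1) x).
  by apply: measurable_funM => //; exact: mGv.
apply: sqintD_lty.
- exact: measurable_Rpos.
- by apply: measurable_funM => //; exact: mGv.
- exact: measurable_funM.
- rewrite sqintZ; [|exact: measurable_Rpos|exact: mGv].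
  by rewrite lte_mul_pinfty ?lee_fin ?sqr_ge0// Goo.
rewrite sqintZ; [|exact: measurable_Rpos|exact: mGvm].
rewrite lte_mul_pinfty ?lee_fin ?sqr_ge0//.
pose rho x : R := x ^+ (n - k) * (u x)^-1.
have mrho : measurable_fun Rpos rho by exact: measurable_funM.
have iq := origin_integrable_expM (n - k) ih.
have iabs : origin_integrable (fun t => `|h t * rho t|).
  have [lq iqy] := iq.
  have E : (fun t => `|h t * rho t|) = (fun t => `|t ^+ (n - k) * (h t * (u t)^-1)|).
    by apply/funext => x; congr (`|_|); rewrite /rho; ring.
  rewrite E; split; first exact: locint_norm.
  by move=> y y0; apply: integrable_norm; exact: iqy.
pose H x : R := 0 + \int[mu]_(s in `]0, x]) `|h s * rho s|.
have [labs iabsy] := iabs.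
have Hp : primitive H (fun t => `|h t * rho t|) := primitive_int 0 labs iabsy.
have H0 x : 0 <= H x by rewrite /H add0r; exact: Rintegral_ge0.
have rhooo r : 0 < r -> (sqint `]0%R, r[ rho < +oo)%E.
  move=> r0; have [_ _ _ uoo] := ru.
  have := @horner_sqint_lty R (fun x => (u x)^-1) mui uoo 'X^(n - k) 0 r (lexx _).
  by congr (_ < _)%E; apply: eq_integral => x _; rewrite hornerXn.
have oc_oo r : sqint `]0, r] rho = sqint `]0, r[ rho.
  rewrite /sqint [LHS]integral_itv_bndoo//.
  apply: measurable_sqr; apply: measurable_funS mrho; first exact: measurable_Rpos.
  exact: sub_Rpos_oo.
have [B HB] := cond k kn.
apply: (@le_lt_trans _ _ (sqint Rpos (fun x => (G k x * v x * H x)%R))).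
  apply: sqint_le => //; first exact: measurable_Rpos.
    by apply: measurable_funM; [exact: mGv|exact: primitive_measurable Hp].
  move=> x; rewrite RposE => x0; rewrite !normrM ler_wpM2l// [`|H x|]ger0_norm//.
  rewrite /H add0r /moment.
  apply: le_trans (le_normr_Rintegral _ (proj2 iq x x0)) _ => //.
  rewrite le_eqVlt; apply/orP; left; apply/eqP; apply: eq_Rintegral => s _.
  by congr (`|_|); rewrite /rho; ring.
apply: (@hardy _ _ rho h H B) => //.
- exact: mGv.
- exact: Goo.
- by move=> r r0; rewrite oc_oo; exact: rhooo.
- by move=> r r0; rewrite oc_oo; exact: HB.
Qed.

Lemma sobolev_of_conditions :
  (forall k, (k < n.+1)%N -> moment_condition k) ->
  (m = n.+1 -> exists M : R,
    \forall x \ae mu, Rpos x -> `|phi x * v x * (u x)^-1| <= M) ->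
  forall f, sobolev n.+1 u f -> sobolev m v (phi \* f).
Proof.
move=> cond bnd f wf; have [p [h [mh hoo fE]]] := sobolev_taylor ru wf.
have wD := multiplier_derivativeP p mh hoo.
have mf : measurable_fun Rpos f by case: wf => df [[]].
have phifE : (fun x => phi x * taylor_chain n p (fun x => h x * (u x)^-1) 0 x) =
    (phi \* f) %[ae mu in Rpos].
  by apply: aeS fE => x fx x0 /=; rewrite fx.
have [lphit lD _] := wD.
apply/sobolevP => //; exists (multiplier_derivative p h).
  apply: weak_derivative_ae wD => //; last exact: aeW.
  by apply: locint_ae phifE lphit; exact: measurable_funM.
have mD : measurable_fun Rpos (multiplier_derivative p h) by case: lD.
have mhu : measurable_fun Rpos (fun x => h x * (u x)^-1) by exact: measurable_funM.
have mpv : measurable_fun Rpos (fun x => phi x * v x * (u x)^-1).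
  by apply: measurable_funM => //; exact: measurable_funM.
have mrest : measurable_fun Rpos
    (fun x => (m == n.+1)%:R * ((phi x * v x * (u x)^-1) * h x)).
  by apply: measurable_funM => //; exact: measurable_funM.
have msum : measurable_fun Rpos (fun x => (\sum_(k < n.+1)
    taylor_coef n p (fun x => h x * (u x)^-1) k x * G k x) * v x).
  rewrite (_ : (fun x => _) = (fun x => multiplier_derivative p h x * v x -
      (m == n.+1)%:R * ((phi x * v x * (u x)^-1) * h x))).
    by apply: measurable_funB => //; exact: measurable_funM.
  by apply/funext => x; rewrite /multiplier_derivative; ring.
rewrite (_ : (fun x => _) = (fun x => (\sum_(k < n.+1)
    taylor_coef n p (fun x => h x * (u x)^-1) k x * G k x) * v x +
    (m == n.+1)%:R * ((phi x * v x * (u x)^-1) * h x))); last first.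
  by apply/funext => x; rewrite /multiplier_derivative; ring.
apply: sqintD_lty => //; [exact: measurable_Rpos|exact: moment_part_L2|].
have [mn|mn] := eqVneq m n.+1; last first.
  rewrite /sqint integral0_eq ?ltry// => x _.
  by rewrite mul0r expr0n.
have [M HM] := bnd mn.
apply: (@le_lt_trans _ _ ((M ^+ 2)%:E * sqint Rpos h)%E); last first.
  by rewrite lte_mul_pinfty ?lee_fin ?sqr_ge0.
rewrite -sqintZ//; last exact: measurable_Rpos.
apply: ae_ge0_le_integral.
- exact: measurable_Rpos.
- by move=> x _; rewrite lee_fin sqr_ge0.
- apply: measurable_sqr; move: mrest; rewrite mn eqxx; exact.
- by move=> x _; rewrite lee_fin sqr_ge0.
- by apply: measurable_sqr; exact: measurable_funM.
- apply: aeS HM => x HM x0; rewrite lee_fin mul1r !exprMn ler_wpM2r ?sqr_ge0//.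
  rewrite -!exprMn -[leLHS]real_normK ?num_real// lerXn2r ?nnegrE ?HM//.
  by rewrite (le_trans _ (HM x0)).
Qed.

Hypothesis mult : forall f, sobolev n.+1 u f -> sobolev m v (phi \* f).

Lemma multiplier_derivative_L2 p h : measurable_fun Rpos h ->
  (sqint Rpos h < +oo)%E ->
  (sqint Rpos (fun x => (multiplier_derivative p h x * v x)%R) < +oo)%E.
Proof.
move=> mh hoo; have wD := multiplier_derivativeP p mh hoo.
have /(sobolevP _ m_gt0 rv)[H wH Hoo] := mult (taylor_sobolev n p ru mh hoo).
have HD := weak_derivative_unique wH wD.
have [_ [mH _ _] _] := wH; have [_ [mD _ _] _] := wD.
rewrite -(@sqint_ae _ _ (fun x => H x * v x))//.
- exact: measurable_Rpos.
- exact: measurable_funM.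
- exact: measurable_funM.
- by apply: aeS HD => x Hx x0; rewrite Hx.
Qed.

(** Both the whole derivative of phi f and its moment part are
    square-integrable against v, so their difference is: multiplication by
    phi v / u acts on L_2. *)
Lemma multiplier_bounded : (forall k, (k < n.+1)%N -> moment_condition k) ->
  m = n.+1 -> exists M : R,
    \forall x \ae mu, Rpos x -> `|phi x * v x * (u x)^-1| <= M.
Proof.
move=> cond mn; apply: L2_multiplier_bounded.
  by apply: measurable_funM => //; exact: measurable_funM.
move=> y my yoo.
have h1 := multiplier_derivative_L2 0 my yoo.
have h2 := moment_part_L2 0 cond my yoo.
have [_ [mD _ _] _] := multiplier_derivativeP 0 my yoo.
have mpvy : measurable_fun Rpos (fun x => phi x * v x * (u x)^-1 * y x).
  by apply: measurable_funM => //; apply: measurable_funM => //; exact: measurable_funM.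
have mDv : measurable_fun Rpos (fun x => multiplier_derivative 0 y x * v x).
  exact: measurable_funM.
pose q x := (\sum_(k < n.+1)
    taylor_coef n 0 (fun x => y x * (u x)^-1) k x * G k x) * v x.
have DE x : multiplier_derivative 0 y x * v x = q x + phi x * v x * (u x)^-1 * y x.
  by rewrite /multiplier_derivative /q mn eqxx mul1r; ring.
have mq : measurable_fun Rpos q.
  rewrite (_ : q = (fun x => multiplier_derivative 0 y x * v x -
     phi x * v x * (u x)^-1 * y x)); first exact: measurable_funB.
  by apply/funext => x; rewrite DE addrK.
have h3 : (sqint Rpos (fun x => ((-1) * q x)%R) < +oo)%E.
  rewrite sqintZ//; last exact: measurable_Rpos.
  by rewrite lte_mul_pinfty ?lee_fin ?sqr_ge0.
have mNq : measurable_fun Rpos (fun x => -1 * q x) by exact: measurable_funM.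
have := sqintD_lty measurable_Rpos mDv mNq h1 h3.
by congr (sqint _ _ < _)%E; apply/funext => x; rewrite DE; ring.
Qed.

Variables (delta C : R).
Hypothesis u_gt0 : forall r, 0 < r -> (0 < sqint `]0%R, r[ (fun x => (u x)^-1%R))%E.
Hypothesis u_doubling : forall a b : R, 0 <= a -> a < b -> delta <= b - a ->
  (sqint `]a, b[ (fun x => (u x)^-1%R) <=
   C%:E * sqint `]((a + b) / 2 - (b - a) / 4)%R,
                  ((a + b) / 2 + (b - a) / 4)%R[ (fun x => (u x)^-1%R))%E.

(** For the gliding hump h, all the moments but one vanish on the gaps, where
    (phi f)^(m) is therefore a multiple of (phi x^k)^(m) alone, with norms
    tending to infinity. *)
Lemma multiplier_moment k : (k < n.+1)%N -> moment_condition k.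
Proof.
move=> kn; apply: contrapT => ncond.
have mw : measurable_fun Rpos (fun x => G k x * v x).
  by apply: measurable_funM => //; exact: mG.
have jn : (n - k < n.+1)%N by rewrite ltnS leq_subr.
have unb (B : R) : exists2 r, 0 < r & (B%:E < sqint `]r, +oo[ (fun x => (G k x * v x)%R) *
    sqint `]0%R, r[ (fun x => (x ^+ (n - k) * (u x)^-1)%R))%E.
  apply/not_exists2P => H; apply: ncond; exists B => r r0.
  by have [//|/negP] := H r; rewrite -leNgt.
have uoo : forall r, 0 < r -> (sqint `]0%R, r[ (fun x => (u x)^-1%R) < +oo)%E.
  by case: ru.
have [y [my yoo] hump] :=
  gliding_hump mui uoo u_gt0 u_doubling mw (Goo kn) jn unb.
have Doo := multiplier_derivative_L2 0 my yoo.
have [_ [mD _ _] _] := multiplier_derivativeP 0 my yoo.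
have mDv : measurable_fun Rpos (fun x => multiplier_derivative 0 y x * v x).
  exact: measurable_funM.
set I := sqint _ _ in Doo.
have I_fin : I \is a fin_num by rewrite ge0_fin_numE// sqint_ge0.
pose c := kernel_coef n k : R.
have c0 : 0 < c ^+ 2.
  rewrite exprn_even_gt0//= /c /kernel_coef !mulf_eq0 invr_eq0 signr_eq0/=.
  by rewrite !pnatr_eq0 negb_or -!lt0n bin_gt0 fact_gt0 andbT.
have key N : (c ^+ 2 * N%:R <= fine I).
  have [r [s' [T [r0 rs' onI NT]]]] := hump N.
  have mi : measurable (`]r, s'] : set R) by exact: measurable_itv.
  have sub : `]r, s'] `<=` @Rpos R by apply: sub_Rpos_oc; exact: ltW.
  have ms g : measurable_fun Rpos g -> measurable_fun (`]r, s']%classic : set R) g.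
    by move=> mg; apply: measurable_funS mg; [exact: measurable_Rpos|].
  have DE x : r < x <= s' -> multiplier_derivative 0 y x * v x =
      (c * T) * (G k x * v x).
    move=> xI; have [y0 mom] := onI x xI.
    rewrite /multiplier_derivative y0 mul0r !mulr0 addr0 (bigD1 (Ordinal kn))//=.
    rewrite big1 => [|i ik].
      by rewrite /taylor_coef coef0 mom// eqxx mul1r /c; ring.
    rewrite /taylor_coef coef0 mom; last by rewrite ltnS leq_subr.
    suff -> : (n - i == n - k)%N = false by rewrite mul0r mulr0 addr0 mul0r.
    apply/negbTE; apply: contra ik => /eqP ik; apply/eqP/val_inj => /=.
    by have := ltn_ord i; lia.
  rewrite -lee_fin fineK//.
  apply: (@le_trans _ _ (sqint `]r, s'] (fun x => (multiplier_derivative 0 y x * v x)%R))).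
    have -> : sqint `]r, s'] (fun x => (multiplier_derivative 0 y x * v x)%R) =
        (((c * T) ^+ 2)%:E * sqint `]r, s'] (fun x => (G k x * v x)%R))%E.
      rewrite -sqintZ//; last exact: ms.
      by apply: eq_integral => x /[1!inE]/=; rewrite in_itv/= => /DE ->.
    rewrite [(c * T) ^+ 2]exprMn (EFinM (c ^+ 2) (T ^+ 2)) (EFinM (c ^+ 2) N%:R) -muleA.
    by apply: lee_wpmul2l => //; rewrite lee_fin ltW.
  by apply: sqint_subset => //; exact: measurable_Rpos.
have I0 : 0 <= fine I / c ^+ 2 by rewrite divr_ge0 ?(ltW c0)// fine_ge0// sqint_ge0.
have := archi_boundP I0; set N := Num.bound _.
by rewrite ltr_pdivrMr// mulrC ltNge key.
Qed.

End multiplier.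

Lemma regular_weight_gt0 w r : regular_weight w -> 0 < r ->
  (0 < sqint `]0%R, r[ (fun x => (w x)^-1%R))%E.
Proof.
move=> [mw w0 mwi woo] r0; rewrite lt_neqAle sqint_ge0 andbT; apply/eqP => /esym S0.
have mi : measurable (`]0, r[%classic : set R) by exact: measurable_itv.
have mwr : measurable_fun (`]0, r[%classic : set R) (fun x => ((w x)^-1 ^+ 2)%:E).
  apply: measurable_sqr; apply: measurable_funS mwi; first exact: measurable_Rpos.
  exact: sub_Rpos_oo.
have : (\int[mu]_(x in `]0%R, r[) `|((w x)^-1 ^+ 2)%:E| = 0)%E.
  rewrite -S0; apply: eq_integral => x _.
  by rewrite gee0_abs// lee_fin sqr_ge0.
move=> /(ae_eq_integral_abs mu mi mwr) w1.
have : mu.-negligible (`]0, r[%classic : set R).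
  apply: negligibleS (aeI w0 w1) => x xr /= [h0 h1].
  have := h1 xr => -[] /eqP; rewrite sqrf_eq0 invr_eq0.
  by rewrite (negbTE (h0 (@sub_Rpos_oo R 0 r (lexx _) _ xr))).
move=> nr; have : mu (`]0, r[%classic : set R) = 0%E by apply: measure_negligible.
have -> : mu (`]0, r[%classic : set R) = r%:E.
  by rewrite lebesgue_measure_itv/= lte_fin r0 -EFinB subr0.
by move=> [] r00; move: r0; rewrite r00 ltxx.
Qed.

End spaces.

(** * Norm conditions as bounds on square integrals *)

Section translation.
Context {R : realType}.
Local Notation mu := (@lebesgue_measure R).
Implicit Types (f g h w u v phi : R -> R) (D : set R) (x y r : R) (n m i j k : nat).

(** The middle half of ]0, r + delta[ is away from the origin, so the doubling
    inequality turns local integrability into integrability up to 0. *)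
Lemma B_class_integral_lty u delta r : B_class delta (wpow_inv u 2) -> 0 <= delta ->
  0 < r -> (\int[mu]_(x in `]0%R, r[) wpow_inv u 2 x < +oo)%E.
Proof.
move=> [u0 [mu2 uK] [C HC]] delta0 r0; pose b := r + delta.
have b0 : 0 < b by rewrite /b; lra.
have w2ge0 x : (0 <= wpow_inv u 2 x)%E by rewrite wpow_inv2E poweR_ge0.
have ms D : measurable D -> D `<=` Rpos -> measurable_fun D (wpow_inv u 2).
  by move=> mD DR; apply: measurable_funS mu2; first exact: measurable_Rpos.
apply: (@le_lt_trans _ _ (\int[mu]_(x in `]0%R, b[) wpow_inv u 2 x)%E).
  apply: ge0_subset_integral => //.
    by apply: ms => //; exact: sub_Rpos_oo.
  by move=> x /=; rewrite !in_itv/= => /andP[-> xr] /=; rewrite /b; lra.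
apply: le_lt_trans (HC 0 b (lexx _) b0 _) _; first by rewrite /b; lra.
have fin : ((\int[mu]_(x in `]((0 + b) / 2 - (b - 0) / 4)%R,
    ((0 + b) / 2 + (b - 0) / 4)%R[)
    wpow_inv u 2 x)%E \is a fin_num).
  rewrite ge0_fin_numE; last exact: integral_ge0.
  set a1 := ((0 + b) / 2 - (b - 0) / 4)%R; set b1 := ((0 + b) / 2 + (b - 0) / 4)%R.
  have a10 : 0 < a1 by rewrite /a1; lra.
  have sub := @Rpos_itv R a1 b1 a10.
  apply: le_lt_trans (uK `[a1, b1]%classic sub (@segment_compact _ _ _)).
  under [leRHS]eq_integral do rewrite gee0_abs//.
  apply: ge0_subset_integral => //; first exact: ms.
  exact: subset_itv_oo_cc.
by rewrite -(fineK fin) -EFinM ltry.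
Qed.

Lemma regular_weight_L2loc v : measurable_fun Rpos v ->
  (forall r, 0 < r -> (LnormOn 2%:E `]0%R, r[ (wpow_inv v 1) < +oo)%E) ->
  regular_weight v.
Proof.
move=> mv vL2; apply: regular_weightP => // r r0.
rewrite (_ : (\int[mu]_(x in _) _)%E = (LnormOn 2%:E `]0%R, r[ (wpow_inv v 1) `^ 2)%E).
  by apply: poweR_lty; exact: vL2.
by rewrite LnormOn2_sqrE; apply: eq_integral => x _; rewrite wpow_inv2E.
Qed.

Lemma sup_conditionP u g k : regular_weight u ->
  (ereal_sup [set (LnormOn 2%:E [set` `]r, +oo[] (EFin \o g) *
     LnormOn 2%:E `]0%R, r[ (fun x => (x ^+ k)%:E * wpow_inv u 1 x))%E
     | r in Rpos] < +oo)%E <->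
  exists B : R, forall r, 0 < r -> (sqint `]r, +oo[ g *
    sqint `]0%R, r[ (fun x => (x ^+ k * (u x)^-1)%R) <= B%:E)%E.
Proof.
move=> ru.
pose P r := (sqint `]r, +oo[ g *
    sqint `]0%R, r[ (fun x => (x ^+ k * (u x)^-1)%R))%E.
have P0 r : (0 <= P r)%E by rewrite mule_ge0 ?sqint_ge0.
have E r : (LnormOn 2%:E [set` `]r, +oo[] (EFin \o g) *
     LnormOn 2%:E `]0%R, r[ (fun x => (x ^+ k)%:E * wpow_inv u 1 x))%E = (P r `^ 2^-1)%E.
  rewrite LnormOn2E LnormOn2_wpow//.
  - by rewrite poweRM ?sqint_ge0.
  - exact: sub_Rpos_oo.
under eq_imagel do rewrite E.
split => [soo|[B HB]].
  set s := ereal_sup _ in soo.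
  have Ps r : 0 < r -> (P r `^ 2^-1 <= s)%E.
    by move=> r0; apply: ereal_sup_ubound; exists r => //; rewrite RposE.
  have s0 : (0 <= s)%E by apply: le_trans (Ps 1 ltr01); exact: poweR_ge0.
  have s2 : (s `^ 2)%E \is a fin_num.
    by rewrite ge0_fin_numE ?poweR_ge0//; exact: poweR_lty.
  exists (fine (s `^ 2)%E) => r r0; rewrite fineK// -/(P r).
  rewrite -[P r]poweRe1// -[1 in X in (X <= _)%E](@mulVf _ 2)// poweRrM.
  apply: gt0_ler_poweR; rewrite ?in_itv/= ?leey ?andbT ?poweR_ge0//.
  exact: Ps.
apply: (@le_lt_trans _ _ (B%:E `^ 2^-1)%E); last by apply: poweR_lty; exact: ltry.
apply: ub_ereal_sup => _ [r r0 <-]; rewrite RposE in r0.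
apply: gt0_ler_poweR; rewrite ?in_itv/= ?leey ?andbT ?invr_ge0 ?P0//.
  by apply: le_trans (HB r r0); exact: P0.
exact: HB.
Qed.

Lemma essential_boundP u f : regular_weight u ->
  (LnormOn +oo%E Rpos (fun x => (f x)%:E * wpow_inv u 1 x) < +oo)%E <->
  exists M : R, \forall x \ae mu, Rpos x -> `|f x * (u x)^-1| <= M.
Proof.
move=> [_ u0 _ _]; rewrite /LnormOn unlock.
have -> : (0 < mu [set: R])%E.
  by rewrite -set_itvNyy lebesgue_measure_itv/= ltry.
split => [|[M HM]].
  set s := ess_sup _ _ => soo.
  have [M sM] : exists M : R, (s <= M%:E)%E.
    by case: s soo => // [t _|_]; [exists t|exists 0; exact: leNye].
  exists M; have /ess_supP H := sM.
  apply: aeS (aeI u0 H) => x [ux +] x0; rewrite /= patchE mem_set//.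
  by rewrite wpow_inv1E ?ux// -EFinM /= lee_fin.
apply: (@le_lt_trans _ _ (Num.max 0 M)%:E); last exact: ltry.
apply/ess_supP; apply: aeS (aeI u0 HM) => x [ux HMx] /=; rewrite patchE.
case: ifPn => [/set_mem x0|_]; last by rewrite abse0 lee_fin le_max lexx.
by rewrite wpow_inv1E ?ux// -EFinM /= lee_fin le_max HMx ?orbT.
Qed.

End translation.

Theorem theorem2 (R : realType) (l m : nat) (u v : R -> R) (delta : R)
  (m_gt0 : (0 < m)%N) (le_ml : (m <= l)%N)
  (wu : weight u) (wv : weight v)
  (delta_ge0 : 0 <= delta)
  (uB : B_class delta (wpow_inv u 2))
  (vL2 : forall r : R, 0 < r -> (LnormOn 2%:E `]0%R, r[ (wpow_inv v 1) < +oo)%E) :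
  multipliers (sobolev l u) (sobolev m v) =
  [set phi : R -> R |
    (forall k : nat, (k < l)%N ->
       exists g : R -> R,
         [/\ weak_derivative m (fun x => phi x * x ^+ k) g,
             (LnormOn 2%:E Rpos (EFin \o (g \* v)%R) < +oo)%E &
             (ereal_sup
                [set LnormOn 2%:E [set` `]r, +oo[] (EFin \o (g \* v)%R) *
                     LnormOn 2%:E `]0%R, r[
                       (fun x => (x ^+ (l - k - 1))%:E * wpow_inv u 1 x)
                | r in Rpos] < +oo)%E]) /\
    (m = l ->
       (LnormOn +oo%E Rpos
          (fun x => (phi x * v x)%:E * wpow_inv u 1 x) < +oo)%E)].
Proof.
have rv : regular_weight v by apply: regular_weight_L2loc => //; case: wv.
have ru : regular_weight u.
  by apply: regular_weightP => [|r r0]; [case: wu|exact: (B_class_integral_lty uB delta_ge0 r0)].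
have [mu_ u0 _ _] := ru.
have u_gt0 r := @regular_weight_gt0 R u r ru.
case: l le_ml => [|n le_mn]; first by rewrite leqNgt m_gt0.
have expE k : (n.+1 - k - 1 = n - k)%N by lia.
apply/seteqP; split => phi.
- move=> mult.
  have GE k : exists g, (k < n.+1)%N -> weak_derivative m (fun x => phi x * x ^+ k) g /\
      (sqint Rpos (fun x => (g x * v x)%R) < +oo)%E.
    (* outside the range of k any function will do *)
    have [kn|kn] := boolP (k < n.+1)%N; last by exists phi.
    have sk : sobolev n.+1 u (fun x => x ^+ k).
      apply/sobolevP => //; exists (fun=> 0).
        have := chain_weak_derivative (poly_chainP n.+1 ('X^k : {poly R})).
        have d0 : ('X^k : {poly R})^`(n.+1) = 0 by rewrite derivn_poly0 ?size_polyXn.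
        rewrite /poly_chain d0.
        congr weak_derivative; apply/funext => x; first by rewrite hornerXn.
        by rewrite horner0.
      by rewrite /sqint integral0_eq ?ltry// => x _; rewrite mul0r expr0n.
    by have /(sobolevP _ m_gt0 rv)[g wg goo] := mult _ sk; exists g.
  have [G HG] := choice GE.
  have wG k (kn : (k < n.+1)%N) := proj1 (HG k kn).
  have Goo k (kn : (k < n.+1)%N) := proj2 (HG k kn).
  have [_ _ [C HC]] := uB.
  have u_dbl (a b : R) : 0 <= a -> a < b -> delta <= b - a ->
    (sqint `]a, b[ (fun x => (u x)^-1%R) <=
     C%:E * sqint `]((a + b) / 2 - (b - a) / 4)%R,
                  ((a + b) / 2 + (b - a) / 4)%R[ (fun x => (u x)^-1%R))%E.
    have sub := @sub_Rpos_oo R.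
    move=> a0 ab dab; have := HC a b a0 ab dab.
    have m0 : 0 <= (a + b) / 2 - (b - a) / 4 by lra.
    rewrite (sqint_wpow mu_ u0 _ (sub a b a0))//.
    by rewrite (sqint_wpow mu_ u0 _ (sub _ ((a + b) / 2 + (b - a) / 4) m0)).
  have cond k : (k < n.+1)%N -> moment_condition n u v G k.
    exact: (multiplier_moment m_gt0 le_mn ru rv wG Goo mult u_gt0 u_dbl).
  split.
    move=> k kn; exists (G k); split; first exact: wG.
      by rewrite LnormOn2_ltyP; exact: Goo.
    by rewrite expE; apply/sup_conditionP => //; exact: cond.
  move=> mn; apply/essential_boundP => //.
  exact: (multiplier_bounded m_gt0 le_mn ru rv wG Goo mult cond mn).
- move=> [condk condinf] f wf.
  have GE k : exists g, (k < n.+1)%N -> [/\ weak_derivative m (fun x => phi x * x ^+ k) g,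
      (sqint Rpos (fun x => (g x * v x)%R) < +oo)%E &
      exists B : R, forall r, 0 < r -> (sqint `]r, +oo[ (fun x => (g x * v x)%R) *
        sqint `]0%R, r[ (fun x => (x ^+ (n - k) * (u x)^-1)%R) <= B%:E)%E].
    have [kn|kn] := boolP (k < n.+1)%N; last by exists phi.
    have [g [wg goo gsup]] := condk k kn; exists g => _; split => //.
      by move: goo; rewrite LnormOn2_ltyP.
    by move: gsup; rewrite expE => /(sup_conditionP _ _ ru).
  have [G HG] := choice GE.
  have wG k : (k < n.+1)%N -> weak_derivative m (fun x => phi x * x ^+ k) (G k).
    by move=> /HG[].
  have Goo k : (k < n.+1)%N -> (sqint Rpos (fun x => (G k x * v x)%R) < +oo)%E.
    by move=> /HG[].
  have cond k : (k < n.+1)%N -> moment_condition n u v G k by move=> /HG[].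
  apply: (sobolev_of_conditions m_gt0 le_mn ru rv wG Goo cond _ wf).
  by move=> mn; apply/(essential_boundP (fun x => phi x * v x) ru); exact: condinf.
Qed.
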